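(* For $i=1,\dots,N$ consider the parabolic agent $$\dot x_i(z,t)=\lambda_ix_i''(z,t)+a_i(z,t)x_i(z,t)+g_{1,i}^\top(z,t)d_i(t),\quad x_i'(0,t)=q_i(t)x_i(0,t)+g_{2,i}^\top(t)d_i(t),$$ $$x_i'(1,t)=q_i^\ell(t)x_i(1,t)+b_iu_i(t)+g_{3,i}^\top(t)d_i(t),\quad y_i(t)=c_ix_i(0,t)+g_{4,i}^\top(t)d_i(t),$$ ($z\in(0,1)$, $t>t_0$), with reference model $\dot w=Sw$, $r=p^\top w$ and disturbance model $\dot v_i=S_iv_i$, $d_i=P_iv_i$. Assume $\mu_i>0$, $i=1,\dots,N$. Let $k_i(z,\zeta,t)$ be the solution of the kernel equations, and $\pi_i^\top(z)$ and $\varphi_i^\top(z,t)$ the solutions of the reference and disturbance regulator equations given in the context. Then the state feedback regulator $$u_i(t)=\tfrac1{b_i}\Big(-k_{w,i}^\top w(t)-k_{v,i}^\top(t)v_i(t)-k_{1,i}(t)x_i(1,t)-\int_0^1k_{x,i}(\zeta,t)x_i(\zeta,t)\,d\zeta\Big)$$ with $$k_{1,i}(t)=-k_i(1,1,t)+q_i^\ell(t),\quad k_{x,i}(\zeta,t)=-k_{i,z}(1,\zeta,t),\quad k_{w,i}^\top=-\pi_{i,z}^\top(1),\quad k_{v,i}^\top(t)=\tilde g_{3,i}^\top(t)-\varphi_{i,z}^\top(1,t)$$ achieves output regulation, i.e. $\lim_{t\to\infty}(y_i(t)-r(t))=0$, $i=1,\dots,N$. Moreover, the dynamics of the tracking error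 $e_i(t)=\{e_i(z,t),z\in[0,1]\}$, $$e_i(z,t)=x_i(z,t)-\mathcal T_{c,i}^{-1}[\pi_i^\top,t](z)w(t)-\mathcal T_{c,i}^{-1}[\varphi_i^\top(\cdot,t),t](z)v_i(t),$$ are uniformly exponentially stable in the $L_2$-norm, i.e. $$\|e_i(t)\|_{L_2}\le M_ie^{-\mu_i(t-t_0)}\|e_i(t_0)\|_{L_2},\quad t\ge t_0,$$ for all $e_i(t_0)\in H^2(0,1)$, $i=1,\dots,N$, satisfying the boundary conditions of the tracking error dynamics, an $M_i\ge1$ and any $t_0\ge0$.
   Context: $\mathbb R^+_{t_0}=\{t>t_0\}$, $t_0\ge0$; primes are $z$-derivatives. $G_\alpha(\mathbb R^+_{t_0})$ is the Gevrey class of order $\alpha$: $f\in C^\infty(\mathbb R^+_{t_0})$ for which there exist positive constants $M$ and $R$ such that $\sup_{t\in K}|f^{(j)}(t)|\le\frac{M}{R^j}(j!)^\alpha$ for all $j\in\mathbb N_0$ and for any compact subset $K\subset\mathbb R^+_{t_0}$ (the constants $M,R$ being the same for all $K$). A product such as $C([0,1])\times G_\alpha(\mathbb R^+_{t_0})$ denotes functions of $(z,t)$ with the first regularity in $z$ and the second in $t$; $C_p$ means piecewise continuous. Standing assumptions: $\lambda_i>0$ constant (normalized system on $[0,1]$); $a_i\in C([0,1])\times G_\alpha(\mathbb R^+_{t_0})$ with $1\le\alpha<2$; $q_i,q_i^\ell\in G_\alpha(\mathbb R^+_{t_0})$; $b_i,c_i\in\mathbb R\setminus\{0\}$; $g_{1,i}\in(C_p([0,1])\times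 G_\alpha(\mathbb R^+_{t_0}))^{m_i}$, $g_{k,i}\in(G_\alpha(\mathbb R^+_{t_0}))^{m_i}$, $k=2,3,4$; $\tilde g_{k,i}^\top=g_{k,i}^\top P_i$, $k=1,\dots,4$; $w(t)\in\mathbb R^{n_w}$, $(p^\top,S)$ observable, $\sigma(S)\subset j\mathbb R$; $v_i(t)\in\mathbb R^{n_{v_i}}$, $(P_i,S_i)$ observable, $S_i$ diagonalizable, $\sigma(S_i)\subset j\mathbb R$. Kernel equations, on $\{0<\zeta<z<1\}\times\mathbb R^+_{t_0}$ (they have a strong solution that is in $G_\alpha(\mathbb R^+_{t_0})$ w.r.t. $t$): $k_{i,t}=\lambda_ik_{i,zz}-\lambda_ik_{i,\zeta\zeta}-(a_i(\zeta,t)+\mu_i)k_i$, $\;k_{i,\zeta}(z,0,t)=q_i(t)k_i(z,0,t)$, $\;k_i(z,z,t)=q_i(t)-\int_0^z\frac{a_i(\zeta,t)+\mu_i}{2\lambda_i}d\zeta$. Backstepping transformation: $\mathcal T_{c,i}[f,t](z)=f(z)-\int_0^zk_i(z,\zeta,t)f(\zeta)d\zeta$, with inverse $\mathcal T_{c,i}^{-1}$. Reference regulator equations: $\lambda_i\pi_{i,zz}^\top(z)-\mu_i\pi_i^\top(z)-\pi_i^\top(z)S=0$ on $(0,1)$, $\pi_{i,z}^\top(0)=0$, $c_i\pi_i^\top(0)=p^\top$, with $\pi_i(z)\in\mathbb R^{n_w}$. Disturbance regulator equations: $\varphi_{i,t}^\top=\lambda_i\varphi_{i,zz}^\top-\mu_i\varphi_i^\top-\varphi_i^\top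 S_i+h_{1,i}^\top$ on $(0,1)\times\mathbb R^+_{t_0}$, $\varphi_{i,z}^\top(0,t)=\tilde g_{2,i}^\top(t)$, $c_i\varphi_i^\top(0,t)=-\tilde g_{4,i}^\top(t)$, with $\varphi_i(z,t)\in\mathbb R^{n_{v_i}}$ and $h_{1,i}^\top(z,t)=k_i(z,0,t)\lambda_i\tilde g_{2,i}^\top(t)+\mathcal T_{c,i}[\tilde g_{1,i}^\top(\cdot,t),t](z)$. The boundary conditions of the tracking error dynamics are that $\mathcal T_{c,i}[e_i(t),t](z)$ has vanishing $z$-derivative at $z=0$ and $z=1$. *)

(* Defs.v *)
(* MathComp-Analysis; all real quantities live in an arbitrary R : realType. *)
From HB Require Import structures.
From mathcomp Require Export all_boot all_order all_algebra.
From mathcomp Require Export all_classical all_reals all_analysis.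
From mathcomp Require Export complex.
Set Implicit Arguments.
Unset Strict Implicit.
Unset Printing Implicit Defensive.
Import Order.TTheory GRing.Theory Num.Theory.
Import numFieldNormedType.Exports.
Local Open Scope classical_set_scope.
Local Open Scope ring_scope.

Section Calculus.
Variable R : realType.
Implicit Types (A : set R) (f : R -> R) (x : R -> R -> R).

(* Derivative relative to a set: two-sided at interior points of A, one-sided
   at the end points of an interval A. *)
Definition is_derive_in A f (z l : R) : Prop :=
  ((f y - f z) / (y - z)) @[y --> within A z^'] --> l.

Definition derivable_in A f (z : R) : Prop := exists l, is_derive_in A f z l.

Definition derive_in A f (z : R) : R :=
  lim (((f y - f z) / (y - z)) @[y --> within A z^']).

Definition C1_in A f : Prop :=
  (forall z, A z -> derivable_in A f z) /\
  {within A, continuous (derive_in A f)}.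

Definition I01 : set R := `[0, 1]%classic.

(* Partial derivatives of a function x of (z, t), z ranging over [0, 1]. *)
Definition dz x : R -> R -> R := fun z t => derive_in I01 (x^~ t) z.
Definition dt x : R -> R -> R := fun z t => derive1 (x z) t.

(* Regularity of a strong solution x(z, t), z in [0, 1], t >= s, of a parabolic
   equation; x_zz is not mentioned because it may jump in z. *)
Record strong_regularity (s : R) x : Prop := StrongRegularity {
  sr_cont : {within [set zt : R * R | I01 zt.1 /\ s <= zt.2],
    continuous (fun zt => x zt.1 zt.2)} ;
  sr_derivable_t : forall z t, I01 z -> s < t -> derivable (x z) t 1 ;
  sr_dt_cont : {within [set zt : R * R | I01 zt.1 /\ s < zt.2],
    continuous (fun zt => dt x zt.1 zt.2)} ;
  sr_C1 : forall t, s < t -> C1_in I01 (x^~ t)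
}.

(* x_zz(z, t) is defined and x_t = lam x_zz + F holds for all z in (0, 1),
   except possibly at the finitely many points where the piecewise continuous
   data jump. *)
Definition parabolic_pde (lam s : R) (F x : R -> R -> R) : Prop :=
  forall t, s < t -> exists D : seq R, forall z, 0 < z < 1 -> z \notin D ->
    derivable_in I01 (dz x ^~ t) z /\
    dt x z t = lam * dz (dz x) z t + F z t.

Definition L2norm f : \bar R :=
  'N[@lebesgue_measure R]_(2%:E)[EFin \o (f \_ I01)].

(* f is (the C^1 representative of) an element of H^2(0, 1). *)
Definition H2 f : Prop :=
  exists f1 f2 : R -> R,
    [/\ (f2 \_ I01) \in Lfun (@lebesgue_measure R) 2%:E,
        forall z, I01 z ->
          f1 z = f1 0 + \int[@lebesgue_measure R]_(y in `[0, z]) f2 y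
      & forall z, I01 z ->
          f z = f 0 + \int[@lebesgue_measure R]_(y in `[0, z]) f1 y].

Definition pw_continuous f : Prop :=
  [/\ exists D : seq R, forall z, I01 z -> z \notin D ->
        f y @[y --> within I01 (nbhs z)] --> f z,
      forall z, 0 < z <= 1 -> cvg (f @ z^'-)
    & forall z, 0 <= z < 1 -> cvg (f @ z^'+)].

End Calculus.

Section Gevrey.
Variable R : realType.

(* Gevrey estimates on (t0, +oo).  As the constants do not depend on the compact
   set K, the supremum over K and the quantification over K amount to a
   quantification over all t > t0.  The bound on f' yields a continuous
   extension to t0; f t0 denotes the value of this extension. *)
Definition gevrey_bounds (alpha t0 M rho : R) (f : R -> R) : Prop :=
  (forall (j : nat) t, t0 < t ->
     derivable (derive1n j f) t 1 /\
     `|derive1n j f t| <= M / rho ^+ j * (j`!%:R `^ alpha)) /\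
  f @ t0^'+ --> f t0.

Definition gevrey (alpha t0 : R) (f : R -> R) : Prop :=
  exists M rho, [/\ 0 < M, 0 < rho & gevrey_bounds alpha t0 M rho f].

(* Gevrey in t, uniformly with respect to a parameter y in Y. *)
Definition gevrey_unif (T : Type) (Y : set T) (alpha t0 : R) (f : T -> R -> R) :=
  exists M rho, [/\ 0 < M, 0 < rho &
    forall y, Y y -> gevrey_bounds alpha t0 M rho (f y)].

Definition C_gevrey (T : topologicalType) (Y : set T) (alpha t0 : R)
    (f : T -> R -> R) : Prop :=
  gevrey_unif Y alpha t0 f /\
  forall t, t0 < t -> {within Y, continuous (f^~ t)}.

Definition Cp_gevrey (alpha t0 : R) (f : R -> R -> R) : Prop :=
  gevrey_unif (@I01 R) alpha t0 f /\
  forall t, t0 < t -> pw_continuous (f^~ t).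

End Gevrey.

Section LinearSystems.
Variable R : realType.

(* v' = S v for t > s, with v right-continuous at the initial time s. *)
Definition lti_solution n (S : 'M[R]_n) (s : R) (v : R -> 'cV[R]_n) : Prop :=
  forall j : 'I_n,
    (forall t, s < t -> is_derive t 1 (fun r => v r j 0) ((S *m v t) j 0)) /\
    (v t j 0 @[t --> s^'+] --> v s j 0).

(* The output on [0, +oo) determines the initial state. *)
Definition observable l n (C : 'M[R]_(l, n)) (S : 'M[R]_n) : Prop :=
  forall v1 v2 : R -> 'cV[R]_n,
    lti_solution S 0 v1 -> lti_solution S 0 v2 ->
    (forall t, 0 <= t -> C *m v1 t = C *m v2 t) -> v1 0 = v2 0.

Definition complexify n (S : 'M[R]_n) : 'M[R[i]]_n :=
  map_mx (real_complex R) S.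

Definition imaginary_spectrum n (S : 'M[R]_n) : Prop :=
  forall s : R[i], eigenvalue (complexify S) s -> complex.Re s = 0.

Definition dot n (r : 'rV[R]_n) (c : 'cV[R]_n) : R := (r *m c) 0 0.

End LinearSystems.

Section Agents.
Variable R : realType.

(* Parabolic agent with its disturbance model v' = Sv v, d = P v. *)
Record agent : Type := Agent {
  lam : R ;
  a : R -> R -> R ;
  q : R -> R ;
  ql : R -> R ;
  b : R ;
  c : R ;
  m : nat ;
  g1 : R -> R -> 'cV[R]_m ;
  g2 : R -> 'cV[R]_m ;
  g3 : R -> 'cV[R]_m ;
  g4 : R -> 'cV[R]_m ;
  nv : nat ;
  P : 'M[R]_(m, nv) ;
  Sv : 'M[R]_nv
}.

Record admissible (alpha t0 : R) (A : agent) : Prop := Admissible {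
  lam_gt0 : 0 < lam A ;
  a_reg : C_gevrey (@I01 R) alpha t0 (a A) ;
  q_reg : gevrey alpha t0 (q A) ;
  ql_reg : gevrey alpha t0 (ql A) ;
  b_neq0 : b A != 0 ;
  c_neq0 : c A != 0 ;
  g1_reg : forall l, Cp_gevrey alpha t0 (fun z t => g1 A z t l 0) ;
  g2_reg : forall l, gevrey alpha t0 (fun t => g2 A t l 0) ;
  g3_reg : forall l, gevrey alpha t0 (fun t => g3 A t l 0) ;
  g4_reg : forall l, gevrey alpha t0 (fun t => g4 A t l 0) ;
  PSv_observable : observable (P A) (Sv A) ;
  Sv_diagonalizable : diagonalizable (complexify (Sv A)) ;
  Sv_spectrum : imaginary_spectrum (Sv A)
}.

Definition gt1 (A : agent) z t : 'rV[R]_(nv A) := (g1 A z t)^T *m P A.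
Definition gt2 (A : agent) t : 'rV[R]_(nv A) := (g2 A t)^T *m P A.
Definition gt3 (A : agent) t : 'rV[R]_(nv A) := (g3 A t)^T *m P A.
Definition gt4 (A : agent) t : 'rV[R]_(nv A) := (g4 A t)^T *m P A.

(* x solves the agent's initial boundary value problem on [s, +oo) for the
   disturbance d and the input u. *)
Record agent_solution (A : agent) (s : R) (d : R -> 'cV[R]_(m A)) (u : R -> R)
    (x : R -> R -> R) : Prop := AgentSolution {
  as_reg : strong_regularity s x ;
  as_pde : parabolic_pde (lam A) s
    (fun z t => a A z t * x z t + dot (g1 A z t)^T (d t)) x ;
  as_bc0 : forall t, s < t ->
    dz x 0 t = q A t * x 0 t + dot (g2 A t)^T (d t) ;
  as_bc1 : forall t, s < t ->
    dz x 1 t = ql A t * x 1 t + b A * u t + dot (g3 A t)^T (d t)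
}.

Definition output (A : agent) (d : R -> 'cV[R]_(m A)) (x : R -> R -> R)
    (t : R) : R :=
  c A * x 0 t + dot (g4 A t)^T (d t).

End Agents.

Section Regulator.
Variable R : realType.
Implicit Types (k : R -> R -> R -> R) (A : agent R).

Definition triangle : set (R * R) := [set zy | 0 <= zy.2 <= zy.1 /\ zy.1 <= 1].

(* Partial derivatives of k(z, y, t) on the triangle 0 <= y <= z <= 1. *)
Definition kernel_dz k (z y t : R) : R :=
  derive_in `[y, 1]%classic (fun z' => k z' y t) z.
Definition kernel_dy k (z y t : R) : R :=
  derive_in `[0, z]%classic (fun y' => k z y' t) y.

(* Strong solution of the kernel equations.  For a(., t) merely continuous the
   kernel is C^1 up to the boundary of the triangle, but k_zz and k_yy need not
   exist separately.  Accordingly k_zz - k_yy is understood as the derivative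
   (d/dz - d/dy)(k_z + k_y) of the continuous function k_z + k_y along the
   characteristic direction (1, -1); for a C^2 kernel this is the classical
   k_zz - k_yy. *)
Record kernel_solution (alpha t0 : R) A (mu : R) k : Prop := KernelSolution {
  ker_reg : C_gevrey triangle alpha t0 (fun zy t => k zy.1 zy.2 t) ;
  ker_pde : forall t, t0 < t -> exists kz ky : R -> R -> R,
    [/\ {within triangle, continuous (fun zy => kz zy.1 zy.2)},
        {within triangle, continuous (fun zy => ky zy.1 zy.2)},
        forall z y, triangle (z, y) ->
          is_derive_in `[y, 1]%classic (fun z' => k z' y t) z (kz z y) /\
          is_derive_in `[0, z]%classic (fun y' => k z y' t) y (ky z y)
      & forall z y, 0 < y -> y < z -> z < 1 -> exists box : R,
          is_derive (0 : R) 1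
            (fun h => kz (z + h) (y - h) + ky (z + h) (y - h)) box /\
          derive1 (k z y) t = lam A * box - (a A y t + mu) * k z y t] ;
  ker_bc0 : forall z t, 0 < z < 1 -> t0 < t ->
    kernel_dy k z 0 t = q A t * k z 0 t ;
  ker_diag : forall z t, 0 <= z <= 1 -> t0 < t ->
    k z z t = q A t -
      \int[@lebesgue_measure R]_(y in `[0, z]) ((a A y t + mu) / (2 * lam A))
}.

Definition Tc k (f : R -> R) (t z : R) : R :=
  f z - \int[@lebesgue_measure R]_(y in `[0, z]) (k z y t * f y).

(* T_c^-1[f, t]: the continuous g on [0, 1] with T_c[g, t] = f on [0, 1]
   (a Volterra equation of the second kind). *)
Definition Tc_inv k (f : R -> R) (t : R) : R -> R :=
  xget (fun=> 0)
    [set g : R -> R | {within @I01 R, continuous g} /\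
                      forall z, I01 z -> Tc k g t z = f z].

Definition Tc_row k n (f : R -> 'rV[R]_n) (t z : R) : 'rV[R]_n :=
  \row_j Tc k (fun y => f y 0 j) t z.
Definition Tc_inv_row k n (f : R -> 'rV[R]_n) (t z : R) : 'rV[R]_n :=
  \row_j Tc_inv k (fun y => f y 0 j) t z.

Definition dz_row n (f : R -> 'rV[R]_n) (z : R) : 'rV[R]_n :=
  \row_j derive_in (@I01 R) (fun y => f y 0 j) z.

Record reference_regulator nw (S : 'M[R]_nw) (p : 'cV[R]_nw) A (mu : R)
    (ppi : R -> 'rV[R]_nw) : Prop := ReferenceRegulator {
  rr_reg : forall j, C1_in (@I01 R) (fun z => ppi z 0 j) ;
  rr_reg2 : forall j z, 0 < z < 1 ->
    derivable_in (@I01 R) (fun y => dz_row ppi y 0 j) z ;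
  rr_ode : forall z, 0 < z < 1 ->
    lam A *: dz_row (dz_row ppi) z - mu *: ppi z - ppi z *m S = 0 ;
  rr_bc0 : dz_row ppi 0 = 0 ;
  rr_out : c A *: ppi 0 = p^T
}.

Definition h1 k A (z t : R) : 'rV[R]_(nv A) :=
  (k z 0 t * lam A) *: gt2 A t + Tc_row k (gt1 A ^~ t) t z.

Record disturbance_regulator (t0 : R) k A (mu : R)
    (phi : R -> R -> 'rV[R]_(nv A)) : Prop := DisturbanceRegulator {
  dr_reg : forall j, strong_regularity t0 (fun z t => phi z t 0 j) ;
  dr_pde : forall j, parabolic_pde (lam A) t0
    (fun z t => (- (mu *: phi z t) - phi z t *m Sv A + h1 k A z t) 0 j)
    (fun z t => phi z t 0 j) ;
  dr_bc0 : forall t, t0 < t -> dz_row (phi ^~ t) 0 = gt2 A t ;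
  dr_out : forall t, t0 < t -> c A *: phi 0 t = - gt4 A t
}.

Definition k_1 k A (t : R) : R := - k 1 1 t + ql A t.
Definition k_x k (y t : R) : R := - kernel_dz k 1 y t.
Definition k_w nw (ppi : R -> 'rV[R]_nw) : 'rV[R]_nw := - dz_row ppi 1.
Definition k_v A (phi : R -> R -> 'rV[R]_(nv A)) (t : R) : 'rV[R]_(nv A) :=
  gt3 A t - dz_row (phi ^~ t) 1.

Definition regulator nw k A (ppi : R -> 'rV[R]_nw)
    (phi : R -> R -> 'rV[R]_(nv A))
    (w : R -> 'cV[R]_nw) (v : R -> 'cV[R]_(nv A)) (x : R -> R -> R)
    (t : R) : R :=
  (b A)^-1 *
    (- dot (k_w ppi) (w t) - dot (k_v phi t) (v t) - k_1 k A t * x 1 t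
     - \int[@lebesgue_measure R]_(y in `[0, 1]) (k_x k y t * x y t)).

Record closed_loop nw (S : 'M[R]_nw) k A (ppi : R -> 'rV[R]_nw)
    (phi : R -> R -> 'rV[R]_(nv A)) (s : R)
    (w : R -> 'cV[R]_nw) (v : R -> 'cV[R]_(nv A)) (x : R -> R -> R) : Prop :=
  ClosedLoop {
  cl_w : lti_solution S s w ;
  cl_v : lti_solution (Sv A) s v ;
  cl_x : agent_solution s (fun t => P A *m v t) (regulator k ppi phi w v x) x
}.

Definition tracking_error nw k A (ppi : R -> 'rV[R]_nw)
    (phi : R -> R -> 'rV[R]_(nv A))
    (w : R -> 'cV[R]_nw) (v : R -> 'cV[R]_(nv A)) (x : R -> R -> R)
    (t z : R) : R :=
  x z t - dot (Tc_inv_row k ppi t z) (w t)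
        - dot (Tc_inv_row k (phi ^~ t) t z) (v t).

Definition error_bc k (t : R) (f : R -> R) : Prop :=
  is_derive_in (@I01 R) (Tc k f t) 0 0 /\ is_derive_in (@I01 R) (Tc k f t) 1 0.

End Regulator.

(* Main.v *)
(* The transformed error eps = T_c[x] - pi^T w - phi^T v solves
   eps_t = lam eps_zz - mu eps with homogeneous Neumann conditions.  The kernel
   has a second derivative only along characteristics, so this equation is
   obtained in z-integrated form.  Hence u = e^(mu (t - s)) eps solves the heat
   equation, and all its even moments int_0^1 u^(2n) dz are nonincreasing in t.
   The case n = 1 gives the L2 decay of eps, which passes to the tracking error
   because the Volterra operators T_c(t) and T_c(t)^-1 are bounded on L2
   uniformly in t (Cauchy-Schwarz and Gronwall).  Letting n tend to infinity
   bounds |u(0, t)| by the sup norm of the initial value, so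
   y - r = c eps(0, t) decays like e^(-mu t). *)
Require Import Defs.
From mathcomp Require Import all_boot all_order all_algebra.
From mathcomp Require Import all_classical all_reals all_analysis.
From mathcomp Require Import measurable_realfun ring lra zify.
Set Implicit Arguments.
Unset Strict Implicit.
Unset Printing Implicit Defensive.
Import Order.TTheory GRing.Theory Num.Theory.
Import numFieldNormedType.Exports.
Local Open Scope classical_set_scope.
Local Open Scope ring_scope.

(** * Integrals of locally bounded measurable functions *)

Section Integral.
Variable R : realType.
Implicit Types (f g : R -> R) (a b c : R).

(** Two obstacles shape the proof. The kernel has continuous first derivatives on the closed
    triangle, but inside it only k_z + k_y can be differentiated again, and only along (1, -1). The
    Volterra integral thus cannot be differentiated twice in z term by term; integrating all
    identities from 0 to z avoids this and also makes finitely many jumps of x_zz harmless. The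
    energy identity survives in this form: with V(z) = int_0^z u_t = lam u_z, the integral of
    u^(2n+1) u_t is integrated by parts, and the Neumann conditions read V(0) = V(1) = 0. Secondly,
    y - r is a point value, which the L2 norm does not control; the moments of all orders stand in
    for a maximum principle. Each kernel condition cancels one obstruction: the equation in the
    triangle removes [a] under the integral, the diagonal value removes it from the local term, and
    the condition at y = 0 removes x(0, t). The bound on the kernel is a Gevrey constant, hence the
    same at all times, which makes the stability constant independent of the initial time. *)

Lemma near_dist_lt (z e : R) : 0 < e -> \forall y \near z, `|z - y| < e.
Proof. by move=> e0; exists e. Qed.

Lemma near_gt (a z : R) : a < z -> \forall y \near z, a < y.
Proof.
move=> az; have := @near_dist_lt z (z - a); rewrite subr_gt0 => /(_ az).
by apply: filterS => y; rewrite ltr_norml; lra.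
Qed.

Lemma near_lt (b z : R) : z < b -> \forall y \near z, y < b.
Proof.
move=> zb; have := @near_dist_lt z (b - z); rewrite subr_gt0 => /(_ zb).
by apply: filterS => y; rewrite ltr_norml; lra.
Qed.

Definition J a b f : R := \int[@lebesgue_measure R]_(x in `[a, b]) f x.

(** An algebra of functions integrable over every compact interval. It contains the continuous
    functions and the piecewise continuous data extended by zero, so the rules for [J] need no
    separate integrability conditions. *)
Definition lbm f := measurable_fun setT f /\
  forall r : R, exists C : R, forall x : R, `|x| <= r -> `|f x| <= C.

Lemma lbm_continuous f : continuous f -> lbm f.
Proof.
move=> cf; split; first exact: continuous_measurable_fun.
move=> r; have [r0|r0] := leP 0 r; last first.
  by exists 0 => x xr; have := le_trans (normr_ge0 x) xr; rewrite leNgt r0.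
have cnf : continuous (fun x => `|f x|).
  by move=> x; apply: (continuous_comp (cf x)); exact: norm_continuous.
have rr : - r <= r by lra.
have [c _ H] := EVT_max rr (continuous_subspaceT cnf).
by exists `|f c| => x; rewrite ler_norml => xr; apply: H; rewrite in_itv.
Qed.

Lemma lbm_integrable f a b : lbm f ->
  (@lebesgue_measure R).-integrable `[a, b] (EFin \o f).
Proof.
move=> [mf bf]; apply: measurable_bounded_integrable => //.
- by rewrite /= lebesgue_measure_itv/=; case: ifPn => // _; rewrite -EFinB ltry.
- exact: measurable_funTS.
- have [C HC] := bf (Num.max `|a| `|b|).
  exists C; split; rewrite ?num_real// => M CM x /=; rewrite in_itv/= => /andP[ax xb].
  apply: le_trans (HC x _) (ltW CM); rewrite le_max.
  have [x0|x0] := leP 0 x.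
    by apply/orP; right; rewrite ger0_norm// ger0_norm// (le_trans x0).
  by apply/orP; left; rewrite ltr0_norm// ltr0_norm ?lerN2// (le_lt_trans ax).
Qed.

Lemma lbmD f g : lbm f -> lbm g -> lbm (fun x => f x + g x).
Proof.
move=> [mf bf] [mg bg]; split; first exact: measurable_funD.
move=> r; have [C hC] := bf r; have [D hD] := bg r; exists (C + D) => x xr.
by rewrite (le_trans (ler_normD _ _))// lerD ?hC ?hD.
Qed.

Lemma lbmM f g : lbm f -> lbm g -> lbm (fun x => f x * g x).
Proof.
move=> [mf bf] [mg bg]; split; first exact: measurable_funM.
move=> r; have [C hC] := bf r; have [D hD] := bg r; exists (C * D) => x xr.
by rewrite normrM ler_pM// ?hC ?hD.
Qed.

Lemma lbm_cst c : lbm (fun=> c).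
Proof. by apply: lbm_continuous; exact: cst_continuous. Qed.

Lemma lbmZ c f : lbm f -> lbm (fun x => c * f x).
Proof. by apply: lbmM; exact: lbm_cst. Qed.

Lemma lbmN f : lbm f -> lbm (fun x => - f x).
Proof. by move=> /(lbmZ (-1)); under eq_fun do rewrite mulN1r. Qed.

Lemma lbmB f g : lbm f -> lbm g -> lbm (fun x => f x - g x).
Proof. by move=> lf /lbmN; exact: lbmD. Qed.

Lemma lbm_norm f : lbm f -> lbm (fun x => `|f x|).
Proof.
move=> [mf bf]; split; first exact: measurableT_comp.
by move=> r; have [C hC] := bf r; exists C => x /hC; rewrite normr_id.
Qed.

Lemma lbm_sum (I : Type) (s : seq I) (F : I -> R -> R) :
  (forall i, lbm (F i)) -> lbm (fun x => \sum_(i <- s) F i x).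
Proof.
move=> hF; elim: s => [|i s IH].
  by under eq_fun do rewrite big_nil; exact: lbm_cst.
by under eq_fun do rewrite big_cons; exact: lbmD.
Qed.

Lemma J_ext a b f g : (forall x, a <= x <= b -> f x = g x) -> J a b f = J a b g.
Proof. by move=> fg; apply: eq_Rintegral => x; rewrite inE/= in_itv/= => /fg. Qed.

Lemma JD a b f g : lbm f -> lbm g ->
  J a b (fun x => f x + g x) = J a b f + J a b g.
Proof. by move=> lf lg; apply: RintegralD => //; exact: lbm_integrable. Qed.

Lemma JB a b f g : lbm f -> lbm g ->
  J a b (fun x => f x - g x) = J a b f - J a b g.
Proof. by move=> lf lg; apply: RintegralB => //; exact: lbm_integrable. Qed.

Lemma JZ a b c f : lbm f -> J a b (fun x => c * f x) = c * J a b f.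
Proof. by move=> lf; apply: RintegralZl => //; exact: lbm_integrable. Qed.

Lemma JN a b f : lbm f -> J a b (fun x => - f x) = - J a b f.
Proof.
by move=> lf; rewrite -mulN1r -JZ//; apply: J_ext => x _; rewrite mulN1r.
Qed.

Lemma J_cst a b c : a <= b -> J a b (fun=> c) = c * (b - a).
Proof.
move=> ab; rewrite /J Rintegral_cst//= lebesgue_measure_itv/= lte_fin.
case: ltP => //= ba; have -> : b = a by apply/le_anti; rewrite ab ba.
by rewrite subrr.
Qed.

Lemma J0 a b : J a b (fun=> 0) = 0.
Proof. by rewrite /J Rintegral_cst// mul0r. Qed.

Lemma J_sum (I : Type) (s : seq I) (F : I -> R -> R) a b :
  (forall i, lbm (F i)) ->
  J a b (fun x => \sum_(i <- s) F i x) = \sum_(i <- s) J a b (F i).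
Proof.
move=> hF; elim: s => [|i s IH].
  by rewrite big_nil; under eq_fun do rewrite big_nil; rewrite J0.
rewrite big_cons -IH -JD//; last exact: lbm_sum.
by apply: J_ext => x _; rewrite big_cons.
Qed.

Lemma J_gt a b f : b <= a -> J a b f = 0.
Proof.
rewrite le_eqVlt => /predU1P[->|ba]; rewrite /J.
  by rewrite set_itv1 Rintegral_set1.
by rewrite set_itv_ge ?Rintegral_set0// bnd_simp -ltNge.
Qed.

Lemma J_cat a b c f : lbm f -> a <= b -> b <= c -> J a b f + J b c f = J a c f.
Proof.
move=> lf ab bc; rewrite /J; apply/esym/eqP; rewrite addrC -subr_eq; apply/eqP.
rewrite Rintegral_itvB ?bnd_simp//; last exact: lbm_integrable.
rewrite Rintegral_itv_obnd_cbnd//; apply: integrableS (lbm_integrable b c lf) => //.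
by apply: subset_itvr; rewrite bnd_simp.
Qed.

Lemma le_J a b f g : lbm f -> lbm g -> (forall x, a <= x <= b -> f x <= g x) ->
  J a b f <= J a b g.
Proof.
move=> lf lg fg; apply: le_Rintegral => //; try exact: lbm_integrable.
Qed.

Lemma J_ge0 a b f : (forall x, a <= x <= b -> 0 <= f x) -> 0 <= J a b f.
Proof. by move=> f0; apply: Rintegral_ge0 => x /=; rewrite in_itv/= => /f0. Qed.

Lemma norm_J_le a b f : lbm f -> `|J a b f| <= J a b (fun x => `|f x|).
Proof. by move=> lf; apply: le_normr_Rintegral => //; exact: lbm_integrable. Qed.

Lemma J_bound a b (C : R) f : lbm f -> a <= b -> (forall x, a <= x <= b -> `|f x| <= C) ->
  `|J a b f| <= C * (b - a).
Proof.
move=> lf ab fC; rewrite (le_trans (norm_J_le a b lf))// -J_cst//.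
by apply: le_J => //; [exact: lbm_norm|exact: lbm_cst].
Qed.

(** For [b <= a] the integral [J a b f] is 0 and not the negative of the reversed one; the Lipschitz
    bound survives this convention, so upper limits may move freely past [a]. *)
Lemma J_lip a b b' (C r : R) f : lbm f -> `|a| <= r -> `|b| <= r -> `|b'| <= r ->
  (forall x : R, `|x| <= r -> `|f x| <= C) -> `|J a b f - J a b' f| <= C * `|b - b'|.
Proof.
move=> lf ar + + fC; wlog bb' : b b' / b' <= b.
  move=> H br b'r; have [?|/ltW ?] := leP b' b; first exact: H.
  by rewrite distrC [`|b - _|]distrC; apply: H.
move=> br b'r; rewrite [`|b - b'|]ger0_norm ?subr_ge0//.
have C0 : 0 <= C by rewrite (le_trans _ (fC _ ar)).
have nr (u v x : R) : `|u| <= r -> `|v| <= r -> u <= x <= v -> `|f x| <= C.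
  move=> + + /andP[ux xv]; rewrite !ler_norml => /andP[ru _] /andP[_ vr].
  by rewrite -ler_norml; apply: fC; rewrite ler_norml (le_trans ru ux) (le_trans xv vr).
have [ab'|/ltW b'a] := leP a b'.
  rewrite -(J_cat lf ab' bb') addrAC subrr add0r.
  by apply: J_bound => // x; exact: nr.
rewrite [X in _ - X]J_gt// subr0.
have [ab|/ltW ba] := leP a b; last by rewrite J_gt// normr0 mulr_ge0// subr_ge0.
rewrite (le_trans (J_bound (C := C) lf ab _))//; first by move=> x; exact: nr.
by rewrite ler_wpM2l// lerD2l lerN2.
Qed.

Lemma J_continuous a f : lbm f -> continuous (fun z => J a z f).
Proof.
move=> lf z; pose r : R := Num.max `|a| (`|z| + 1).
have [C fC] := lf.2 r.
have ar : `|a| <= r by rewrite le_max lexx.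
have zr : `|z| + 1 <= r by rewrite le_max lexx orbT.
have C0 : 0 <= C by rewrite (le_trans _ (fC _ ar)).
apply/cvgrPdist_le => /= e e0; near=> y.
have yz : `|z - y| < 1 by near: y; exact: near_dist_lt.
have yr : `|y| <= r.
  rewrite (le_trans _ zr)// -[y](subrK z) (le_trans (ler_normD _ _))//.
  by rewrite addrC lerD2l distrC ltW.
have z1r : `|z| <= r by rewrite (le_trans _ zr)// lerDl.
rewrite (le_trans (J_lip lf ar z1r yr fC))//.
have : `|z - y| < e / (C + 1).
  near: y; apply: near_dist_lt.
  by rewrite divr_gt0// ltr_wpDl.
rewrite ltr_pdivlMr ?ltr_wpDl// => /ltW H; apply: le_trans H.
by rewrite mulrC ler_wpM2l// lerDl.
Unshelve. all: by end_near. Qed.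

Lemma is_derive_J a z f : lbm f -> a < z -> {for z, continuous f} ->
  is_derive z (1:R) (fun z => J a z f) (f z).
Proof.
move=> lf az cf; have zz : z < z + 1 by rewrite ltrDl.
have [d1 d2] := continuous_FTC1_closed zz (lbm_integrable a (z+1) lf) az cf.
by apply: DeriveDef; [exact: d1|rewrite -derive1E; exact: d2].
Qed.

(** Induction on the exceptional points: one inside (a, b) splits the interval and continuity
    carries the value across it; with none left this is the mean value theorem. *)
Lemma derive0_cst a b (D : seq R) (f : R -> R) : a <= b -> continuous f ->
  (forall x, a < x < b -> x \notin D -> is_derive x (1:R) f 0) -> f b = f a.
Proof.
move=> + cf; elim: D a b => [|d D IH] a b ab fD.
  move: ab; rewrite le_eqVlt => /predU1P[->//|ab].
  have [|c _] := @MVT R f (fun=> 0) a b ab _ (continuous_subspaceT cf).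
    by move=> x; rewrite in_itv/= => /fD; apply.
  by rewrite mul0r => /eqP; rewrite subr_eq0 => /eqP.
have [/andP[ad db]|dab] := boolP (a < d < b); last first.
  apply: IH => // x xab xD; apply: fD => //; rewrite inE negb_or xD andbT.
  by apply: contraNneq dab => <-.
have -> : f b = f d.
  apply: IH (ltW db) _ => x /andP[dx xb] xD.
  by apply: fD; rewrite ?inE ?negb_or ?xD ?gt_eqF// (lt_trans ad dx).
apply: IH (ltW ad) _ => x /andP[ax xd] xD.
by apply: fD; rewrite ?inE ?negb_or ?xD ?lt_eqF// ax (lt_trans xd db).
Qed.

(** The difference between [J a z f] and [F z] is continuous in z with zero derivative off [D]. The
    exceptional set is there for second derivatives that jump with the data. *)
Lemma FTC a b (D : seq R) (F f : R -> R) : a <= b -> continuous F -> lbm f ->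
  (forall x, a < x < b -> x \notin D ->
    is_derive x (1:R) F (f x) /\ {for x, continuous f}) ->
  J a b f = F b - F a.
Proof.
move=> ab cF lf FD.
pose g z : R := J a z f - F z.
have : g b = g a.
  have cg : continuous g.
    by move=> z; apply: cvgB; [exact: J_continuous|exact: cF].
  apply: (@derive0_cst a b D g ab cg) => x xab xD.
  have [dF cf] := FD x xab xD.
  have dJ : is_derive x (1:R) (fun z => J a z f) (f x).
    by apply: is_derive_J => //; case/andP: xab.
  by apply: is_derive_eq (is_deriveB dJ dF) _; rewrite subrr.
by rewrite /g [J a a f]J_gt// sub0r => /eqP; rewrite subr_eq => /eqP ->; rewrite addrC.
Qed.

(** The constant 0 is a primitive of [f - g] off [D], because a finite list stays away from a
    neighbourhood of each point outside it. *)
Lemma J_ext_fin a b (D : seq R) f g : lbm f -> lbm g ->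
  (forall x, a < x < b -> x \notin D -> f x = g x) -> J a b f = J a b g.
Proof.
move=> lf lg fg; have [ab|/ltW ba] := leP a b; last by rewrite !J_gt.
apply/eqP; rewrite -subr_eq0 -JB//; apply/eqP.
rewrite (@FTC _ _ D (fun=> 0)) ?subrr//; first exact: cst_continuous.
  exact: lbmB.
move=> x xab xD; rewrite fg// subrr; split; first exact: is_derive_cst.
have nx : \forall y \near x, (fun=> 0) y = f y - g y.
  have /andP[ax xb] := xab.
  have nD : \forall y \near x, y \notin D.
    elim: D xD {fg} => [|d D IH]; first by move=> _; near=> y.
    rewrite inE negb_or => /andP[xd /IH nD]; near=> y.
    rewrite inE negb_or; apply/andP; split; last by near: y.
    have : `|x - y| < `|x - d|.
      near: y; apply: near_dist_lt.
      by rewrite normr_gt0 subr_eq0.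
    by apply: contraTneq => ->; rewrite ltxx.
  near=> y; rewrite fg ?subrr//; last by near: y.
  apply/andP; split; near: y.
    exact: near_gt.
  exact: near_lt.
rewrite /prop_for /continuous_at fg// subrr.
apply/cvgrPdist_le => e e0; near=> y.
by have <- : 0 = f y - g y; [near: y|rewrite subrr normr0 ltW].
Unshelve. all: by end_near. Qed.

End Integral.

(** * Continuity and differentiation of integrals in a parameter *)

Section ParametricIntegral.
Variable R : realType.
Implicit Types (f g : R -> R) (a b c : R).

(** Division-free form of the derivative: the point [y = x] is harmless, so estimates can be added
    without punctured neighbourhoods. *)
Lemma is_derive_epsP f (x l : R) : is_derive x (1:R) f l <->
  forall e : R, 0 < e -> \forall y \near x, `|f y - f x - l * (y - x)| <= e * `|y - x|.
Proof.
split=> [[df <-] e e0|H].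
  have /cvgrPdist_le/(_ e e0)[d /= d0 Hd] := df.
  exists d => // y /= yd; have [->|yx] := eqVneq y x.
    by rewrite !subrr mulr0 subrr normr0 mulr0.
  have yx0 : y - x != 0 by rewrite subr_eq0.
  have /= := Hd (y - x); rewrite sub0r normrN distrC => /(_ yd yx0).
  rewrite /shift/= [_%:A]mulr1 subrK => Hy.
  have -> : f y - f x - 'D_1 f x * (y - x) =
      - ('D_1 f x - (y - x)^-1 * (f y - f x)) * (y - x) by field.
  by rewrite normrM normrN [`|y - x|]distrC ler_wpM2r.
have D : h^-1 *: ((f \o shift x) (h *: 1) - f x) @[h --> 0^'] --> l.
  apply/cvgrPdist_le => e e0; have [d /= d0 Hd] := H e e0.
  exists d => // h /=; rewrite sub0r normrN => hd h0.
  have := Hd (h + x); rewrite /= distrC addrK => /(_ hd).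
  rewrite [_%:A]mulr1 => Hy.
  have -> : l - h^-1 *: (f (h + x) - f x) = - (f (h + x) - f x - l * h) / h.
    by rewrite /GRing.scale/=; field.
  by rewrite normrM normrN normfV ler_pdivrMr// normr_gt0.
by apply: DeriveDef; [apply/cvg_ex; exists l|exact: cvg_lim D].
Qed.

(** Compactness of the segment makes pointwise joint continuity uniform in y. This uniformity takes
    the place of dominated convergence below. *)
Lemma tube (T : topologicalType) (m : T -> R -> R) (p0 : T) a b :
  (forall y, a <= y <= b -> {for (p0, y), continuous (fun q : T * R => m q.1 q.2)}) ->
  forall e : R, 0 < e ->
  \forall p \near p0, forall y, a <= y <= b -> `|m p y - m p0 y| <= e.
Proof.
move=> cm e e0.
have /compact_near_coveringP/(_ T (nbhs p0) (fun p y => `|m p y - m p0 y| <= e) _) :=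
  @segment_compact R a b.
move=> H; have {}H := H _.
near=> p => y yab; have : (`[a, b] `<=` [set y | `|m p y - m p0 y| <= e]).
  near: p; apply: H => y0 /=; rewrite in_itv/= => /cm cy.
  have e2 : 0 < e / 2 by rewrite divr_gt0.
  have /cvgrPdist_lt/(_ _ e2) [[U V]/= [Up Vy] UV] := cy.
  exists (V, U) => //= -[y' p'] /= [Vy' Up'].
  have := UV (p', y') (conj Up' Vy').
  have := UV (p0, y') (conj (nbhs_singleton Up) Vy') => /= h1 h2.
  rewrite -(subrKA (m p0 y0)) (le_trans (ler_normD _ _))// [leRHS]splitr.
  by rewrite lerD// ltW// distrC.
by move=> /(_ y) /=; rewrite in_itv/=; exact.
Unshelve. all: by end_near. Qed.

Lemma J_continuous_param (T : topologicalType) (m : T -> R -> R) (beta : T -> R) a (p0 : T) :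
  {for p0, continuous beta} ->
  (forall y, {for (p0, y), continuous (fun q : T * R => m q.1 q.2)}) ->
  (\forall p \near p0, lbm (m p)) ->
  {for p0, continuous (fun p => J a (beta p) (m p))}.
Proof.
move=> cb cm lm.
have lm0 : lbm (m p0) := nbhs_singleton lm.
rewrite /prop_for /continuous_at.
rewrite (_ : (fun p => _) = (fun p => J a (beta p) (m p0) +
   (J a (beta p) (m p) - J a (beta p) (m p0)))); last first.
  by apply/funext => p; rewrite addrC subrK.
rewrite -[J a (beta p0) (m p0)]addr0; apply: cvgD.
  by apply: (@continuous_comp _ _ _ beta (fun z => J a z (m p0)) p0 cb); exact: J_continuous.
apply/cvgrPdist_le => /= e e0.
(* Bounds the length of the integration interval for [p] near [p0]; the maximum with 1 keeps it
   positive when [beta p0] lies far to the left of [a]. *)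
pose r : R := Num.max 1 (`|beta p0| + 1 - a).
have r0 : 0 < r by rewrite lt_max ltr01.
near=> p; rewrite sub0r normrN -JB//; last by near: p.
have [ab|/ltW ba] := leP a (beta p); last by rewrite J_gt// normr0 ltW.
have h1 y : a <= y <= beta p -> `|m p y - m p0 y| <= e / r.
  move=> /andP[ay yb].
  have : a <= y <= `|beta p0| + 1.
    rewrite ay (le_trans yb)// -(subrK (beta p0) (beta p)) addrC lerD ?ler_norm//.
    rewrite (le_trans (ler_norm _))// distrC ltW//.
    by near: p; apply: cvgr_dist_lt.
  move: y {ay yb}; near: p; apply: tube => //; exact: divr_gt0.
rewrite (le_trans (J_bound _ ab h1))//; first by apply: lbmB => //; near: p.
rewrite -mulrA mulrC -ler_pdivlMr// divff ?gt_eqF// ler_pdivrMl// mulr1.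
rewrite le_max; apply/orP; right; rewrite lerD2r.
rewrite -(subrK (beta p0) (beta p)) addrC lerD ?ler_norm//.
rewrite (le_trans (ler_norm _))// distrC ltW//.
by near: p; apply: cvgr_dist_lt.
Unshelve. all: by end_near. Qed.

(** For each y the mean value theorem in s expresses the increment of [h] by a value of [hs] at an
    intermediate time, and [tube] makes that value close to [hs s y] uniformly in y. *)
Lemma is_derive_under_J (h hs : R -> R -> R) a b (s : R) : a <= b ->
  (\forall s' \near s, lbm (h s') /\
     forall y, a <= y <= b -> is_derive s' (1:R) (h^~ y) (hs s' y)) ->
  (forall y, a <= y <= b -> {for (s, y), continuous (fun q : R * R => hs q.1 q.2)}) ->
  lbm (hs s) ->
  is_derive s (1:R) (fun s => J a b (h s)) (J a b (hs s)).
Proof.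
move=> ab nh chs lhs; apply/is_derive_epsP => e e0.
(* The summand 1 keeps the denominator positive when [a = b]. *)
pose r : R := e / (b - a + 1).
have r0 : 0 < r by rewrite divr_gt0// ltr_wpDl// subr_ge0.
have [d /= d0 hd] := nh; have lh0 := (nbhs_singleton nh).1.
have [d' /= d'0 hd'] := tube chs r0.
near=> s'.
have sd : `|s - s'| < d by near: s'; exact: near_dist_lt.
have sd' : `|s - s'| < d' by near: s'; exact: near_dist_lt.
have lhs' : lbm (h s') := (hd s' sd).1.
rewrite mulrC -JZ// -!JB//; [|exact: lbmB|exact: lbmZ].
have key y : a <= y <= b ->
    `|h s' y - h s y - (s' - s) * hs s y| <= r * `|s' - s|.
  move=> yab.
  have mvt (u v : R) : u <= v -> (forall x, u <= x <= v -> `|s - x| < d /\ `|s - x| < d') ->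
      `|h v y - h u y - (v - u) * hs s y| <= r * `|v - u|.
    move=> uv Huv.
    have dh (x : R) : x \in `]u, v[ -> is_derive x (1:R) (h^~ y) (hs x y).
      rewrite in_itv/= => /andP[ux xv].
      have [xd _] := Huv x (introT andP (conj (ltW ux) (ltW xv))).
      by have [_] := hd x xd; exact.
    have ch : {within `[u, v], continuous (h^~ y)}.
      apply: derivable_within_continuous => x; rewrite in_itv/= => xuv.
      have [xd _] := Huv x xuv.
      by have [_ /(_ y yab)[]] := hd x xd.
    have [x xuv ->] := MVT_segment uv dh ch.
    rewrite mulrC -mulrBr normrM mulrC ler_wpM2r//.
    by apply: hd' => //=; have [] := Huv x xuv.
  have [ss'|/ltW s's] := leP s s'.
    apply: mvt => // x /andP[sx xs'].
    have : `|s - x| <= `|s - s'| by rewrite !ler0_norm ?subr_le0//; lra.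
    by split; exact: le_lt_trans sd || exact: le_lt_trans sd'.
  have -> : h s' y - h s y - (s' - s) * hs s y = - (h s y - h s' y - (s - s') * hs s y) by ring.
  rewrite normrN [`|s' - s|]distrC; apply: mvt => // x /andP[sx xs'].
  have : `|s - x| <= `|s - s'| by rewrite !ger0_norm ?subr_ge0//; lra.
  by split; exact: le_lt_trans sd || exact: le_lt_trans sd'.
rewrite (le_trans (J_bound _ ab key))//; first by apply: lbmB; [exact: lbmB|exact: lbmZ].
rewrite mulrAC ler_wpM2r// /r -mulrA ler_piMr ?(ltW e0)//.
by rewrite mulrC ler_pdivrMr ?mul1r ?lerDl// ltr_wpDl// subr_ge0.
Unshelve. all: by end_near. Qed.

Lemma pair_continuous_at (T U V : topologicalType) (f : T -> U) (g : T -> V) (x : T) :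
  {for x, continuous f} -> {for x, continuous g} ->
  {for x, continuous (fun y => (f y, g y))}.
Proof. by move=> cf cg; exact: (cvg_pair cf cg). Qed.

Lemma continuous_section (m : R -> R -> R) (s : R) :
  continuous (fun q : R * R => m q.1 q.2) -> continuous (m s).
Proof.
move=> cm y; apply: (@continuous_comp _ _ _ (fun y : R => (s, y)) (fun q : R * R => m q.1 q.2)).
  by apply: pair_continuous_at; [exact: cvg_cst|exact: cvg_id].
exact: cm.
Qed.

Lemma continuous_section2 (m : R -> R -> R) (y : R) :
  continuous (fun q : R * R => m q.1 q.2) -> continuous (m^~ y).
Proof.
move=> cm s; apply: (@continuous_comp _ _ _ (fun s : R => (s, y)) (fun q : R * R => m q.1 q.2)).
  by apply: pair_continuous_at; [exact: cvg_id|exact: cvg_cst].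
exact: cm.
Qed.

(** The increment is split into the change of the integrand at the fixed limit [c * s] and the
    change of the limit with the new integrand, each worth [e / 2]. Both [c = 1] and [c = 2] occur,
    the latter in characteristic coordinates. *)
Lemma is_derive_Leibniz (h hs : R -> R -> R) (s c : R) :
  continuous (fun q : R * R => h q.1 q.2) ->
  continuous (fun q : R * R => hs q.1 q.2) -> 0 < c -> 0 < s ->
  (forall s' y : R, 0 < s' -> is_derive s' (1:R) (h^~ y) (hs s' y)) ->
  is_derive s (1:R) (fun s => J 0 (c * s) (h s)) (c * h s (c * s) + J 0 (c * s) (hs s)).
Proof.
move=> ch chs c0 s0 dh.
have lh s' : lbm (h s') by exact/lbm_continuous/continuous_section.
have lhs s' : lbm (hs s') by exact/lbm_continuous/continuous_section.
apply/is_derive_epsP => e e0.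
have e2 : 0 < e / 2 by rewrite divr_gt0.
have cs0 : 0 <= c * s by rewrite mulr_ge0 ?ltW.
have /is_derive_epsP/(_ _ e2) D : is_derive s (1:R) (fun s' => J 0 (c * s) (h s')) (J 0 (c * s) (hs s)).
  apply: is_derive_under_J => //; last by move=> y _; exact: chs.
  near=> s'; split => // y _; apply: dh; near: s'; exact: near_gt.
have ec : 0 < e / 2 / c by rewrite divr_gt0.
have /cvgrPdist_le/(_ _ ec) : {for (s, c * s), continuous (fun q : R * R => h q.1 q.2)} by exact: ch.
move=> [[U V]/= [[d1 /= d10 Us] [d2 /= d20 Vs]] UV].
near=> s'.
have s'0 : 0 < s' by near: s'; exact: near_gt.
have sd : `|s - s'| < d1 by near: s'; exact: near_dist_lt.
have sd' : `|s - s'| < d2 / c.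
  by near: s'; apply: near_dist_lt; exact: divr_gt0.
have cs'0 : 0 <= c * s' by rewrite mulr_ge0 ?ltW.
have D1 : `|J 0 (c * s) (h s') - J 0 (c * s) (h s) - J 0 (c * s) (hs s) * (s' - s)|
   <= e / 2 * `|s' - s| by near: s'.
have D2 : `|J 0 (c * s') (h s') - J 0 (c * s) (h s') - c * h s (c * s) * (s' - s)|
   <= e / 2 * `|s' - s|.
  pose g y := h s' y - h s (c * s).
  have lg : lbm g by apply: lbmB => //; exact: lbm_cst.
  have E b : 0 <= b -> J 0 b (h s') = J 0 b g + h s (c * s) * b.
    move=> b0; rewrite JB//; last exact: lbm_cst.
    by rewrite J_cst// subr0 subrK.
  rewrite !E//.
  have -> : J 0 (c * s') g + h s (c * s) * (c * s') -
    (J 0 (c * s) g + h s (c * s) * (c * s)) - c * h s (c * s) * (s' - s)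
    = J 0 (c * s') g - J 0 (c * s) g by ring.
  have gb (u v : R) : 0 <= u -> u <= v -> (forall x, u <= x <= v -> `|c * s - x| < d2) ->
     `|J 0 v g - J 0 u g| <= e / 2 / c * `|v - u|.
    move=> u0 uv Huv; rewrite -(J_cat lg u0 uv) addrAC subrr add0r (ger0_norm (_ : 0 <= v - u)) ?subr_ge0//.
    apply: J_bound => // x xuv; rewrite /g distrC.
    by apply: (UV (s', x)); split; [exact: Us|exact/Vs/Huv].
  have bnd x : `|c * s - x| <= c * `|s - s'| -> `|c * s - x| < d2.
    by move/le_lt_trans; apply; rewrite mulrC -ltr_pdivlMr.
  have -> : e / 2 * `|s' - s| = e / 2 / c * `|c * s' - c * s|.
    by rewrite -mulrBr normrM (gtr0_norm c0); field; rewrite gt_eqF.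
  have cc : `|c * s - c * s'| = c * `|s - s'| by rewrite -mulrBr normrM (gtr0_norm c0).
  have [ss'|/ltW ss'] := leP (c * s) (c * s').
    apply: gb => // x /andP[x1 x2]; apply: bnd; rewrite -cc !ler0_norm ?subr_le0//; lra.
  rewrite distrC [`|_ - c * s|]distrC.
  apply: gb => // x /andP[x1 x2]; apply: bnd; rewrite -cc !ger0_norm ?subr_ge0//; lra.
rewrite [e]splitr mulrDl.
rewrite mulrDl (le_trans _ (lerD D2 D1))// (le_trans _ (ler_normD _ _))//.
by rewrite le_eqVlt; apply/orP; left; apply/eqP; congr `|_|; ring.
Unshelve. all: by end_near. Qed.

End ParametricIntegral.

(** * Joint continuity and retractions *)

Section Continuity2.
Variable R : realType.

Lemma continuous_at_comp2 (T : topologicalType) (f g : T -> R) (m : R -> R -> R) (x : T) :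
  {for x, continuous f} -> {for x, continuous g} ->
  {for (f x, g x), continuous (fun q : R * R => m q.1 q.2)} ->
  {for x, continuous (fun t => m (f t) (g t))}.
Proof.
move=> cf cg cm.
exact: (@continuous_comp _ _ _ (fun t => (f t, g t)) (fun q : R * R => m q.1 q.2) x
  (pair_continuous_at cf cg) cm).
Qed.

Lemma continuous_comp2 (T : topologicalType) (f g : T -> R) (m : R -> R -> R) :
  continuous f -> continuous g -> continuous (fun q : R * R => m q.1 q.2) ->
  continuous (fun t => m (f t) (g t)).
Proof. by move=> cf cg cm x; apply: continuous_at_comp2; [exact: cf|exact: cg|exact: cm]. Qed.

Lemma continuous_comp1 (T : topologicalType) (f : T -> R) (g : R -> R) :
  continuous f -> continuous g -> continuous (fun t => g (f t)).
Proof. by move=> cf cg x; apply: (@continuous_comp _ _ _ f g); [exact: cf|exact: cg]. Qed.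

Lemma continuous_add (T : topologicalType) (f g : T -> R) :
  continuous f -> continuous g -> continuous (fun t => f t + g t).
Proof. by move=> cf cg x; apply: cvgD; [exact: cf|exact: cg]. Qed.

Lemma continuous_sub (T : topologicalType) (f g : T -> R) :
  continuous f -> continuous g -> continuous (fun t => f t - g t).
Proof. by move=> cf cg x; apply: cvgB; [exact: cf|exact: cg]. Qed.

Lemma continuous_mul (T : topologicalType) (f g : T -> R) :
  continuous f -> continuous g -> continuous (fun t => f t * g t).
Proof. by move=> cf cg x; apply: cvgM; [exact: cf|exact: cg]. Qed.

Lemma continuous_fst : continuous (fun q : R * R => q.1).
Proof. by move=> q; exact: cvg_fst. Qed.

Lemma continuous_snd : continuous (fun q : R * R => q.2).
Proof. by move=> q; exact: cvg_snd. Qed.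

Lemma continuous_const (T : topologicalType) (c : R) : continuous (fun _ : T => c).
Proof. by move=> q; exact: cvg_cst. Qed.

Lemma continuous_ident : continuous (fun x : R => x).
Proof. by move=> q; exact: cvg_id. Qed.

Lemma continuous_max (T : topologicalType) (f g : T -> R) :
  continuous f -> continuous g -> continuous (fun t => Num.max (f t) (g t)).
Proof. by move=> cf cg x; apply: continuous_max; [exact: cf|exact: cg]. Qed.

Lemma continuous_min (T : topologicalType) (f g : T -> R) :
  continuous f -> continuous g -> continuous (fun t => Num.min (f t) (g t)).
Proof. by move=> cf cg x; apply: continuous_min; [exact: cf|exact: cg]. Qed.

Lemma continuous_J (T : topologicalType) (a : R) (beta : T -> R) (m : T -> R -> R) :
  continuous beta -> continuous (fun q : T * R => m q.1 q.2) ->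
  continuous (fun p => J a (beta p) (m p)).
Proof.
move=> cb cm p; apply: J_continuous_param; [exact: cb|by move=> y; exact: cm|].
near=> p'; apply: lbm_continuous => y.
apply: (@continuous_comp _ _ _ (fun y : R => (p', y)) (fun q : T * R => m q.1 q.2)).
  by apply: pair_continuous_at; [exact: cvg_cst|exact: cvg_id].
exact: cm.
Unshelve. all: by end_near. Qed.

Definition clip (l h z : R) := Num.min (Num.max l z) h.

Lemma clip_itv (l h z : R) : l <= h -> l <= clip l h z <= h.
Proof. by move=> lh; rewrite /clip le_min le_max lexx lh ge_min lexx orbT. Qed.

Lemma clip_id (l h z : R) : l <= z <= h -> clip l h z = z.
Proof. by move=> /andP[lz zh]; rewrite /clip max_r// min_l. Qed.

Lemma continuous_clip (T : topologicalType) (l h z : T -> R) :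
  continuous l -> continuous h -> continuous z -> continuous (fun t => clip (l t) (h t) (z t)).
Proof. by move=> cl ch cz; apply: continuous_min => //; exact: continuous_max. Qed.

(* Composition with the retractions [cl] and [clip] extends functions given on
   [0, 1] or on the triangle to the whole line or plane, where continuity need
   not be relativized. *)
Definition cl (z : R) := clip 0 1 z.

Lemma cl_itv (z : R) : 0 <= cl z <= 1. Proof. by apply: clip_itv; exact: ler01. Qed.

Lemma cl_id (z : R) : 0 <= z <= 1 -> cl z = z. Proof. exact: clip_id. Qed.

Lemma continuous_cl : continuous cl.
Proof. by apply: continuous_clip; [exact: continuous_const|exact: continuous_const|exact: continuous_ident]. Qed.

End Continuity2.

Ltac ctn := repeat (first
  [ assumption
  | exact: continuous_fst | exact: continuous_snd | exact: continuous_ident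
  | exact: continuous_const | exact: continuous_cl
  | apply: continuous_sub | apply: continuous_add | apply: continuous_mul
  | apply: continuous_clip
  | apply: continuous_min | apply: continuous_max ]).

(** * Integrated derivatives of the Volterra transform *)

Section Kernel.
Variable R : realType.
Local Notation cont2 m := (continuous (fun q : R * R => m q.1 q.2)).

(* h' follows h for lo y <= z <= hi y and is affine in z elsewhere, which makes
   it differentiable in z across the boundary of the domain of h. *)
Lemma is_derive_ext_domain (h hs : R -> R -> R) (lo hi : R -> R) :
  cont2 h -> cont2 hs -> continuous lo -> continuous hi ->
  (forall y, 0 <= lo y <= hi y) ->
  exists h' hs' : R -> R -> R,
  [/\ cont2 h', cont2 hs',
      forall z y : R, 0 < z -> is_derive z (1:R) (h'^~ y) (hs' z y),
      forall z y : R, lo y <= z <= hi y -> hs' z y = hs z y &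
      forall z y : R, lo y <= z <= hi y -> J (lo y) z (hs^~ y) = h z y - h (lo y) y ->
        h' z y = h z y].
Proof.
move=> ch chs clo chi lohi.
pose hs' z y := hs (clip (lo y) (hi y) z) y.
have chs' : cont2 hs'.
  apply: (continuous_comp2 (f := fun q : R * R => clip (lo q.2) (hi q.2) q.1) (g := snd)) => //.
    apply: continuous_clip; [|  | exact: continuous_fst].
      exact: (continuous_comp1 (@continuous_snd R)).
    exact: (continuous_comp1 (@continuous_snd R)).
  exact: continuous_snd.
have lhs' y : lbm (hs'^~ y) by exact/lbm_continuous/continuous_section2.
pose h' z y := h (lo y) y + (J (-1) z (hs'^~ y) - J (-1) (lo y) (hs'^~ y)).
have cJ (b : R * R -> R) : continuous b -> continuous (fun q : R * R => J (-1) (b q) (hs'^~ q.2)).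
  move=> cb; apply: (continuous_J (m := fun q t => hs' t q.2)) => //.
  apply: (continuous_comp2 (f := fun q : (R * R) * R => q.2) (g := fun q : (R * R) * R => q.1.2)) => //.
    by move=> q; exact: cvg_snd.
  move=> q; apply: (@continuous_comp _ _ _ (fun q : (R * R) * R => q.1) (fun q : R * R => q.2)).
    exact: cvg_fst.
  exact: cvg_snd.
have clo2 : continuous (fun q : R * R => lo q.2).
  exact: (continuous_comp1 (@continuous_snd R)).
exists h', hs'; split => //.
- apply: continuous_add.
    apply: (continuous_comp2 (f := fun q : R * R => lo q.2) (g := snd)) => //.
    exact: continuous_snd.
  by apply: continuous_sub; apply: cJ => //; exact: continuous_fst.
- move=> z y z0; have z1 : -1 < z by lra.
  have D : is_derive z (1:R) (fun z => J (-1) z (hs'^~ y)) (hs' z y).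
    by apply: is_derive_J => //; exact: continuous_section2.
  have D2 : is_derive z (1:R) (fun=> h (lo y) y) 0 by exact: is_derive_cst.
  have D3 : is_derive z (1:R) (fun=> J (-1) (lo y) (hs'^~ y)) 0 by exact: is_derive_cst.
  by apply: is_derive_eq (is_deriveD D2 (is_deriveB D D3)) _; rewrite add0r subr0.
- by move=> z y yz; rewrite /hs' clip_id.
- move=> z y /andP[yz zy] HJ; rewrite /h'.
  have /andP[lo0 _] := lohi y.
  rewrite -(J_cat (lhs' y) (_ : -1 <= lo y) yz); last by lra.
  rewrite [X in h _ _ + X](addrC _ (- _)) addKr.
  rewrite (_ : J (lo y) z _ = h z y - h (lo y) y) ?subrKC//.
  rewrite -HJ; apply: J_ext => x /andP[lx xz]; rewrite /hs' clip_id// lx/=.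
  exact: le_trans xz zy.
Qed.

Lemma J_Leibniz (h hs : R -> R -> R) (c z : R) : cont2 h -> cont2 hs -> 0 < c -> 0 <= z ->
  (forall s y : R, 0 < s -> is_derive s (1:R) (h^~ y) (hs s y)) ->
  J 0 z (fun s => c * h s (c * s) + J 0 (c * s) (hs s)) = J 0 (c * z) (h z).
Proof.
move=> ch chs c0 z0 dh.
have cc : continuous (fun s : R => c * s) by ctn.
have cF : continuous (fun s => J 0 (c * s) (h s)) by exact: continuous_J.
have cf : continuous (fun s => c * h s (c * s) + J 0 (c * s) (hs s)).
  apply: continuous_add; last exact: continuous_J.
  apply: continuous_mul; first exact: continuous_const.
  by apply: (continuous_comp2 (f := fun s => s) (g := fun s => c * s)) => //; ctn.
rewrite (@FTC R 0 z [::] (fun s => J 0 (c * s) (h s)))//.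
- by rewrite mulr0 [X in _ - X]J_gt// subr0.
- exact: lbm_continuous.
- move=> x /andP[x0 xz] _; split; last exact: cf.
  exact: is_derive_Leibniz.
Qed.

Lemma J_shift (a b c : R) (g : R -> R) : a <= b -> continuous g ->
  J (a + c) (b + c) (fun x => g (x - c)) = J a b g.
Proof.
move=> ab cg; have cs : continuous (fun x : R => x - c) by ctn.
have cgs : continuous (fun x => g (x - c)) by exact: continuous_comp1 cs cg.
rewrite (@FTC R _ _ [::] (fun x => J a (x - c) g)) ?lerD2r//.
- by rewrite !addrK [X in _ - X]J_gt// subr0.
- by apply: (continuous_comp1 cs (g := fun x => J a x g)); exact/J_continuous/lbm_continuous.
- exact: lbm_continuous.
- move=> x /andP[ax xb] _; split; last exact: cgs.
  have D1 : is_derive (x - c) (1:R) (fun x => J a x g) (g (x - c)).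
    apply: is_derive_J; [exact: lbm_continuous|lra|exact: cg].
  have D2 : is_derive x (1:R) (fun x : R => x - c) 1.
    by apply: is_derive_eq (is_deriveB (is_derive_id x (1:R)) (is_derive_cst c x (1:R))) _; rewrite subr0.
  have D3 := @is_derive1_comp R (fun x => J a x g) (fun x => x - c) x _ _ D1 D2.
  by rewrite mulr1 in D3; exact: D3.
Qed.

Section fixed_kernel.
Variables (kk kz ky B : R -> R -> R).
Hypotheses (ckk : cont2 kk) (ckz : cont2 kz) (cky : cont2 ky) (cB : cont2 B).
Hypothesis kk_dz : forall y z : R, 0 <= y -> y < z -> z < 1 ->
  is_derive z (1:R) (kk^~ y) (kz z y).
Hypothesis kk_dy : forall y z : R, 0 < y -> y < z -> z <= 1 ->
  is_derive y (1:R) (kk z) (ky z y).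
Hypothesis K_dchar : forall y z : R, 0 < y -> y < z -> z < 1 ->
  is_derive (0:R) (1:R) (fun h => kz (z + h) (y - h) + ky (z + h) (y - h)) (B z y).

(** The one combination of first derivatives that is known to be differentiable again; its
    derivative along (1, -1) is [B], the generalized k_zz - k_yy. *)
Let K z y := kz z y + ky z y.

Let cK : cont2 K. Proof. exact: continuous_add. Qed.

Let c2snd (g : R -> R) : continuous g -> continuous (fun q : R * R => g q.2).
Proof. by move=> cg; exact: (continuous_comp1 (@continuous_snd R)). Qed.

Let lsec (m : R -> R -> R) (z : R) : cont2 m -> lbm (m z).
Proof. by move=> cm; exact/lbm_continuous/continuous_section. Qed.

Let csec (m : R -> R -> R) (y : R) : cont2 m -> continuous (fun s => m s y).
Proof. by move=> cm; exact: continuous_section2. Qed.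

Let cdiag (m : R -> R -> R) : cont2 m -> continuous (fun s : R => m s s).
Proof. by move=> cm; apply: (continuous_comp2 (f := fun s : R => s) (g := fun s : R => s)) => //; ctn. Qed.

Let cJ (m : R -> R -> R) : cont2 m -> continuous (fun s => J 0 s (m s)).
Proof. by move=> cm; apply: continuous_J => //; ctn. Qed.

(** Leibniz' rule asks for differentiability in z at all positive z, while [kk] has it only for y <
    z < 1. The extension of [kk] across the diagonal supplies the rest and agrees with [kk] wherever
    the integrals look. *)
Lemma J_kernel_dz (g : R -> R) (z : R) : continuous g -> 0 <= z <= 1 ->
  J 0 z (fun s => kk s s * g s + J 0 s (fun y => kz s y * g y)) =
  J 0 z (fun y => kk z y * g y).
Proof.
move=> cg /andP[z0 z1].
have [||y|h [hs [ch chs dh Ehs Eh]]] := @is_derive_ext_domain kk kz (@cl R) (fun=> 1) ckk ckz.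
- exact: continuous_cl.
- exact: continuous_const.
- exact: cl_itv.
have EH (s y : R) : 0 <= y -> y <= s -> s <= 1 -> h s y = kk s y.
  move=> y0 ys s1; have ycl : cl y = y by rewrite cl_id// y0 (le_trans ys).
  apply: Eh; rewrite ycl ?ys//.
  rewrite (@FTC R y s [::] (kk^~ y))//; [exact: csec|exact/lbm_continuous/csec|].
  move=> x /andP[yx xs] _; split; last exact: (csec (m := kz)).
  by apply: kk_dz => //; exact: lt_le_trans xs s1.
have EHs (s y : R) : 0 <= y -> y <= s -> s <= 1 -> hs s y = kz s y.
  move=> y0 ys s1; have ycl : cl y = y by rewrite cl_id// y0 (le_trans ys).
  by apply: Ehs; rewrite ycl ys.
have := @J_Leibniz (fun s y => h s y * g y) (fun s y => hs s y * g y) 1 z.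
rewrite !mul1r => H.
transitivity (J 0 z (fun y => h z y * g y)); last first.
  by apply: J_ext => y /andP[y0 yz]; rewrite EH.
etransitivity; last apply: H => //.
- apply: J_ext => s /andP[s0 sz]; rewrite !mul1r EH// ?(le_trans sz)//; congr (_ + _).
  by apply: J_ext => y /andP[y0 ys]; rewrite EHs// (le_trans sz).
- by apply: continuous_mul => //; exact: c2snd.
- by apply: continuous_mul => //; exact: c2snd.
- move=> s y s0; have D1 := dh s y s0.
  have D2 : is_derive s (1:R) (fun=> g y) 0 by exact: is_derive_cst.
  by apply: is_derive_eq (is_deriveM D1 D2) _; rewrite /GRing.scale/= mulr0 add0r mulrC.
Qed.

(* Leibniz' rule in the coordinates (s, w = s + y), in which the characteristic
   derivative is d/ds at fixed w and 0 <= y <= s becomes s <= w <= 2 s. *)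
Lemma J_kernel_dchar (f f' : R -> R) (z : R) :
  continuous f -> continuous f' ->
  (forall x : R, 0 < x < 1 -> is_derive x (1:R) f (f' x)) -> 0 <= z <= 1 ->
  J 0 z (fun s => 2 * (K s s * f s) - K s 0 * f 0 +
     J 0 s (fun y => B s y * f y - K s y * f' y)) =
  J 0 z (fun y => K z y * f y).
Proof.
move=> cf cf' df /andP[z0 z1].
pose M s w := K s (w - s) * f (w - s).
pose v s y := B s y * f y - K s y * f' y.
pose Ms s w := v s (w - s).
have cv : cont2 v by apply: continuous_sub; apply: continuous_mul => //; exact: c2snd.
have cd : continuous (fun q : R * R => q.2 - q.1) by ctn.
have cMs : cont2 Ms.
  by apply: (continuous_comp2 (f := fun q : R * R => q.1) (g := fun q : R * R => q.2 - q.1) (m := v)) => //; ctn.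
have cKf : cont2 (fun s y => K s y * f y) by apply: continuous_mul => //; exact: c2snd.
have cM : cont2 M.
  by apply: (continuous_comp2 (f := fun q : R * R => q.1) (g := fun q : R * R => q.2 - q.1) (m := fun s y => K s y * f y)) => //; ctn.
(* At fixed w = s + y the triangle 0 <= y <= s <= 1 becomes w / 2 <= s <= min(w, 1), which explains
   the two bounds. *)
have [||y|h [hs [ch chs dh Ehs Eh]]] :=
    @is_derive_ext_domain M Ms (fun w => cl (w / 2)) (@cl R) cM cMs.
- by apply: (continuous_comp1 (f := fun w : R => w / 2)); ctn.
- exact: continuous_cl.
- have /andP[-> _] := cl_itv (y / 2); rewrite /= /cl /clip.
  rewrite le_min [X in _ && X]ge_min lexx orbT andbT ge_min; apply/orP; left.
  by rewrite ge_max !le_max lexx/=; have [y0|y0] := leP y 0;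
    [rewrite (_ : y / 2 <= 0)//|rewrite (_ : y / 2 <= y) ?orbT//]; lra.
have dom (s w : R) : 0 <= s <= 1 -> s <= w <= 2 * s -> cl (w / 2) = w / 2 /\ s <= cl w.
  move=> /andP[s0 s1] /andP[sw ws]; split; first by rewrite cl_id//; apply/andP; split; lra.
  by rewrite /cl /clip le_min s1 le_max sw orbT.
(* At fixed w the variable s moves along (1, -1): [K] contributes [B], while the argument w - s of
   [f] moves backwards and contributes - f'. *)
have dM (s w : R) : w / 2 < s -> s < w -> s < 1 -> is_derive s (1:R) (M^~ w) (Ms s w).
  move=> ws sw s1.
  have D1 : is_derive s (1:R) (fun s => K s (w - s)) (B s (w - s)).
    have D0 : is_derive (s - s) (1:R) (fun h => K (s + h) ((w - s) - h)) (B s (w - s)).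
      by rewrite subrr; apply: K_dchar => //; lra.
    have D2 : is_derive s (1:R) (fun x : R => x - s) 1.
      by apply: is_derive_eq (is_deriveB (is_derive_id s (1:R)) (is_derive_cst s s (1:R))) _; rewrite subr0.
    have D3 := @is_derive1_comp R (fun h => K (s + h) ((w - s) - h)) (fun x => x - s) s _ _ D0 D2.
    rewrite mulr1 in D3; move: D3; congr (is_derive _ _ _ _).
    by apply/funext => x /=; rewrite subrKC; congr K; ring.
  have D2 : is_derive s (1:R) (fun s => f (w - s)) (- f' (w - s)).
    have D0 : is_derive (w - s) (1:R) f (f' (w - s)) by apply: df; lra.
    have D2 : is_derive s (1:R) (fun x : R => w - x) (-1).
      by apply: is_derive_eq (is_deriveB (is_derive_cst w s (1:R)) (is_derive_id s (1:R))) _; rewrite sub0r.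
    have D3 := @is_derive1_comp R f (fun x => w - x) s _ _ D0 D2.
    by rewrite mulrN1 in D3; exact: D3.
  apply: is_derive_eq (is_deriveM D1 D2) _.
  by rewrite /GRing.scale/= /Ms /v; ring.
have EHs (s w : R) : 0 <= s <= 1 -> s <= w <= 2 * s -> hs s w = Ms s w.
  move=> s01 sw; have [e1 e2] := dom s w s01 sw.
  by apply: Ehs; rewrite e1 e2 andbT; lra.
have EH (s w : R) : 0 <= s <= 1 -> s <= w <= 2 * s -> h s w = M s w.
  move=> s01 sw; have [e1 e2] := dom s w s01 sw.
  apply: Eh; rewrite e1 ?e2 ?andbT; first by lra.
  rewrite (@FTC R _ _ [::] (M^~ w))//; [lra|exact: csec|exact/lbm_continuous/csec|].
  move=> x xs _; split; last exact: (csec (m := Ms)).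
  by apply: dM; lra.
(* The integral over s <= w <= 2 s is a difference of integrals from 0, one per value of [c]. The
   end w = 2 s is y = s and gives [2 * (K s s * f s)]; the end w = s is y = 0 and gives
   [K s 0 * f 0]. *)
have J1 := @J_Leibniz h hs 1 z ch chs ltr01 z0 (fun s y => dh s y).
have J2 := @J_Leibniz h hs 2 z ch chs (ltr0Sn _ _) z0 (fun s y => dh s y).
have zz : z <= 2 * z by rewrite ler_peMl // ler1n.
transitivity (J z (2 * z) (fun w => K z (w - z) * f (w - z))); last first.
  have <- := @J_shift 0 z z (fun y => K z y * f y) z0 (@continuous_section R (fun s y => K s y * f y) z cKf).
  by rewrite add0r mulrDl !mul1r.
transitivity (J z (2 * z) (h z)); last first.
  by apply: J_ext => w zw; rewrite EH// z0.
have -> : J z (2 * z) (h z) = J 0 (2 * z) (h z) - J 0 (1 * z) (h z).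
  by rewrite mul1r -(J_cat (lsec z ch) z0 zz) addrAC subrr add0r.
have cl1 c : continuous (fun s => c * h s (c * s) + J 0 (c * s) (hs s)).
  have cc : continuous (fun s : R => c * s) by ctn.
  apply: continuous_add; last exact: continuous_J.
  apply: continuous_mul; first exact: continuous_const.
  by apply: (continuous_comp2 (f := fun s => s) (g := fun s => c * s)) => //; ctn.
rewrite -J1 -J2 -JB; [|exact/lbm_continuous/cl1|exact/lbm_continuous/cl1].
apply: J_ext => s /andP[s0 sz]; have s1 : s <= 1 := le_trans sz z1.
have ss : s <= 2 * s by rewrite ler_peMl // ler1n.
rewrite !mul1r (EH s (2 * s)) ?s0// ?lexx ?andbT// (EH s s) ?s0// ?lexx//.
rewrite -(J_cat (lsec s chs) s0 ss) /M subrr.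
have -> : 2 * s - s = s by ring.
have -> : J 0 s (v s) = J s (2 * s) (hs s).
  rewrite -(@J_shift 0 s s (v s) s0 (@continuous_section R v s cv)) add0r.
  have -> : s + s = 2 * s by ring.
  by apply: J_ext => w sw; rewrite EHs ?s0.
ring.
Qed.

(** Integration by parts in y. Exceptional points are allowed because [g'] will also be the second
    derivative of the state. *)
Lemma J_kernel_dy (g g' : R -> R) (D : seq R) (z : R) :
  continuous g -> lbm g' ->
  (forall x : R, 0 < x < 1 -> x \notin D ->
     is_derive x (1:R) g (g' x) /\ {for x, continuous g'}) -> 0 <= z <= 1 ->
  J 0 z (fun y => ky z y * g y) + J 0 z (fun y => kk z y * g' y) =
  kk z z * g z - kk z 0 * g 0.
Proof.
move=> cg lg' dg /andP[z0 z1].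
have ckg : continuous (fun y => kk z y * g y).
  by apply: continuous_mul => //; exact: continuous_section.
have lkg : lbm (fun y => ky z y * g y).
  by apply: lbmM; [exact: lsec|exact: lbm_continuous].
have lkg' : lbm (fun y => kk z y * g' y) by apply: lbmM => //; exact: lsec.
rewrite -JD// (@FTC R 0 z D (fun y => kk z y * g y))//; first exact: lbmD.
move=> x /andP[x0 xz] xD.
have [D2 cg'] : is_derive x (1:R) g (g' x) /\ {for x, continuous g'}.
  by apply: dg => //; rewrite x0 (lt_le_trans xz).
have D1 := kk_dy x0 xz z1; split.
  apply: is_derive_eq (is_deriveM D1 D2) _.
  by rewrite /GRing.scale/= addrC mulrC.
apply: cvgD; apply: cvgM => //; try exact: cg; exact: (continuous_section (m := ky)) || exact: continuous_section.
Qed.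

Section transform.
Variables (f f' xi : R -> R) (D : seq R).
Hypotheses (cf : continuous f) (cf' : continuous f') (lxi : lbm xi).
Hypothesis df : forall x : R, 0 < x < 1 -> is_derive x (1:R) f (f' x).
Hypothesis df' : forall x : R, 0 < x < 1 -> x \notin D ->
  is_derive x (1:R) f' (xi x) /\ {for x, continuous xi}.

(* The z-derivative of f(z) - int_0^z kk(z, y) f(y) dy. *)
Definition transf_z z := f' z - kk z z * f z - J 0 z (fun y => kz z y * f y).

Let c2M (m : R -> R -> R) (g : R -> R) : cont2 m -> continuous g -> cont2 (fun s y => m s y * g y).
Proof. by move=> cm cg; apply: continuous_mul => //; exact: c2snd. Qed.

Lemma continuous_transf_z : continuous transf_z.
Proof.
apply: continuous_sub; last by apply: (cJ (m := fun s y => kz s y * f y)); exact: c2M.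
by apply: continuous_sub => //; apply: continuous_mul => //; exact: cdiag.
Qed.

Lemma J_transf_z (z : R) : 0 <= z <= 1 ->
  J 0 z transf_z = f z - J 0 z (fun y => kk z y * f y) - f 0.
Proof.
move=> /andP[z0 z1].
have ck : continuous (fun s => kk s s * f s + J 0 s (fun y => kz s y * f y)).
  apply: continuous_add; first by apply: continuous_mul => //; exact: cdiag.
  by apply: (cJ (m := fun s y => kz s y * f y)); exact: c2M.
rewrite -J_kernel_dz ?z0// addrAC -(@FTC R 0 z [::] f f')//.
- rewrite -JB; [|exact: lbm_continuous..].
  by apply: J_ext => s _; rewrite /transf_z opprD addrA.
- exact: lbm_continuous.
- by move=> x /andP[x0 xz] _; split; [apply: df; rewrite x0 (lt_le_trans xz)|exact: cf'].
Qed.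

(* kz alone has no z-derivative: writing kz = (kz + ky) - ky, the first part is
   treated along characteristics and the second by parts in y. *)
Lemma J_transf_zz : exists X, [/\ lbm X,
  forall s : R, 0 <= s <= 1 -> X s = xi s - 2 * (K s s * f s) + ky s 0 * f 0 - kk s 0 * f' 0
     - (J 0 s (fun y => B s y * f y) + J 0 s (fun y => kk s y * xi y)) &
  forall z : R, 0 <= z <= 1 -> J 0 z X = transf_z z - transf_z 0].
Proof.
(* By parts in y, [transf_z z] equals f'(z) - int_0^z K f - kk(z, 0) f(0) - int_0^z kk f'. The
   functions [P2], [P4] and [P1] are the z-derivatives of the three subtracted terms. *)
pose P2 s := 2 * (K s s * f s) - K s 0 * f 0 + J 0 s (fun y => B s y * f y - K s y * f' y).
pose P1 s := kk s s * f' s + J 0 s (fun y => kz s y * f' y).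
pose P4 s := kz s 0 * f 0.
have cP1 : continuous P1.
  apply: continuous_add; first by apply: continuous_mul => //; exact: cdiag.
  by apply: (cJ (m := fun s y => kz s y * f' y)); exact: c2M.
have cP4 : continuous P4.
  by apply: continuous_mul; [exact: csec|exact: continuous_const].
have cP2 : continuous P2.
  apply: continuous_add; first apply: continuous_sub.
  - apply: continuous_mul; first exact: continuous_const.
    by apply: continuous_mul => //; exact: (cdiag (m := K)).
  - by apply: continuous_mul; [exact: (csec (m := K))|exact: continuous_const].
  - apply: (cJ (m := fun s y => B s y * f y - K s y * f' y)).
    by apply: continuous_sub; exact: c2M.
have lP2 := lbm_continuous cP2; have lP1 := lbm_continuous cP1; have lP4 := lbm_continuous cP4.
have lBf s : lbm (fun y => B s y * f y) by apply: (lsec (m := fun s y => B s y * f y)); exact: c2M.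
have lKf' s : lbm (fun y => K s y * f' y) by apply: (lsec (m := fun s y => K s y * f' y)); exact: c2M.
have lkzf' s : lbm (fun y => kz s y * f' y) by apply: (lsec (m := fun s y => kz s y * f' y)); exact: c2M.
have lkyf' s : lbm (fun y => ky s y * f' y) by apply: (lsec (m := fun s y => ky s y * f' y)); exact: c2M.
have lkzf s : lbm (fun y => kz s y * f y) by apply: (lsec (m := fun s y => kz s y * f y)); exact: c2M.
have lkyf s : lbm (fun y => ky s y * f y) by apply: (lsec (m := fun s y => ky s y * f y)); exact: c2M.
have JK (g : R -> R) s : lbm (fun y => kz s y * g y) -> lbm (fun y => ky s y * g y) ->
    J 0 s (fun y => K s y * g y) = J 0 s (fun y => kz s y * g y) + J 0 s (fun y => ky s y * g y).
  by move=> l1 l2; rewrite -JD//; apply: J_ext => y _; rewrite /K mulrDl.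
exists (fun s => xi s - P2 s - P4 s - P1 s); split.
- by apply: lbmB => //; apply: lbmB => //; exact: lbmB.
- move=> s s01.
  (* In - P2 - P1 the integrals of K f' and kz f' leave that of ky f'. A second integration by parts
     trades f' for [xi] and cancels [kk s s * f' s]. *)
  have := @J_kernel_dy f' xi D s cf' lxi df' s01.
  rewrite /P2 /P4 /P1 JB// JK//.
  move: (J 0 s _) (J 0 s _) (J 0 s _) (J 0 s _) => j1 j2 j3 j4 E.
  rewrite /K; have -> : kk s s * f' s = j4 + j3 + kk s 0 * f' 0 by rewrite E; ring.
  ring.
- move=> z z01; have /andP[z0 z1] := z01.
  rewrite !JB//; [|exact: lbmB|by apply: lbmB => //; exact: lbmB].
  have -> : J 0 z xi = f' z - f' 0.
    apply: (@FTC R 0 z D f' xi) => // x /andP[x0 xz]; apply: df'.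
    by rewrite x0 (lt_le_trans xz).
  have -> : J 0 z P4 = kk z 0 * f 0 - kk 0 0 * f 0.
    have cE : continuous (fun s => kk s 0 * f 0).
      by apply: continuous_mul; [exact: csec|exact: continuous_const].
    apply: (@FTC R 0 z [::] (fun s => kk s 0 * f 0) P4) => // x /andP[x0 xz] _.
    split; last exact: cP4.
    have D1 := kk_dz (lexx 0) x0 (lt_le_trans xz z1).
    have D2 : is_derive x (1:R) (fun=> f 0) 0 by exact: is_derive_cst.
    by apply: is_derive_eq (is_deriveM D1 D2) _; rewrite /GRing.scale/= mulr0 add0r mulrC.
  rewrite (J_kernel_dchar cf cf' df z01) (J_kernel_dz cf' z01) JK//.
  have dfx (x : R) : 0 < x < 1 -> x \notin [::] -> is_derive x (1:R) f (f' x) /\ {for x, continuous f'}.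
    by move=> x01 _; split; [exact: df|exact: cf'].
  have := @J_kernel_dy f f' [::] z cf (lbm_continuous cf') dfx z01.
  rewrite /transf_z [J 0 0 _]J_gt//.
  move: (J 0 z _) (J 0 z _) (J 0 z _) => j1 j2 j3 E.
  have -> : kk z z * f z = j3 + j2 + kk z 0 * f 0 by rewrite E; ring.
  ring.
Qed.

End transform.
End fixed_kernel.
End Kernel.

(** * Energy estimates for the heat equation *)

Section Energy.
Variable R : realType.

Lemma is_derive_exp (f : R -> R) (x df : R) n : is_derive x (1:R) f df ->
  is_derive x (1:R) (fun y => f y ^+ n.+1) (n.+1%:R * f x ^+ n * df).
Proof.
move=> dfx; elim: n => [|n IH].
  by under eq_fun do rewrite expr1; rewrite expr0 !mul1r.
have -> : (fun y => f y ^+ n.+2) = (fun y => f y * f y ^+ n.+1).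
  by apply/funext => y; rewrite exprS.
apply: is_derive_eq (is_deriveM dfx IH) _; rewrite /GRing.scale/=.
by rewrite !exprS -[in RHS]natr1 -natr1; ring.
Qed.

Lemma continuous_exp (T : topologicalType) (f : T -> R) n (x : T) :
  {for x, continuous f} -> {for x, continuous (fun y => f y ^+ n)}.
Proof.
rewrite /prop_for /continuous_at => cf; elim: n => [|n IH].
  by rewrite expr0; under eq_fun do rewrite expr0; exact: cvg_cst.
by rewrite exprS; under eq_fun do rewrite exprS; apply: cvgM.
Qed.

Lemma near_eq_continuous_at (T U : topologicalType) (f g : T -> U) (x : T) :
  (\forall y \near x, f y = g y) -> {for x, continuous g} -> {for x, continuous f}.
Proof.
move=> fg; rewrite /prop_for /continuous_at (nbhs_singleton fg) => cg V /cg gV.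
by apply: filterS2 fg gV => y /= ->.
Qed.

(* The witness u1 is u_z; u1 1 = 0 and the last clause at z = 0 are the Neumann
   conditions. *)
Lemma heat_energy_nonincreasing (lam s : R) (u ut : R -> R -> R) :
  0 < lam ->
  continuous (fun q : R * R => u q.1 (Num.max s q.2)) ->
  (forall z t : R, s < t -> is_derive t (1:R) (u z) (ut z t)) ->
  (forall z t : R, s < t -> {for (z, t), continuous (fun q : R * R => ut q.1 q.2)}) ->
  (forall t : R, s < t -> exists u1 : R -> R,
    [/\ continuous u1, u1 1 = 0,
        forall z, 0 <= z <= 1 -> J 0 z u1 = u z t - u 0 t &
        forall z, 0 <= z <= 1 -> lam * u1 z = J 0 z (ut^~ t)]) ->
  forall n t, s <= t ->
    J 0 1 (fun z => u z t ^+ n.*2.+2) <= J 0 1 (fun z => u z s ^+ n.*2.+2).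
Proof.
move=> lam0 cu du cut heat n t; rewrite le_eqVlt => /predU1P[->//|st].
have cuz t' : s <= t' -> continuous (u^~ t').
  move=> st'; have := continuous_section2 (m := fun z t => u z (Num.max s t)) (y := t') cu.
  by rewrite (max_r st').
have cutz t' : s < t' -> continuous (ut^~ t').
  move=> st' z; apply: (@continuous_comp _ _ _ (fun z : R => (z, t')) (fun q : R * R => ut q.1 q.2)).
    by apply: pair_continuous_at; [exact: cvg_id|exact: cvg_cst].
  exact: cut.
(* Freezing time at [s] on the left makes the energy continuous on the whole line, although it is
   differentiated only after [s]; the mean value theorem then reaches down to [s]. *)
pose E t := J 0 1 (fun z => u z (Num.max s t) ^+ n.*2.+2).
have cE : continuous E.
  apply: (continuous_J (m := fun t z => u z (Num.max s t) ^+ n.*2.+2)).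
    exact: continuous_const.
  move=> q; apply: continuous_exp.
  apply: (continuous_comp2 (f := fun q : R * R => q.2) (g := fun q : R * R => q.1)
    (m := fun z t => u z (Num.max s t))); ctn.
pose E' t := J 0 1 (fun z => n.*2.+2%:R * u z t ^+ n.*2.+1 * ut z t).
have dE t' : s < t' -> is_derive t' (1:R) E (E' t').
  move=> st'.
  have D : is_derive t' (1:R) (fun t => J 0 1 (fun z => u z t ^+ n.*2.+2)) (E' t').
    apply: (@is_derive_under_J R (fun t z => u z t ^+ n.*2.+2)
      (fun t z => n.*2.+2%:R * u z t ^+ n.*2.+1 * ut z t)); first exact: ler01.
    - near=> r; have sr : s < r by near: r; exact: near_gt.
      split; first by apply: lbm_continuous => z; apply: continuous_exp; apply: cuz; exact: ltW.
      by move=> y _; apply: is_derive_exp; exact: du.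
    - move=> y _; apply: cvgM; last first.
        apply: (continuous_at_comp2 (f := fun q : R * R => q.2) (g := fun q : R * R => q.1) (m := ut)).
        + exact: continuous_snd.
        + exact: continuous_fst.
        + exact: cut.
      apply: cvgM; first exact: cvg_cst.
      apply: (@continuous_exp _ (fun q : R * R => u q.2 q.1)).
      have H : {for (t', y), continuous (fun q : R * R => u q.2 (Num.max s q.1))}.
        by apply: (continuous_comp2 (f := fun q : R * R => q.2) (g := fun q : R * R => q.1)
          (m := fun z t => u z (Num.max s t))) => //; ctn.
      apply: near_eq_continuous_at H; near=> q; rewrite max_r// ltW//.
      near: q; have := @continuous_fst R (t', y).
      by move=> /(_ _ (near_gt st')).
    - apply: lbm_continuous => z; apply: cvgM; last exact: cutz.
      by apply: cvgM; [exact: cvg_cst|apply: continuous_exp; apply: cuz; exact: ltW].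
  apply: near_eq_is_derive D; near=> r; rewrite /E max_r// ltW//.
  by near: r; exact: near_gt.
have E'0 t' : s < t' -> E' t' <= 0.
  move=> st'; have [u1 [cu1 u11 Ju Jut]] := heat t' st'.
  have st'' := ltW st'.
  pose U z := u 0 t' + J 0 z u1.
  have EU z : 0 <= z <= 1 -> u z t' = U z by move=> z01; rewrite /U Ju// addrC subrK.
  pose V z := J 0 z (ut^~ t').
  have lut := lbm_continuous (cutz t' st').
  have cU : continuous U.
    by apply: continuous_add; [exact: continuous_const|exact/J_continuous/lbm_continuous].
  have cV : continuous V by exact: J_continuous.
  (* Since V' = ut and V = lam u1, the integral of G' relates that of U^(2n+1) ut to that of (2n+1)
     lam U^(2n) u1^2, which is nonnegative. [V] vanishes at both ends, so no boundary term
     remains. *)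
  pose G z := U z ^+ n.*2.+1 * V z.
  have cUn k : continuous (fun z => U z ^+ k) by move=> z; apply: continuous_exp; exact: cU.
  pose g z := n.*2.+1%:R * U z ^+ n.*2 * u1 z * V z + U z ^+ n.*2.+1 * ut z t'.
  have cpre : continuous (fun z => n.*2.+1%:R * U z ^+ n.*2 * u1 z * V z).
    by apply: continuous_mul => //; apply: continuous_mul => //; apply: continuous_mul => //; exact: continuous_const.
  have cpost : continuous (fun z => U z ^+ n.*2.+1 * ut z t').
    by apply: continuous_mul => //; exact: cutz.
  have HG : J 0 1 g = G 1 - G 0.
    apply: (@FTC R 0 1 [::] G g ler01).
    - exact: continuous_mul.
    - by apply: lbm_continuous; exact: continuous_add.
    - move=> x /andP[x0 x1] _; split; last exact: continuous_add.
      have D1 : is_derive x (1:R) U (u1 x).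
        have D0 := is_derive_J (lbm_continuous cu1) x0 (cu1 x).
        by apply: is_derive_eq (is_deriveD (is_derive_cst (u 0 t') x (1:R)) D0) _; rewrite add0r.
      have D2 := is_derive_J lut x0 (cutz t' st' x).
      have D3 := is_derive_exp n.*2 D1.
      apply: is_derive_eq (is_deriveM D3 D2) _; rewrite /GRing.scale/= /g /V.
      by rewrite addrC; congr (_ + _); rewrite mulrC.
  have V1 : V 1 = 0 by rewrite /V -Jut ?u11 ?mulr0// ler01 lexx.
  have V0 : V 0 = 0 by rewrite /V J_gt.
  rewrite /E'.
  have -> : J 0 1 (fun z => n.*2.+2%:R * u z t' ^+ n.*2.+1 * ut z t') =
      n.*2.+2%:R * J 0 1 (fun z => U z ^+ n.*2.+1 * ut z t').
    rewrite -JZ; last exact: lbm_continuous.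
    by apply: J_ext => z z01; rewrite EU// mulrA.
  rewrite pmulr_rle0 ?ltr0n//.
  move: HG; rewrite /g JD; [|exact: lbm_continuous..].
  rewrite /G V1 V0 !mulr0 subr0 addrC => /eqP; rewrite addr_eq0 => /eqP ->.
  rewrite oppr_le0; apply: J_ge0 => z z01.
  have U0 : 0 <= U z ^+ n.*2 by rewrite -mul2n exprM exprn_ge0// sqr_ge0.
  rewrite /V -Jut// (_ : _ * _ = n.*2.+1%:R * U z ^+ n.*2 * (lam * u1 z ^+ 2)); last by ring.
  by apply: mulr_ge0; apply: mulr_ge0 => //; [exact: ltW|exact: sqr_ge0].
have dE2 (x : R) : x \in `]s, t[ -> is_derive x (1:R) E (E' x).
  by rewrite in_itv/= => /andP[sx _]; exact: dE.
have [c] := MVT st dE2 (continuous_subspaceT cE).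
rewrite in_itv/= => /andP[sc _] /eqP; rewrite subr_eq => /eqP.
rewrite /E (max_r (ltW st)) maxxx => ->.
by rewrite gerDr mulr_le0_ge0 ?E'0// subr_ge0 ltW.
Unshelve. all: by end_near. Qed.

Lemma bernoulli (r : R) n : 0 <= r -> 1 + n%:R * r <= (1 + r) ^+ n.
Proof.
move=> r0; elim: n => [|n IH]; first by rewrite mul0r addr0 expr0.
rewrite exprS; apply: le_trans (_ : (1 + r) * (1 + n%:R * r) <= _).
  have : 0 <= n%:R * (r * r) by rewrite !mulr_ge0.
  rewrite -natr1; nra.
by rewrite ler_wpM2l// addr_ge0.
Qed.

(* If |g| > m > M near 0, the moments grow at least like m^(2n). *)
Lemma sup_of_moments (M : R) (g : R -> R) : 0 < M -> continuous g ->
  (forall n, J 0 1 (fun z => g z ^+ n.*2.+2) <= M ^+ n.*2.+2) -> `|g 0| <= M.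
Proof.
move=> M0 cg H; rewrite leNgt; apply/negP => Mg.
pose m := (M + `|g 0|) / 2.
have Mm : M < m by rewrite /m; lra.
have m0 : 0 < m by rewrite (lt_trans M0 Mm).
have mg : m < `|g 0| by rewrite /m; lra.
have cng : {for (0:R), continuous (fun z => `|g z|)}.
  by apply: (@continuous_comp _ _ _ g (fun x : R => `|x|)); [exact: cg|exact: norm_continuous].
have [d /= d0 Hd] := cng _ (near_gt mg).
(* Half of [d] puts the closed interval [0, h] inside the ball where |g| > m; the cap 1 keeps it in
   the domain of integration. *)
pose h : R := Num.min (d / 2) 1.
have h0 : 0 < h by rewrite lt_min ltr01 divr_gt0.
have h1 : h <= 1 by rewrite ge_min lexx orbT.
have hd : h <= d / 2 by rewrite ge_min lexx.
pose r := m / M - 1.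
have r0 : 0 < r by rewrite /r subr_gt0 ltr_pdivlMr// mul1r.
(* Restricting the moment to [0, h] gives h m^(2n+2) <= M^(2n+2), that is h (1 + r)^(2n+2) <= 1.
   Bernoulli's inequality leaves linear growth in [n] against a constant. *)
have key n : h * (1 + n%:R * r) <= 1.
  have cgn : continuous (fun z => g z ^+ n.*2.+2) by move=> z; apply: continuous_exp; exact: cg.
  have lgn := lbm_continuous cgn.
  have : h * m ^+ n.*2.+2 <= M ^+ n.*2.+2.
    apply: le_trans (H n); rewrite -(J_cat lgn (ltW h0) h1).
    have evenp (x : R) : x ^+ n.*2.+2 = `|x| ^+ n.*2.+2.
      by rewrite -doubleS -mul2n !exprM real_normK// num_real.
    rewrite -[leLHS]addr0; apply: lerD; last first.
      by apply: J_ge0 => x _; rewrite evenp exprn_ge0.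
    have -> : h * m ^+ n.*2.+2 = J 0 h (fun=> m ^+ n.*2.+2).
      by rewrite J_cst ?ltW// subr0 mulrC.
    apply: le_J => //; first exact: lbm_cst.
    move=> x /andP[x0 xh]; rewrite [X in _ <= X]evenp; apply: lerXn2r; rewrite ?nnegrE ?(ltW m0)//.
    have : m < `|g x| by apply: Hd => /=; rewrite sub0r normrN ger0_norm//; lra.
    exact: ltW.
  have -> : m = M * (1 + r) by rewrite /r addrC subrK mulrCA divff ?mulr1// gt_eqF.
  rewrite exprMn mulrCA -[leRHS]mulr1 ler_pM2l ?exprn_gt0//; apply: le_trans.
  rewrite ler_wpM2l ?(ltW h0)// (le_trans _ (bernoulli _ (ltW r0)))//.
  rewrite lerD2l ler_wpM2r ?(ltW r0)// ler_nat -addnn; lia.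
pose n := Num.bound ((h * r)^-1).
have hr0 : 0 < h * r by rewrite mulr_gt0.
have : (h * r)^-1 < n%:R by apply: archi_boundP; rewrite invr_ge0 ltW.
rewrite -[X in X < _]div1r ltr_pdivrMr// => E.
have := key n; rewrite leNgt => /negP; apply.
rewrite (lt_le_trans E)//; nra.
Qed.

End Energy.

(** * Volterra equations *)

Section Volterra.
Variable R : realType.
Local Notation cont2 m := (continuous (fun q : R * R => m q.1 q.2)).

(** The radius 2 c / 2^n is the full remaining geometric tail, so the intervals around the [a n] are
    nested and the supremum of their left ends lies in all of them. *)
Lemma geometric_limit (a : nat -> R) (c : R) : 0 <= c ->
  (forall n, `|a n.+1 - a n| <= c / 2 ^+ n) ->
  exists l, forall n, `|l - a n| <= 2 * c / 2 ^+ n.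
Proof.
move=> c0 ha.
pose b n := a n - 2 * c / 2 ^+ n; pose d n := a n + 2 * c / 2 ^+ n.
have half n : 2 * c / 2 ^+ n.+1 = c / 2 ^+ n by rewrite exprS; field; rewrite expf_neq0.
have cn n : 0 <= 2 * c / 2 ^+ n by rewrite divr_ge0 ?mulr_ge0 ?exprn_ge0.
have dbl n : 2 * c / 2 ^+ n = c / 2 ^+ n + c / 2 ^+ n by field; rewrite expf_neq0.
have bS n : b n <= b n.+1.
  by rewrite /b half dbl; have := ha n; rewrite ler_norml; lra.
have dS n : d n.+1 <= d n.
  by rewrite /d half dbl; have := ha n; rewrite ler_norml; lra.
have bd n k : b n <= d k.
  apply: le_trans (_ : b (maxn n k) <= _).
    apply: (@homo_leq _ b <=%R); [by []|exact: le_trans|exact: bS|exact: leq_maxl].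
  apply: le_trans (_ : d (maxn n k) <= _).
    by rewrite /b /d; have := cn (maxn n k); lra.
  apply: (@homo_leq _ d (fun x y => y <= x)); [by move=> x|by move=> x y z /[swap]; exact: le_trans|exact: dS|exact: leq_maxr].
pose B := [set b n | n in [set: nat]].
have B0 : B !=set0 by exists (b 0%N), 0%N.
have ubB k : ubound B (d k) by move=> _ [n _ <-].
exists (sup B) => n; rewrite ler_norml; apply/andP; split.
  have : b n <= sup B by apply: ub_le_sup; [exists (d 0%N); exact: ubB|exists n].
  by rewrite /b; lra.
have : sup B <= d n by apply: ge_sup => //; exact: ubB.
by rewrite /d; lra.
Qed.

Lemma exp2_small (c e : R) : 0 < e -> exists n, c / 2 ^+ n <= e.
Proof.
move=> e0; exists (Num.bound (`|c| / e)).
have : `|c| / e < (Num.bound (`|c| / e))%:R by apply: archi_boundP; rewrite divr_ge0// ltW.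
move: (Num.bound _) => n; rewrite ltr_pdivrMr// => H.
rewrite ler_pdivrMr ?exprn_gt0// (le_trans (ler_norm c))// (le_trans (ltW H))//.
rewrite mulrC ler_wpM2l ?(ltW e0)//.
by rewrite -natrX ler_nat ltnW// ltn_expl.
Qed.

(** Picard iteration on [0, 1], extended by [cl] so that the iterates are continuous on the line and
    converge uniformly there. It guarantees that the choice in the definition of the inverse
    transform has something to choose. *)
Lemma volterra_solution (kk : R -> R -> R) (f : R -> R) (M : R) : cont2 kk -> continuous f ->
  0 < M -> (forall z y, `|kk z y| <= M) ->
  exists g : R -> R, continuous g /\
    forall z : R, 0 <= z <= 1 -> g z - J 0 z (fun y => kk z y * g y) = f z.
Proof.
move=> ck cf M0 kM.
pose S := fix S n := if n is m.+1 then
  (fun z => f (cl z) + J 0 (cl z) (fun y => kk (cl z) y * S m y)) else (fun z => f (cl z)).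
have SE n z : S n.+1 z = f (cl z) + J 0 (cl z) (fun y => kk (cl z) y * S n y) by [].
have cfc : continuous (fun z => f (cl z)).
  by apply: (continuous_comp1 (@continuous_cl R)).
have cS n : continuous (S n).
  elim: n => [//|n IH] /=.
  apply: continuous_add => //.
  apply: (continuous_J (m := fun z y => kk (cl z) y * S n y)); first exact: continuous_cl.
  apply: continuous_mul; last exact: (continuous_comp1 (@continuous_snd R)).
  apply: (continuous_comp2 (f := fun q : R * R => cl q.1) (g := snd)) => //; last exact: continuous_snd.
  exact: (continuous_comp1 (@continuous_fst R) (@continuous_cl R)).
have ckz z : continuous (kk z) by exact: continuous_section.
have lkS z (g : R -> R) : continuous g -> lbm (fun y => kk z y * g y).
  by move=> cg; apply: lbm_continuous; exact: continuous_mul.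
have [C0 hC0] := (lbm_continuous cfc).2 1.
have C00 : 0 <= C0 by apply: le_trans (hC0 0 _); rewrite ?normr0.
pose C := M * C0.
have C_ge0 : 0 <= C by rewrite mulr_ge0// ltW.
(* The weight e^(2 M z) makes the Picard iteration a contraction of ratio 1/2. *)
have bnd n (z : R) : 0 <= z <= 1 -> `|S n.+1 z - S n z| <= C / 2 ^+ n * expR (2 * M * z).
  elim: n z => [|n IH] z z01; have /andP[z0 z1] := z01.
    rewrite /= (cl_id z01) addrAC subrr add0r expr0 divr1.
    rewrite (@le_trans _ _ (C * (z - 0)))//.
      apply: J_bound => //; first exact: lkS.
      move=> x /andP[x0 xz]; rewrite normrM ler_pM// hC0// ger0_norm// (le_trans xz z1)//.
    rewrite ler_wpM2l// subr0 (le_trans z1)// -expR0 ler_expR.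
    by rewrite !mulr_ge0// ltW.
  have -> : S n.+2 z - S n.+1 z = J 0 z (fun y => kk z y * (S n.+1 y - S n y)).
    rewrite (SE n.+1 z) (SE n z) (cl_id z01) opprD addrACA subrr add0r -JB; try exact: lkS.
    by apply: J_ext => y _; rewrite mulrBr.
  pose G y := C / 2 ^+ n / 2 * expR (2 * M * y).
  have cexp : continuous (fun y : R => expR (2 * M * y)).
    apply: (continuous_comp1 (f := fun y : R => 2 * M * y)); first by ctn.
    exact: continuous_expR.
  have cS2 : continuous (fun y => S n.+1 y - S n y) by apply: continuous_sub; exact: cS.
  rewrite (le_trans (norm_J_le _ _ (lkS _ _ cS2)))//.
  apply: (@le_trans _ _ (J 0 z (fun y => M * (C / 2 ^+ n) * expR (2 * M * y)))).
    apply: le_J; [exact/lbm_norm/lkS|by apply: lbmZ; exact: lbm_continuous|].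
    move=> x /andP[x0 xz]; rewrite normrM -mulrA ler_pM//.
    by apply: IH; rewrite x0 (le_trans xz).
  rewrite (@FTC R 0 z [::] G)//.
  - rewrite /G mulr0 expR0 mulr1 exprS invfM (mulrC 2^-1) mulrA lerBlDr lerDl.
    by rewrite !divr_ge0// exprn_ge0.
  - by apply: continuous_mul; [exact: continuous_const|].
  - by apply: lbmZ; exact: lbm_continuous.
  - move=> x _ _; split; last by apply: continuous_mul; [exact: continuous_const|].
    have D0 : is_derive x (1:R) (fun y : R => 2 * M * y) (2 * M).
      apply: is_derive_eq (is_deriveM (is_derive_cst (2 * M) x (1:R)) (is_derive_id x (1:R))) _.
      by rewrite /GRing.scale/= mulr1 mulr0 addr0.
    have D1 := @is_derive1_comp R expR (fun y => 2 * M * y) x _ _ (is_derive_expR _) D0.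
    have D2 : is_derive x (1:R) (fun=> C / 2 ^+ n / 2) 0 by exact: is_derive_cst.
    apply: is_derive_eq (is_deriveM D2 D1) _.
    by rewrite /GRing.scale/= mulr0 addr0; field; rewrite expf_neq0.
(* The largest value of the weight on [0, 1] turns the weighted contraction into a uniform bound. *)
pose c := C * expR (2 * M).
have c0 : 0 <= c by rewrite mulr_ge0// expR_ge0.
have SS n z : `|S n.+1 z - S n z| <= c / 2 ^+ n.
  have Scl m : S m z = S m (cl z).
    by case: m => [|m] /=; rewrite (cl_id (cl_itv z)).
  rewrite !Scl (le_trans (bnd n _ (cl_itv z)))// /c [leRHS]mulrAC ler_wpM2l ?divr_ge0 ?exprn_ge0//.
  by rewrite ler_expR -[leRHS]mulr1 ler_wpM2l ?mulr_ge0 ?(ltW M0)//; have /andP[] := cl_itv z.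
have hl (z : R) : exists l : R, forall n, `|l - S n z| <= 2 * c / 2 ^+ n.
  exact: geometric_limit c0 (SS^~ z).
have [g hg] := boolp.choice hl.
have cg : continuous g.
  move=> z; apply/cvgrPdist_le => e e0.
  have e3 : 0 < e / 3 by rewrite divr_gt0.
  have [n hn] := exp2_small (2 * c) e3.
  have /cvgrPdist_le/(_ _ e3) := cS n z; apply: filterS => y hy.
  have h1 := le_trans (hg z n) hn; have h2 := le_trans (hg y n) hn.
  have -> : g z - g y = (g z - S n z) + (S n z - S n y) - (g y - S n y) by ring.
  rewrite (le_trans (ler_normB _ _))// (le_trans (lerD (ler_normD _ _) (lexx _)))//; lra.
exists g; split => // z z01; have /andP[z0 z1] := z01.
apply/eqP; rewrite -subr_eq0 -normr_le0; apply/ler_addgt0Pr => e e0; rewrite add0r.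
(* The residual of the limit consists of g - S(n+1) and of the Volterra integral of g - S(n), which
   costs a factor [M]: together (1 + M) shares. *)
have eM : 0 < e / (1 + M) by rewrite divr_gt0// addr_gt0.
have [n hn] := exp2_small (2 * c) eM.
have hn1 : 2 * c / 2 ^+ n.+1 <= e / (1 + M).
  apply: le_trans hn; rewrite ler_wpM2l ?(mulr_ge0 (ler0n R 2) c0)//.
  by rewrite lef_pV2 ?posrE ?exprn_gt0// exprS ler_peMl ?exprn_ge0// ler1n.
have -> : g z - J 0 z (fun y => kk z y * g y) - f z =
    (g z - S n.+1 z) - J 0 z (fun y => kk z y * (g y - S n y)).
  rewrite /= (cl_id z01) (_ : J 0 z (fun y => kk z y * (g y - S n y)) =
    J 0 z (fun y => kk z y * g y) - J 0 z (fun y => kk z y * S n y)); first by ring.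
  rewrite -JB; [|exact: lkS|exact: lkS].
  by apply: J_ext => y _; rewrite mulrBr.
have h2 : `|J 0 z (fun y => kk z y * (g y - S n y))| <= M * (e / (1 + M)).
  rewrite (@le_trans _ _ (M * (e / (1 + M)) * (z - 0)))//.
    apply: J_bound => //; first by apply: lkS; exact: continuous_sub.
    by move=> x _; rewrite normrM ler_pM// (le_trans (hg x n)).
  by rewrite subr0 ler_piMr// mulr_ge0 ?(ltW M0)// ltW.
rewrite (le_trans (ler_normB _ _))//.
have h1 := le_trans (hg z n.+1) hn1.
rewrite (le_trans (lerD h1 h2))//.
rewrite le_eqVlt; apply/orP; left; apply/eqP; field.
by rewrite gt_eqF// addr_gt0.
Qed.

(** Cauchy-Schwarz against the constant 1, from the nonnegative integral of (g - m)^2 with [m] the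
    mean of [g]; the factor z is dropped because z <= 1. *)
Lemma J_sqr_le (z : R) (g : R -> R) : 0 <= z <= 1 -> lbm g ->
  (J 0 z g) ^+ 2 <= J 0 z (fun y => g y ^+ 2).
Proof.
move=> /andP[+ z1] lg; rewrite le_eqVlt => /predU1P[<-|z0].
  by rewrite !J_gt// expr0n.
pose m := J 0 z g / z.
have lg2 : lbm (fun y => g y ^+ 2).
  by under eq_fun do rewrite expr2; exact: lbmM.
have : 0 <= J 0 z (fun y => (g y ^+ 2 - (2 * m) * g y) + m ^+ 2).
  by apply: J_ge0 => y _; have := sqr_ge0 (g y - m); congr (_ <= _); ring.
rewrite JD; [|by apply: lbmB => //; exact: lbmZ|exact: lbm_cst].
rewrite JB//; last exact: lbmZ.
rewrite (JZ _ _ (2 * m) lg) (J_cst (m ^+ 2) (ltW z0)) subr0.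
have Jm : J 0 z g = m * z by rewrite /m divfK// gt_eqF.
rewrite Jm => H; have H2 : m ^+ 2 * z <= J 0 z (fun y => g y ^+ 2) by nra.
apply: le_trans H2; rewrite exprMn ler_wpM2l ?sqr_ge0//.
by rewrite expr2 ler_piMr// ltW.
Qed.

Section L2.
Variables (kk : R -> R -> R) (M : R) (e eps : R -> R).
Hypotheses (ck : cont2 kk) (M0 : 0 < M) (kM : forall z y, `|kk z y| <= M).
Hypotheses (ce : continuous e) (ceps : continuous eps).
Hypothesis eps_e : forall z : R, 0 <= z <= 1 -> eps z = e z - J 0 z (fun y => kk z y * e y).

Let csq (g : R -> R) : continuous g -> continuous (fun y => g y ^+ 2).
Proof. by move=> cg y; apply: continuous_exp; exact: cg. Qed.

Let Je (z : R) : 0 <= z <= 1 ->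
  (J 0 z (fun y => kk z y * e y)) ^+ 2 <= M ^+ 2 * J 0 z (fun y => e y ^+ 2).
Proof.
move=> z01; have cke : continuous (fun y => kk z y * e y).
  by apply: continuous_mul => //; exact: continuous_section.
apply: le_trans (J_sqr_le z01 (lbm_continuous cke)) _.
rewrite -JZ; last by apply: lbm_continuous; exact: csq.
apply: le_J; [by apply: lbm_continuous; exact: csq| |].
  by apply: lbmZ; apply: lbm_continuous; exact: csq.
move=> y _; rewrite exprMn ler_wpM2r ?sqr_ge0//.
by rewrite -[leLHS]real_normK ?num_real// lerXn2r ?nnegrE// ltW.
Qed.

(** From (e - j)^2 <= 2 e^2 + 2 j^2, where [j] is the Volterra term and j^2 is at most M^2 times the
    integral of e^2. *)
Lemma L2_transform_le :
  J 0 1 (fun y => eps y ^+ 2) <= (2 + 2 * M ^+ 2) * J 0 1 (fun y => e y ^+ 2).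
Proof.
set E := J 0 1 (fun y => e y ^+ 2).
have le2 := lbm_continuous (csq ce).
have -> : (2 + 2 * M ^+ 2) * E = J 0 1 (fun y => 2 * e y ^+ 2 + 2 * M ^+ 2 * E).
  by rewrite JD; [rewrite (JZ _ _ 2 le2) (J_cst _ ler01) subr0 -/E; ring|exact: lbmZ|exact: lbm_cst].
apply: le_J.
- exact: lbm_continuous (csq ceps).
- by apply: lbmD; [exact: lbmZ|exact: lbm_cst].
- move=> z z01; rewrite eps_e//; have := Je z01.
  have EE : J 0 z (fun y => e y ^+ 2) <= E.
    have /andP[z0 z1] := z01; rewrite /E -(J_cat le2 z0 z1) lerDl.
    by apply: J_ge0 => y _; exact: sqr_ge0.
  have : M ^+ 2 * J 0 z (fun y => e y ^+ 2) <= M ^+ 2 * E by rewrite ler_wpM2l ?sqr_ge0.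
  move: (J 0 z (fun y => kk z y * e y)) => j h1 h2.
  have := sqr_ge0 (e z + j); nra.
Qed.

(** Gronwall: e = eps + j gives e^2 <= 2 eps^2 + c Q with c = 2 M^2 and Q(z) the integral of e^2 up
    to z. With the integrating factor exp(- c z) the left-hand remainder becomes the derivative of
    [G]. *)
Lemma L2_inverse_transform_le :
  J 0 1 (fun y => e y ^+ 2) <= 2 * expR (2 * M ^+ 2) * J 0 1 (fun y => eps y ^+ 2).
Proof.
pose c := 2 * M ^+ 2.
have c0 : 0 <= c by rewrite mulr_ge0 ?sqr_ge0.
have le2 := lbm_continuous (csq ce).
pose Q z := J 0 z (fun y => e y ^+ 2).
have cQ : continuous Q by exact: J_continuous.
pose G z := expR (- c * z) * Q z.
pose g z := expR (- c * z) * (e z ^+ 2 - c * Q z).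
have cexp : continuous (fun y : R => expR (- c * y)).
  apply: (continuous_comp1 (f := fun y : R => - c * y)); first by ctn.
  exact: continuous_expR.
have cg : continuous g.
  apply: continuous_mul => //; apply: continuous_sub; first exact: csq.
  by apply: continuous_mul => //; exact: continuous_const.
have : J 0 1 g <= J 0 1 (fun y => 2 * eps y ^+ 2).
  apply: le_J; [exact: lbm_continuous| by apply: lbmZ; exact: lbm_continuous (csq ceps)|].
  move=> z z01; rewrite /g.
  have : e z ^+ 2 - c * Q z <= 2 * eps z ^+ 2.
    have := Je z01; rewrite -/(Q z) (_ : e z = eps z + J 0 z (fun y => kk z y * e y)); last by rewrite eps_e// subrK.
    move: (J 0 z (fun y => kk z y * e y)) => j h; rewrite /c.
    have := sqr_ge0 (eps z - j); nra.
  have e1 : expR (- c * z) <= 1.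
    by rewrite -expR0 ler_expR mulNr oppr_le0 mulr_ge0//; case/andP: z01.
  have ez := expR_ge0 (- c * z); have := sqr_ge0 (eps z).
  move: (expR _) (e z ^+ 2 - _) (eps z ^+ 2) ez e1 => x y w x0 x1 w0 yw.
  apply: le_trans (_ : x * (2 * w) <= _); first by rewrite ler_wpM2l.
  by rewrite ler_piMl// mulr_ge0.
rewrite JZ; last exact: lbm_continuous (csq ceps).
rewrite (@FTC R 0 1 [::] G g ler01).
- rewrite /G /Q [J 0 0 _]J_gt// mulr0 subr0 mulr1 expRN -/c mulrC ler_pdivrMr ?expR_gt0//.
  by rewrite mulrAC.
- exact: continuous_mul.
- exact: lbm_continuous.
- move=> x /andP[x0 x1] _; split; last exact: cg.
  have D0 : is_derive x (1:R) (fun y : R => - c * y) (- c).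
    apply: is_derive_eq (is_deriveM (is_derive_cst (- c) x (1:R)) (is_derive_id x (1:R))) _.
    by rewrite /GRing.scale/= mulr1 mulr0 addr0.
  have D1 := @is_derive1_comp R expR (fun y => - c * y) x _ _ (is_derive_expR _) D0.
  have D2 : is_derive x (1:R) Q (e x ^+ 2) by apply: is_derive_J => //; exact: csq.
  apply: is_derive_eq (is_deriveM D1 D2) _.
  by rewrite /GRing.scale/= /g /Q; ring.
Qed.

End L2.

(** Passage from the extended-real norm to [J]: [f] is the tracking error as defined, [g] a
    continuous function on the line with the same values on [0, 1]. *)
Lemma L2normE (f g : R -> R) : continuous g -> (forall z, 0 <= z <= 1 -> f z = g z) ->
  L2norm f = (Num.sqrt (J 0 1 (fun y => g y ^+ 2)))%:E.
Proof.
move=> cg fg.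
have cg2 : continuous (fun y => g y ^+ 2) by move=> y; apply: continuous_exp; exact: cg.
have ig2 := lbm_integrable 0 1 (lbm_continuous cg2).
rewrite /L2norm unlock.
have -> : (\int[@lebesgue_measure R]_x (`|(EFin \o (f \_ (@I01 R))) x| `^ 2)%E)%E =
   (J 0 1 (fun y => g y ^+ 2))%:E.
  rewrite /J /Rintegral fineK; last exact: integrable_fin_num.
  rewrite [RHS]integral_mkcond; apply: eq_integral => x _ /=.
  rewrite /patch /I01; case: ifPn => [|_].
    rewrite inE/= in_itv/= => x01; rewrite fg//.
    by rewrite powR_mulrn// real_normK// num_real.
  by rewrite normr0 powR0.
by rewrite poweR_EFin powR12_sqrt// J_ge0// => y _; exact: sqr_ge0.
Qed.

End Volterra.

(** * Derivatives relative to an interval *)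

Section OneSided.
Variable R : realType.
Implicit Types (f g : R -> R).

Lemma within_continuous_retract (T U V : topologicalType) (A : set U) (f : U -> V) (r : T -> U) (x : T) :
  {within A, continuous f} -> {for x, continuous r} -> (\forall y \near x, A (r y)) ->
  {for x, continuous (fun y => f (r y))}.
Proof.
move=> /subspace_continuousP cf cr Ar.
have Ax := nbhs_singleton Ar; rewrite /prop_for /continuous_at => W fW.
have := cr _ (cf _ Ax _ fW); apply: filterS2 Ar => y Ary; exact.
Qed.

Lemma is_derive_in_interior (A : set R) f (z l : R) (c d : R) : c < z < d ->
  (forall y, c < y < d -> A y) -> is_derive_in A f z l -> is_derive z (1:R) f l.
Proof.
move=> /andP[cz zd] HA /cvgrPdist_le H; apply/is_derive_epsP => e e0.
have [r /= r0 Hr] := H e e0.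
near=> y; have [->|yz] := eqVneq y z; first by rewrite !subrr mulr0 subrr normr0 mulr0.
have yz0 : y - z != 0 by rewrite subr_eq0.
have Ay : A y.
  by apply: HA; apply/andP; split; near: y; [exact: near_gt|exact: near_lt].
have yr : `|z - y| < r by near: y; exact: near_dist_lt.
have := Hr y yr yz Ay.
have -> : f y - f z - l * (y - z) = - (l - (f y - f z) / (y - z)) * (y - z) by field.
by rewrite normrM normrN => Hy; rewrite ler_wpM2r.
Unshelve. all: by end_near. Qed.

Lemma derivable_in_interior (A : set R) f (z : R) (c d : R) : c < z < d ->
  (forall y, c < y < d -> A y) -> derivable_in A f z -> is_derive z (1:R) f (derive_in A f z).
Proof.
move=> czd HA [l fl]; apply: (is_derive_in_interior czd HA).
by rewrite /is_derive_in /derive_in; apply/cvg_ex; exists l.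
Qed.

(** The limit is unique because the punctured neighbourhood within the segment is a proper filter:
    there are points to the right of z, or to its left when z = b. *)
Lemma derive_inE (a b : R) f (z l : R) : a < b -> a <= z <= b ->
  is_derive_in `[a, b]%classic f z l -> derive_in `[a, b]%classic f z = l.
Proof.
move=> ab /andP[az zb] H.
have P : ProperFilter (within `[a, b]%classic z^').
  apply: Build_ProperFilter_ex => P [e /= e0 He].
  have [zlb|bz] := ltP z b.
    pose y := z + Num.min (e / 2) (b - z).
    have m0 : 0 < Num.min (e / 2) (b - z) by rewrite lt_min divr_gt0//= subr_gt0.
    have me : Num.min (e / 2) (b - z) <= e / 2 by rewrite ge_min lexx.
    have mb : Num.min (e / 2) (b - z) <= b - z by rewrite ge_min lexx orbT.
    exists y; apply: He => /=; rewrite /y.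
    - by rewrite opprD addrA subrr sub0r normrN gtr0_norm//; lra.
    - by rewrite gt_eqF// ltrDl.
    - by rewrite in_itv/=; apply/andP; split; lra.
  pose y := z - Num.min (e / 2) (z - a).
  have za : a < z by rewrite (lt_le_trans ab).
  have m0 : 0 < Num.min (e / 2) (z - a) by rewrite lt_min divr_gt0//= subr_gt0.
  have me : Num.min (e / 2) (z - a) <= e / 2 by rewrite ge_min lexx.
  have mb : Num.min (e / 2) (z - a) <= z - a by rewrite ge_min lexx orbT.
  exists y; apply: He => /=; rewrite /y.
  - by rewrite opprB addrC subrK gtr0_norm//; lra.
  - by rewrite lt_eqF// gtrBl.
  - by rewrite in_itv/=; apply/andP; split; lra.
exact: cvg_lim.
Qed.

(** Meant for the feedback gain: at y = 1 the z-derivative of the kernel is taken relative to the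
    single point 1 and has no meaning, so equality is available on [0, 1) only. *)
Lemma J_ext_co (a b : R) f g : lbm g -> (forall x, a <= x < b -> f x = g x) -> J a b f = J a b g.
Proof.
move=> lg fg; rewrite /J.
have ig : (@lebesgue_measure R).-integrable `[a, b[ (EFin \o g).
  by apply: integrableS (lbm_integrable a b lg) => //; apply: subset_itvl; rewrite bnd_simp.
have if_ : (@lebesgue_measure R).-integrable `[a, b[ (EFin \o f).
  apply: eq_integrable ig => // x; rewrite inE/= in_itv/= => /fg fgx.
  by rewrite /= fgx.
rewrite -(Rintegral_itv_bndo_bndc if_) -(Rintegral_itv_bndo_bndc ig).
by apply: eq_Rintegral => x; rewrite inE/= in_itv/= => /fg.
Qed.

End OneSided.

(** * Regularity of the data and of the kernel *)

Section GevreyFamily.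
Variables (R : realType) (T : topologicalType) (h : T -> R -> R) (alpha t0 M rho : R).
Hypotheses (M0 : 0 < M) (rho0 : 0 < rho).
Hypothesis hb : forall p, gevrey_bounds alpha t0 M rho (h p).
Hypothesis hc : forall t p, t0 < t -> {for p, continuous (h^~ t)}.

Lemma gevrey_is_derive p (t : R) : t0 < t -> is_derive t (1:R) (h p) (derive1 (h p) t).
Proof.
move=> tt; have [H _] := hb p; have [D _] := H 0%N t tt.
by rewrite derive1E; apply: DeriveDef.
Qed.

(** [M1] and [M2] are the Gevrey bounds for the first and second time derivative, with (1!)^alpha =
    1 and (2!)^alpha = 2^alpha. *)
Let M1 := M / rho.
Let M2 := M / rho ^+ 2 * (2 `^ alpha).

Let M10 : 0 <= M1. Proof. by rewrite divr_ge0// ltW. Qed.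
Let M20 : 0 <= M2. Proof. by rewrite mulr_ge0 ?powR_ge0// divr_ge0 ?exprn_ge0// ltW. Qed.

Let is_derive2 p (t : R) : t0 < t -> is_derive t (1:R) (derive1 (h p)) (derive1n 2 (h p) t).
Proof.
move=> tt; have [H _] := hb p; have [D _] := H 1%N t tt.
have -> : derive1n 2 (h p) t = 'D_1 (derive1 (h p)) t by rewrite -derive1E.
exact: DeriveDef.
Qed.

Let lip (f df : R -> R) (K : R) : (forall t, t0 < t -> is_derive t (1:R) f (df t)) ->
  (forall t, t0 < t -> `|df t| <= K) ->
  forall t t', t0 < t -> t0 < t' -> `|f t - f t'| <= K * `|t - t'|.
Proof.
move=> dfP dfK t t'; wlog tt' : t t' / t' <= t.
  move=> W H H'; have [/W|/ltW/W] := leP t' t; first exact.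
  by rewrite distrC [`|t - _|]distrC; exact.
move=> H H'.
have D (x : R) : x \in `]t', t[ -> is_derive x (1:R) f (df x).
  by rewrite in_itv/= => /andP[x1 _]; apply: dfP; exact: lt_trans x1.
have Cf : {within `[t', t], continuous f}.
  apply: derivable_within_continuous => x; rewrite in_itv/= => /andP[x1 _].
  by have [] := dfP x (lt_le_trans H' x1).
have [c] := MVT_segment tt' D Cf; rewrite in_itv/= => /andP[c1 _] ->.
by rewrite normrM ler_wpM2r// dfK// (lt_le_trans H').
Qed.

Let lip0 p t t' : t0 < t -> t0 < t' -> `|h p t - h p t'| <= M1 * `|t - t'|.
Proof.
apply: (lip (df := derive1 (h p))); first exact: gevrey_is_derive.
move=> u tu; have [H _] := hb p; have [_] := H 1%N u tu.
by rewrite /= factS fact0 muln1 powR1 mulr1 expr1.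
Qed.

Let lip1 p t t' : t0 < t -> t0 < t' -> `|derive1 (h p) t - derive1 (h p) t'| <= M2 * `|t - t'|.
Proof.
apply: (lip (df := derive1n 2 (h p))); first exact: is_derive2.
by move=> u tu; have [H _] := hb p; have [_] := H 2 u tu.
Qed.

(** Derivatives are controlled only after [t0]; the right limit in [gevrey_bounds] extends the
    Lipschitz bound to [t0] by way of a slightly later instant. *)
Let lip0c p t t' : t0 <= t -> t0 < t' -> `|h p t - h p t'| <= M1 * `|t - t'|.
Proof.
rewrite le_eqVlt => /predU1P[<-|]; last exact: lip0.
move=> tt'; have [_ /cvgrPdist_le Hc] := hb p.
apply/ler_addgt0Pr => e e0.
have eM : 0 < e / (1 + M1) by rewrite divr_gt0// ltr_wpDr.
have nz : \forall u \near t0^'+, `|h p t0 - h p u| <= e / (1 + M1) /\ t0 < u /\ u - t0 <= e / (1 + M1).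
  near=> u; split; first by near: u; exact: Hc.
  split; first by near: u; exact: nbhs_right_gt.
  rewrite lerBlDl; near: u; apply: nbhs_right_le; by rewrite ltrDl.
have [u [h1 [h2 h3]]] := @filter_ex _ _ (at_right_proper_filter t0) _ nz.
have h4 := lip0 p h2 tt'.
have -> : h p t0 - h p t' = (h p t0 - h p u) + (h p u - h p t') by ring.
rewrite (le_trans (ler_normD _ _))//.
have h5 : `|u - t'| <= `|t0 - t'| + e / (1 + M1).
  have -> : u - t' = (t0 - t') + (u - t0) by ring.
  by rewrite (le_trans (ler_normD _ _))// lerD2l ger0_norm// subr_ge0 ltW.
have h6 : M1 * `|u - t'| <= M1 * (`|t0 - t'| + e / (1 + M1)) by rewrite ler_wpM2l.
rewrite (le_trans (lerD h1 (le_trans h4 h6)))//.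
rewrite le_eqVlt; apply/orP; left; apply/eqP; field.
by rewrite gt_eqF// ltr_wpDr.
Unshelve. all: by end_near. Qed.

Let lip0cc p t t' : t0 <= t -> t0 <= t' -> `|h p t - h p t'| <= M1 * `|t - t'|.
Proof.
rewrite le_eqVlt => /predU1P[<-|t1]; last by rewrite distrC [`|t - _|]distrC => /lip0c; exact.
rewrite le_eqVlt => /predU1P[<-|]; first by rewrite !subrr !normr0 mulr0.
exact: lip0c.
Qed.

Lemma gevrey_bound p t : t0 <= t -> `|h p t| <= M.
Proof.
have bt u : t0 < u -> `|h p u| <= M.
  move=> tu; have [H _] := hb p; have [_] := H 0%N u tu.
  by rewrite /= fact0 powR1 mulr1 expr0 divr1.
rewrite le_eqVlt => /predU1P[<-|]; last exact: bt.
have [_ Hc] := hb p.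
have Hn : `|h p u| @[u --> t0^'+] --> `|h p t0| by exact: cvg_norm.
apply: (closed_cvg (fun x : R => x <= M)) Hn; first exact: closed_le.
near=> u; apply: bt; near: u; exact: nbhs_right_gt.
Unshelve. all: by end_near. Qed.

Lemma gevrey_continuous : continuous (fun q : T * R => h q.1 (Num.max q.2 t0)).
Proof.
move=> [p t]; apply/cvgrPdist_le => /= e e0.
(* Continuity in [p] is available only at times after [t0], so both values are compared at the later
   instant [m], and the Lipschitz bound in time pays for the detour. The three pieces cost e/4, e/4
   and 2 e/4. *)
pose m := Num.max t t0 + e / (4 * (1 + M1)).
have eM : 0 < e / (4 * (1 + M1)) by rewrite divr_gt0// mulr_gt0// ltr_wpDr.
have mt : t0 < m by rewrite /m (@le_lt_trans _ _ (Num.max t t0)) ?le_max ?lexx ?orbT// ltrDl.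
have mm : Num.max t t0 - m = - (e / (4 * (1 + M1))) by rewrite /m; ring.
have e4 : 0 < e / 4 by rewrite divr_gt0.
have /cvgrPdist_le/(_ _ e4) n1 := @hc _ p mt.
have cmx : {for t, continuous (fun u : R => Num.max u t0)}.
  by apply: (@continuous_max R R (fun u => u) (fun=> t0)); [exact: continuous_ident|exact: continuous_const].
have /cvgrPdist_le/(_ _ eM) n2 := cmx.
exists ([set p' | `|h p m - h p' m| <= e / 4], [set t' | `|Num.max t t0 - Num.max t' t0| <= e / (4 * (1 + M1))]) => //= -[p' t'] /= [h1 h2].
have a1 : `|h p (Num.max t t0) - h p m| <= M1 * (e / (4 * (1 + M1))).
  rewrite (le_trans (lip0cc p _ (ltW mt)))//; first by rewrite le_max lexx orbT.
  by rewrite mm normrN gtr0_norm.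
have a2 : `|h p' m - h p' (Num.max t' t0)| <= M1 * (2 * (e / (4 * (1 + M1)))).
  rewrite (le_trans (lip0cc p' (ltW mt) _))//; first by rewrite le_max lexx orbT.
  rewrite ler_wpM2l//.
  have -> : m - Num.max t' t0 = - (Num.max t t0 - m) + (Num.max t t0 - Num.max t' t0) by ring.
  rewrite (le_trans (ler_normD _ _))// mm opprK gtr0_norm//; lra.
have -> : h p (Num.max t t0) - h p' (Num.max t' t0) = (h p (Num.max t t0) - h p m) +
   (h p m - h p' m) + (h p' m - h p' (Num.max t' t0)) by ring.
rewrite (le_trans (ler_normD _ _))// (le_trans (lerD (ler_normD _ _) (lexx _)))//.
have : M1 * (e / (4 * (1 + M1))) <= e / 4.
  rewrite (_ : _ * _ = e / 4 * (M1 / (1 + M1))); last by rewrite invfM; ring.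
  rewrite ler_piMr ?divr_ge0 ?(ltW e0)// ler_pdivrMr ?ltr_wpDr// mul1r.
  by rewrite lerDr.
move=> b1; have b2 : M1 * (2 * (e / (4 * (1 + M1)))) <= 2 * (e / 4) by rewrite mulrCA; lra.
by rewrite (le_trans (lerD (lerD a1 h1) a2))//; lra.
Qed.

(** Only [h] itself is assumed continuous in [p]. Its difference quotient with step [d] is therefore
    continuous in [p] too, and the bound on the second derivative makes it approximate the time
    derivative uniformly in [p]. *)
Lemma gevrey_derive_continuous p t : t0 < t ->
  {for (p, t), continuous (fun q : T * R => derive1 (h q.1) q.2)}.
Proof.
move=> tt; apply/cvgrPdist_le => /= e e0.
pose d := e / (6 * (1 + M2)).
have d0 : 0 < d by rewrite divr_gt0// mulr_gt0// ltr_wpDr.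
have Md : M2 * d <= e / 6.
  have -> : M2 * d = e / 6 * (M2 / (1 + M2)) by rewrite /d invfM; ring.
  rewrite ler_piMr ?divr_ge0 ?(ltW e0)// ler_pdivrMr ?ltr_wpDr// mul1r.
  by rewrite lerDr.
have td : t0 < t + d by rewrite (lt_trans tt)// ltrDl.
have quot p' : `|derive1 (h p') t - (h p' (t + d) - h p' t) / d| <= e / 6.
  have D (x : R) : x \in `]t, t + d[ -> is_derive x (1:R) (h p') (derive1 (h p') x).
    by rewrite in_itv/= => /andP[x1 _]; apply: gevrey_is_derive; exact: lt_trans x1.
  have Cf : {within `[t, t + d], continuous (h p')}.
    apply: derivable_within_continuous => x; rewrite in_itv/= => /andP[x1 _].
    by have [] := gevrey_is_derive p' (lt_le_trans tt x1).
  have tltd : t < t + d by rewrite ltrDl.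
  have [c] := MVT tltd D Cf; rewrite in_itv/= => /andP[c1 c2] ->.
  have -> : derive1 (h p') c * (t + d - t) / d = derive1 (h p') c by field; rewrite gt_eqF.
  rewrite (le_trans (lip1 _ _ _))//; first exact: lt_trans c1.
  rewrite (le_trans _ Md)// ler_wpM2l// ler0_norm ?subr_le0 ?ltW//; lra.
have ed : 0 < e / 6 * d by rewrite mulr_gt0// divr_gt0.
have /cvgrPdist_le/(_ _ ed) n1 := @hc _ p td.
have /cvgrPdist_le/(_ _ ed) n2 := @hc _ p tt.
have n3 := near_gt tt.
have n4 := near_dist_lt t d0.
exists ([set p' | `|h p (t + d) - h p' (t + d)| <= e / 6 * d /\ `|h p t - h p' t| <= e / 6 * d],
  [set t' | t0 < t' /\ `|t - t'| < d]).
  by split; apply: filterI.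
move=> [p' t'] /= [[h1 h2] [h3 h4]].
have q1 := quot p; have q2 := quot p'.
have q3 : `|derive1 (h p') t - derive1 (h p') t'| <= e / 6.
  by rewrite (le_trans (lip1 _ _ _))// (le_trans _ Md)// ler_wpM2l// ltW.
have q4 : `|(h p (t + d) - h p t) / d - (h p' (t + d) - h p' t) / d| <= e / 6 + e / 6.
  rewrite -mulrBl normrM normfV (gtr0_norm d0) ler_pdivrMr//.
  have -> : h p (t + d) - h p t - (h p' (t + d) - h p' t) =
     (h p (t + d) - h p' (t + d)) - (h p t - h p' t) by ring.
  by rewrite (le_trans (ler_normB _ _))// mulrDl lerD.
move: q1 q2 q3 q4; rewrite !ler_norml; lra.
Qed.

End GevreyFamily.

(** * The kernel, extended from the triangle to the plane *)

Section KernelFacts.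
Variables (R : realType) (alpha t0 mu : R) (A : agent R) (k : R -> R -> R -> R).
Hypothesis hA : admissible alpha t0 A.
Hypothesis hk : kernel_solution alpha t0 A mu k.
Local Notation cont2 m := (continuous (fun q : R * R => m q.1 q.2)).

Definition kap (z y t : R) := k (cl z) (clip 0 (cl z) y) t.
Definition kap_t (z y t : R) := derive1 (kap z y) t.

Let rt (q : R * R) : R * R := (cl q.1, clip 0 (cl q.1) q.2).

Let rt_triangle q : triangle (rt q).
Proof.
have /andP[z0 z1] := cl_itv q.1; split => //=.
exact: clip_itv.
Qed.

Let rt_cont q : {for q, continuous rt}.
Proof.
have c1 : continuous (fun q : R * R => cl q.1).
  exact: (continuous_comp1 (@continuous_fst R) (@continuous_cl R)).
apply: pair_continuous_at; first exact: c1.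
have : continuous (fun q : R * R => clip 0 (cl q.1) q.2) by ctn.
exact.
Qed.

Let retract_continuous (m : R -> R -> R) :
  {within @triangle R, continuous (fun zy : R * R => m zy.1 zy.2)} ->
  continuous (fun q : R * R => m (rt q).1 (rt q).2).
Proof.
move=> cm q; have near_tri : \forall p \near q, @triangle R (rt p).
  by near=> p; exact: rt_triangle.
exact: (within_continuous_retract cm (@rt_cont q) near_tri).
Unshelve. all: by end_near. Qed.

Lemma kap_id (z y t : R) : 0 <= y <= z -> z <= 1 -> kap z y t = k z y t.
Proof.
move=> /andP[y0 yz] z1; have zc : cl z = z by rewrite cl_id// z1 (le_trans y0).
by rewrite /kap zc clip_id// y0.
Qed.

(** The bound is the Gevrey estimate of order 0, uniform in time down to and including [t0]; the
    constant of the exponential estimate is built from it. *)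
Lemma kap_facts : exists M : R, [/\ 0 < M,
  forall z y t, t0 <= t -> `|kap z y t| <= M,
  continuous (fun q : (R * R) * R => kap q.1.1 q.1.2 (Num.max q.2 t0)),
  forall z y t, t0 < t -> is_derive t (1:R) (kap z y) (kap_t z y t) &
  forall p t, t0 < t -> {for (p, t), continuous (fun q : (R * R) * R => kap_t q.1.1 q.1.2 q.2)}].
Proof.
have [[M [rho [M0 rho0 Hb]]] Hc] := ker_reg hk.
pose h (q : R * R) (t : R) := k (rt q).1 (rt q).2 t.
have hb p : gevrey_bounds alpha t0 M rho (h p) by apply: Hb; exact: rt_triangle.
have hc t p : t0 < t -> {for p, continuous (h^~ t)}.
  by move=> tt; exact: (retract_continuous (m := fun z y => k z y t) (Hc t tt)).
exists M; split => //.
- by move=> z y t tt; exact: (gevrey_bound hb (z, y) tt).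
- exact: (gevrey_continuous M0 rho0 hb hc).
- by move=> z y t tt; exact: (gevrey_is_derive hb (z, y) tt).
- by move=> p t tt; exact: (gevrey_derive_continuous M0 rho0 hb hc).
Qed.

Lemma kap_continuous2 (t : R) : t0 <= t -> cont2 (fun z y => kap z y t).
Proof.
move=> tt q; have [M [_ _ H _ _]] := kap_facts.
have -> : (fun q : R * R => kap q.1 q.2 t) =
    (fun q : (R * R) * R => kap q.1.1 q.1.2 (Num.max q.2 t0)) \o (fun q => (q, t)).
  by apply/funext => p /=; rewrite max_l.
apply: continuous_comp; last exact: H.
by apply: pair_continuous_at; [exact: cvg_id|exact: cvg_cst].
Qed.

Section fixed_time.
Variable t : R.
Hypothesis tt : t0 < t.

Let lam0 : 0 < lam A. Proof. exact: lam_gt0 hA. Qed.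

Lemma a_continuous : continuous (fun y => a A (cl y) t).
Proof.
move=> y; apply: (@within_continuous_retract _ _ _ (@I01 R) (fun y => a A y t) (@cl R)).
- by have [_] := a_reg hA; exact.
- exact: continuous_cl.
- by near=> z; rewrite /I01 /= in_itv/=; exact: cl_itv.
Unshelve. all: by end_near. Qed.

(* k_zz - k_yy, read off the kernel equation. *)
Definition kap_box (z y : R) :=
  (kap_t z y t + (a A (cl y) t + mu) * kap z y t) / lam A.

Lemma kap_t_continuous2 : cont2 (fun z y => kap_t z y t).
Proof.
move=> q; have [M [_ _ _ _ H]] := kap_facts.
apply: (@continuous_comp _ _ _ (fun q : R * R => (q, t)) (fun q : (R * R) * R => kap_t q.1.1 q.1.2 q.2) q).
  by apply: pair_continuous_at; [exact: cvg_id|exact: cvg_cst].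
exact: H.
Qed.

Lemma kap_box_continuous2 : cont2 kap_box.
Proof.
apply: continuous_mul; last exact: continuous_const.
apply: continuous_add; first exact: kap_t_continuous2.
apply: continuous_mul; last exact: (kap_continuous2 (ltW tt)).
apply: continuous_add; last exact: continuous_const.
exact: (continuous_comp1 (@continuous_snd R) a_continuous).
Qed.

(** Derivatives relative to a section of the triangle become two-sided where the variable is
    interior to that section. The last two clauses are the traces that meet the boundary conditions:
    at z = 1 the feedback gain up to sign, at y = 0 the Robin condition. *)
Lemma kap_partials : exists kz ky : R -> R -> R,
  [/\ cont2 kz /\ cont2 ky,
      forall y z : R, 0 <= y -> y < z -> z < 1 -> is_derive z (1:R) (fun z => kap z y t) (kz z y),
      forall y z : R, 0 < y -> y < z -> z <= 1 -> is_derive y (1:R) (fun y => kap z y t) (ky z y),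
      forall y z : R, 0 < y -> y < z -> z < 1 ->
        is_derive (0:R) (1:R) (fun h => kz (z + h) (y - h) + ky (z + h) (y - h)) (kap_box z y) &
      (forall y : R, 0 <= y < 1 -> kernel_dz k 1 y t = kz 1 y) /\
      (forall z : R, 0 < z < 1 -> ky z 0 = q A t * kap z 0 t)].
Proof.
have [kz [ky [ckz cky Hd Hbox]]] := ker_pde hk tt.
exists (fun z y => kz (rt (z, y)).1 (rt (z, y)).2), (fun z y => ky (rt (z, y)).1 (rt (z, y)).2).
have rt_id z y : 0 <= y <= z -> z <= 1 -> rt (z, y) = (z, y).
  move=> /andP[y0 yz] z1; have zc : cl z = z by rewrite cl_id// z1 (le_trans y0).
  by rewrite /rt /= zc clip_id// y0.
split.
- by split; [exact: (retract_continuous ckz)|exact: (retract_continuous cky)].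
- move=> y z y0 yz z1; rewrite rt_id ?y0 ?ltW//=.
  have [D _] : _ /\ _ := Hd z y (conj (introT andP (conj y0 (ltW yz))) (ltW z1)).
  have D2 : is_derive z (1:R) (fun z' => k z' y t) (kz z y).
    apply: (@is_derive_in_interior R _ _ z _ y 1) D; first by rewrite yz.
    by move=> x /andP[x1 x2]; rewrite /= in_itv/= !ltW.
  apply: near_eq_is_derive D2; near=> z'.
  by rewrite kap_id// ?y0 /= ltW//; near: z'; first [exact: near_lt|exact: near_gt].
- move=> y z y0 yz z1; rewrite rt_id ?(ltW y0) ?(ltW yz)//=.
  have [_ D] : _ /\ _ := Hd z y (conj (introT andP (conj (ltW y0) (ltW yz))) z1).
  have D2 : is_derive y (1:R) (fun y' => k z y' t) (ky z y).
    apply: (@is_derive_in_interior R _ _ y _ 0 z) D; first by rewrite y0.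
    by move=> x /andP[x1 x2]; rewrite /= in_itv/= !ltW.
  apply: near_eq_is_derive D2; near=> y'.
  by rewrite kap_id//; apply/andP; split; rewrite ltW//; near: y'; first [exact: near_lt|exact: near_gt].
- move=> y z y0 yz z1; have [box [D Hb]] := Hbox z y y0 yz z1.
  (* The kernel equation provides a number [box] for each point separately; solving the equation for
     it yields a function continuous on the whole plane. *)
  have -> : kap_box z y = box.
    have p1 : 0 <= y <= z by rewrite !ltW.
    have p2 : z <= 1 by exact: ltW.
    rewrite /kap_box cl_id; last by rewrite (ltW y0) ltW// (lt_trans yz).
    have -> : kap_t z y t = derive1 (k z y) t.
      by rewrite /kap_t; congr (derive1 _ t); apply/funext => t'; rewrite kap_id.
    rewrite kap_id//.
    by rewrite Hb subrK mulrAC divff ?mul1r// gt_eqF.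
  apply: near_eq_is_derive D; near=> h.
  (* These bounds, together with the one by (z - y) / 2, keep (z + h, y - h) inside the triangle. *)
  have h1 : `|0 - h| < Num.min y (1 - z).
    by near: h; apply: near_dist_lt; rewrite lt_min y0 subr_gt0.
  have h2 : `|0 - h| < (z - y) / 2 by near: h; apply: near_dist_lt; rewrite divr_gt0// subr_gt0.
  move: h1 h2; rewrite lt_min sub0r normrN => /andP[]; rewrite !ltr_norml => h1 h2 h3.
  by rewrite rt_id//; [apply/andP; split|]; lra.
- split.
    move=> y /andP[y0 y1]; rewrite /kernel_dz rt_id ?y0 ?(ltW y1) ?lexx//=.
    apply: derive_inE => //; first by rewrite (ltW y1) lexx.
    by have [D _] : _ /\ _ := Hd 1 y (conj (introT andP (conj y0 (ltW y1))) (lexx 1)).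
  move=> z z01; have /andP[z0 z1] := z01; rewrite rt_id ?lexx ?(ltW z0) ?(ltW z1)//=.
  rewrite kap_id ?lexx ?(ltW z0) ?(ltW z1)// -(ker_bc0 hk z01 tt) /kernel_dy; apply/esym.
  apply: derive_inE => //; first by rewrite lexx (ltW z0).
  by have [_ D] : _ /\ _ := Hd z 0 (conj (introT andP (conj (lexx 0) (ltW z0))) (ltW z1)).
Unshelve. all: by end_near. Qed.

Lemma kap_diag_derive (kz ky : R -> R -> R) : cont2 kz -> cont2 ky ->
  (forall y z : R, 0 <= y -> y < z -> z < 1 -> is_derive z (1:R) (fun z => kap z y t) (kz z y)) ->
  (forall y z : R, 0 < y -> y < z -> z <= 1 -> is_derive y (1:R) (fun y => kap z y t) (ky z y)) ->
  forall s : R, 0 < s < 1 -> kz s s + ky s s = - ((a A (cl s) t + mu) / (2 * lam A)).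
Proof.
move=> ckz cky dkz dky s /andP[s0 s1].
have ckap := kap_continuous2 (ltW tt).
have D1 : is_derive s (1:R) (fun s => kap s s t) (kz s s + ky s s).
  apply/is_derive_epsP => e e0; have e2 : 0 < e / 2 by rewrite divr_gt0.
  have /cvgrPdist_le/(_ _ e2) [[U1 V1]/= [[d1 /= d10 HU1] [d2 /= d20 HV1]] UV1] := ckz (s, s).
  have /cvgrPdist_le/(_ _ e2) [[U2 V2]/= [[d3 /= d30 HU2] [d4 /= d40 HV2]] UV2] := cky (s, s).
  pose d := Num.min (Num.min d1 d2) (Num.min d3 d4).
  have d0 : 0 < d by rewrite !lt_min d10 d20 d30 d40.
  have inc (u v : R) : 0 < u -> u <= v -> v < 1 -> `|s - u| < d -> `|s - v| < d ->
      `|kap v v t - kap u u t - (kz s s + ky s s) * (v - u)| <= e * `|v - u|.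
    move=> u0 uv v1 su sv.
    have dist (x : R) : u <= x <= v -> `|s - x| < d.
      by move: su sv; rewrite !ltr_norml => /andP[? ?] /andP[? ?] /andP[? ?]; apply/andP; split; lra.
    have I1 : J u v (ky v) = kap v v t - kap v u t.
      apply: (@FTC R u v [::] (fun y => kap v y t)) => //.
      - exact: (continuous_section (m := fun z y => kap z y t)).
      - by apply: lbm_continuous; exact: continuous_section.
      - move=> x /andP[x1 x2] _; split; last exact: (continuous_section (m := ky)).
        by apply: dky => //; [exact: lt_trans x1|exact: ltW].
    have I2 : J u v (kz^~ u) = kap v u t - kap u u t.
      apply: (@FTC R u v [::] (fun z => kap z u t)) => //.
      - exact: (continuous_section2 (m := fun z y => kap z y t)).
      - by apply: lbm_continuous; exact: continuous_section2.
      - move=> x /andP[x1 x2] _; split; last exact: (continuous_section2 (m := kz)).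
        by apply: dkz => //; [exact: ltW|exact: lt_trans v1].
    have lky : lbm (fun y => ky v y - ky s s).
      by apply: lbmB; [apply: lbm_continuous; exact: continuous_section|exact: lbm_cst].
    have lkz : lbm (fun z => kz z u - kz s s).
      by apply: lbmB; [apply: lbm_continuous; exact: continuous_section2|exact: lbm_cst].
    have -> : kap v v t - kap u u t - (kz s s + ky s s) * (v - u) =
       J u v (fun y => ky v y - ky s s) + J u v (fun z => kz z u - kz s s).
      rewrite !JB; [|by apply: lbm_continuous; exact: continuous_section2|exact: lbm_cst
        |by apply: lbm_continuous; exact: continuous_section|exact: lbm_cst].
      by rewrite I1 I2 !J_cst//; ring.
    rewrite (le_trans (ler_normD _ _))// (splitr e) mulrDl (ger0_norm (_ : 0 <= v - u)) ?subr_ge0//.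
    apply: lerD; apply: J_bound => // x xuv; rewrite distrC.
      have := dist x xuv; have := dist v; rewrite lexx uv => /(_ isT).
      rewrite !lt_min => /andP[_ /andP[a3 _]] /andP[_ /andP[_ b4]].
      by apply: (UV2 (v, x)); split; [exact: HU2|exact: HV2].
    have := dist x xuv; have := dist u; rewrite lexx uv => /(_ isT).
    rewrite !lt_min => /andP[/andP[_ a2] _] /andP[/andP[b1 _] _].
    by apply: (UV1 (x, u)); split; [exact: HU1|exact: HV1].
  near=> s'.
  have s'0 : 0 < s' by near: s'; exact: near_gt.
  have s'1 : s' < 1 by near: s'; exact: near_lt.
  have sd : `|s - s'| < d by near: s'; exact: near_dist_lt.
  have ssd : `|s - s| < d by rewrite subrr normr0.
  have [ss'|/ltW s's] := leP s s'; first exact: inc.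
  have := inc s' s s'0 s's s1 sd ssd.
  rewrite [`|s - s'|]distrC; apply: le_trans.
  by rewrite -normrN le_eqVlt; apply/orP; left; apply/eqP; congr `|_|; ring.
have ca : continuous (fun y => (a A (cl y) t + mu) / (2 * lam A)).
  apply: continuous_mul; last exact: continuous_const.
  by apply: continuous_add; [exact: a_continuous|exact: continuous_const].
have D2 : is_derive s (1:R) (fun s => kap s s t) (- ((a A (cl s) t + mu) / (2 * lam A))).
  have D0 := is_derive_J (lbm_continuous ca) s0 (ca s).
  have D : is_derive s (1:R) (fun s => q A t - J 0 s (fun y => (a A (cl y) t + mu) / (2 * lam A)))
     (- ((a A (cl s) t + mu) / (2 * lam A))).
    by apply: is_derive_eq (is_deriveB (is_derive_cst (q A t) s (1:R)) D0) _; rewrite sub0r.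
  apply: near_eq_is_derive D; near=> s'.
  have s'0 : 0 <= s' by rewrite ltW//; near: s'; exact: near_gt.
  have s'1 : s' <= 1 by rewrite ltW//; near: s'; exact: near_lt.
  rewrite kap_id ?s'0 ?lexx// (ker_diag hk _ tt) ?s'0//; congr (_ - _).
  apply: J_ext => y /andP[y0 ys]; rewrite cl_id// y0/=; exact: le_trans s'1.
by case: D1 => _ <-; case: D2 => _ <-.
Unshelve. all: by end_near. Qed.

(** This value cancels q x(0, t) when the transformed state is differentiated at z = 0. *)
Lemma kap00 : kap 0 0 t = q A t.
Proof.
rewrite kap_id ?lexx// (ker_diag hk _ tt) ?lexx ?ler01//.
by rewrite -/(J 0 0 _) J_gt// subr0.
Qed.

End fixed_time.
End KernelFacts.

(** * Piecewise continuous data *)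

Section PiecewiseContinuity.
Variable R : realType.
Local Notation cont2 m := (continuous (fun q : R * R => m q.1 q.2)).

(** Continuity off a finite set is the form in which [FTC] accepts jumps; [lbm] gives integrability
    across them. *)
Definition pwc (F : R -> R) := lbm F /\
  exists D : seq R, forall z : R, 0 < z < 1 -> z \notin D -> {for z, continuous F}.

(* f is C^1 with derivative f1, and f2 is the piecewise continuous f''. *)
Definition pwC2 (f f1 f2 : R -> R) :=
  [/\ continuous f, continuous f1, lbm f2,
      forall z : R, 0 < z < 1 -> is_derive z (1:R) f (f1 z) &
      exists D : seq R, forall z : R, 0 < z < 1 -> z \notin D ->
        is_derive z (1:R) f1 (f2 z) /\ {for z, continuous f2}].

Lemma pwc_continuous F : continuous F -> pwc F.
Proof. by move=> cF; split; [exact: lbm_continuous|exists [::] => z _ _; exact: cF]. Qed.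

Lemma pwcD F G : pwc F -> pwc G -> pwc (fun z => F z + G z).
Proof.
move=> [lF [D HD]] [lG [D' HD']]; split; first exact: lbmD.
exists (D ++ D') => z z01; rewrite mem_cat negb_or => /andP[zD zD'].
by apply: cvgD; [exact: HD|exact: HD'].
Qed.

Lemma pwcM F G : pwc F -> pwc G -> pwc (fun z => F z * G z).
Proof.
move=> [lF [D HD]] [lG [D' HD']]; split; first exact: lbmM.
exists (D ++ D') => z z01; rewrite mem_cat negb_or => /andP[zD zD'].
by apply: cvgM; [exact: HD|exact: HD'].
Qed.

Lemma pwcZ (c : R) F : pwc F -> pwc (fun z => c * F z).
Proof. by apply: pwcM; apply: pwc_continuous; exact: continuous_const. Qed.

Lemma pwcZr (c : R) F : pwc F -> pwc (fun z => F z * c).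
Proof. by move=> pF; apply: pwcM => //; apply: pwc_continuous; exact: continuous_const. Qed.

Lemma pwcB F G : pwc F -> pwc G -> pwc (fun z => F z - G z).
Proof.
move=> pF /(pwcZ (-1)) pG; have := pwcD pF pG.
by under eq_fun do rewrite mulN1r.
Qed.

Lemma pwc_sum (I : Type) (s : seq I) (F : I -> R -> R) :
  (forall i, pwc (F i)) -> pwc (fun z => \sum_(i <- s) F i z).
Proof.
move=> pF; elim: s => [|i s IH].
  under eq_fun do rewrite big_nil; apply: pwc_continuous; exact: continuous_const.
by under eq_fun do rewrite big_cons; exact: pwcD.
Qed.

Lemma pwC2_sum (I : Type) (s : seq I) (f f1 f2 : I -> R -> R) (c : I -> R) :
  (forall i, pwC2 (f i) (f1 i) (f2 i)) ->
  pwC2 (fun z => \sum_(i <- s) f i z * c i) (fun z => \sum_(i <- s) f1 i z * c i)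
       (fun z => \sum_(i <- s) f2 i z * c i).
Proof.
move=> H; elim: s => [|i s [c0 c1 l2 d0 [D HD]]].
  have E : (fun z => \sum_(i <- [::]) f i z * c i) = fun=> 0 by apply/funext => z; rewrite big_nil.
  have E1 : (fun z => \sum_(i <- [::]) f1 i z * c i) = fun=> 0 by apply/funext => z; rewrite big_nil.
  have E2 : (fun z => \sum_(i <- [::]) f2 i z * c i) = fun=> 0 by apply/funext => z; rewrite big_nil.
  rewrite E E1 E2; split; [exact: continuous_const|exact: continuous_const|exact: lbm_cst| |].
    by move=> z _; exact: is_derive_cst.
  by exists [::] => z _ _; split; [exact: is_derive_cst|exact: continuous_const].
have E : (fun z => \sum_(j <- i :: s) f j z * c j) = fun z => f i z * c i + \sum_(j <- s) f j z * c j.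
  by apply/funext => z; rewrite big_cons.
have E1 : (fun z => \sum_(j <- i :: s) f1 j z * c j) = fun z => f1 i z * c i + \sum_(j <- s) f1 j z * c j.
  by apply/funext => z; rewrite big_cons.
have E2 : (fun z => \sum_(j <- i :: s) f2 j z * c j) = fun z => f2 i z * c i + \sum_(j <- s) f2 j z * c j.
  by apply/funext => z; rewrite big_cons.
have [ci ci1 li2 di [Di HDi]] := H i.
have dc (g : R -> R) (g' z : R) : is_derive z (1:R) g g' -> is_derive z (1:R) (fun z => g z * c i) (g' * c i).
  move=> dg; have dk : is_derive z (1:R) (fun=> c i) 0 by exact: is_derive_cst.
  by apply: is_derive_eq (is_deriveM dg dk) _; rewrite /GRing.scale/= mulr0 add0r mulrC.
rewrite E E1 E2; split.
- by apply: continuous_add => //; apply: continuous_mul => //; exact: continuous_const.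
- by apply: continuous_add => //; apply: continuous_mul => //; exact: continuous_const.
- by apply: lbmD => //; apply: lbmM => //; exact: lbm_cst.
- by move=> z z01; exact: is_deriveD (dc _ _ _ (di z z01)) (d0 z z01).
- exists (Di ++ D) => z z01; rewrite mem_cat negb_or => /andP[zDi zD].
  have [a1 a2] := HDi z z01 zDi; have [b1 b2] := HD z z01 zD; split.
    exact: is_deriveD (dc _ _ _ a1) b1.
  by apply: cvgD => //; apply: cvgM => //; exact: cvg_cst.
Qed.

Lemma J_pwC2 (f f1 f2 : R -> R) (z : R) : pwC2 f f1 f2 -> 0 <= z <= 1 ->
  J 0 z f1 = f z - f 0 /\ J 0 z f2 = f1 z - f1 0.
Proof.
move=> [cf cf1 l2 df [D HD]] /andP[z0 z1].
have sub (x : R) : 0 < x < z -> 0 < x < 1.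
  by move=> /andP[-> xz]; rewrite (lt_le_trans xz).
split.
  apply: (@FTC R 0 z [::] f f1) => //; first exact: lbm_continuous.
  by move=> x /sub x01 _; split; [exact: df|exact: cf1].
by apply: (@FTC R 0 z D f1 f2) => // x /sub x01; exact: HD.
Qed.

(** Measurability is the point: [0, 1] is covered by the open set of interior points off [D], where
    [f] is continuous, and by the finite set [F] made of [D] and both end points, whose subsets are
    all measurable. *)
Lemma pwc_restrict (f : R -> R) (M : R) (D : seq R) : 0 < M ->
  (forall z, I01 z -> `|f z| <= M) ->
  (forall z, I01 z -> z \notin D -> f y @[y --> within (@I01 R) (nbhs z)] --> f z) ->
  pwc (f \_ (@I01 R)).
Proof.
move=> M0 fM fD.
have cf (z : R) : 0 < z < 1 -> z \notin D -> {for z, continuous (f \_ (@I01 R))}.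
  move=> /andP[z0 z1] zD.
  have nI : \forall y \near z, (@I01 R) y.
    near=> y; rewrite /I01/= in_itv/= !ltW//; near: y; first [exact: near_lt|exact: near_gt].
  apply: (@near_eq_continuous_at _ _ _ f).
    by near=> y; rewrite /patch mem_set//; near: y.
  have := fD z (nbhs_singleton nI) zD; rewrite /prop_for /continuous_at => H V fV.
  by have := H V fV; apply: filterS2 nI => y Iy; exact.
split; last by exists D.
split.
  have mI : measurable (@I01 R) by exact: measurable_itv.
  apply/(measurable_restrictT _ mI).
  pose F := [set` [:: 0, 1 & D]] : set R.
  have finF : finite_set F by exact: finite_seq.
  pose U : set R := `]0, 1[%classic `&` ~` F.
  have oU : open U.
    apply: openI; first exact: itv_open.
    by apply: closed_openC; apply: compact_closed; [exact: norm_hausdorff|exact: finite_compact].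
  have mU : measurable U by exact: open_measurable.
  have mset (B : set R) : finite_set B -> measurable B.
    move=> fB; apply: countable_measurable; last exact: finite_set_countable.
    by move=> y; exact: measurable_set1.
  have mUF : measurable_fun (U `|` F) f.
    apply/measurable_funU => //; first exact: mset.
    split; last by move=> _ Y mY; apply: mset; exact: finite_setIl.
    apply: open_continuous_measurable_fun => // z; rewrite inE => -[/= + zF].
    rewrite in_itv/= => z01.
    have zD : z \notin D.
      by apply/negP => zD; apply: zF; rewrite /F /= !inE zD !orbT.
    have /andP[z0 z1] := z01.
    apply: (@near_eq_continuous_at _ _ _ (f \_ (@I01 R))); last exact: cf.
    near=> y; rewrite /patch mem_set// /I01/= in_itv/= !ltW//.
      by near: y; first [exact: near_lt|exact: near_gt].
    by near: y; first [exact: near_lt|exact: near_gt].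
  apply: measurable_funS mUF; first by apply: measurableU => //; exact: mset.
  move=> z; rewrite /I01/= in_itv/= => /andP[z0 z1].
  have [zF|zF] := pselect (F z); first by right.
  left; split => //=; rewrite in_itv/= !lt_neqAle z0 z1 !andbT.
  apply/andP; split; apply/eqP => E; apply: zF; rewrite /F /= !inE.
    by rewrite -E eqxx.
  by rewrite E eqxx orbT.
move=> r; exists M => z _; rewrite /patch; case: ifPn => [|_]; last by rewrite normr0 ltW.
by rewrite inE => /fM.
Unshelve. all: by end_near. Qed.

(** Here [g] may jump, so the integrand is not jointly continuous; it suffices that [m] varies
    uniformly over [0, 1] by [tube] while [g] stays bounded. *)
Lemma continuous_J_weight (m : R -> R -> R) (g : R -> R) : cont2 m -> lbm g ->
  continuous (fun z => J 0 (cl z) (fun y => m z y * g y)).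
Proof.
move=> cm lg z.
have lm z' : lbm (m z') by apply: lbm_continuous; exact: continuous_section.
have [C0 gC0] := lg.2 1.
pose C := `|C0| + 1.
have C0' : 0 < C by rewrite ltr_wpDl.
have gC y : 0 <= y <= 1 -> `|g y| <= C.
  move=> /andP[y0 y1]; rewrite (le_trans (gC0 y _)) ?ger0_norm//.
  by rewrite /C (le_trans (ler_norm _))// lerDl.
rewrite (_ : (fun z' => _) = (fun z' => J 0 (cl z') (fun y => m z y * g y) +
   (J 0 (cl z') (fun y => m z' y * g y) - J 0 (cl z') (fun y => m z y * g y)))); last first.
  by apply/funext => p; rewrite addrC subrK.
rewrite /continuous_at subrr -[J 0 (cl z) _ + 0]addr0.
apply: cvgD; last first.
  apply/cvgrPdist_le => /= e e0.
  have eC : 0 < e / C by rewrite divr_gt0.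
  have := @tube R R m z 0 1 (fun y _ => cm (z, y)) _ eC.
  apply: filterS => z' Hz'; have /andP[z'0 z'1] := cl_itv z'.
  rewrite sub0r normrN -JB; [|exact: lbmM|exact: lbmM].
  rewrite (@le_trans _ _ (e * (cl z' - 0)))//; last by rewrite subr0 ler_piMr// ltW.
  apply: J_bound => //; first by apply: lbmB; exact: lbmM.
  move=> y /andP[y0 yz]; have y01 : 0 <= y <= 1 by rewrite y0 (le_trans yz).
  rewrite -mulrBl normrM -[e](divfK (_ : C != 0)); last by rewrite gt_eqF.
  by rewrite ler_pM// ?Hz' ?gC.
rewrite addr0; apply: (@continuous_comp _ _ _ (@cl R) (fun b => J 0 b (fun y => m z y * g y))).
  exact: continuous_cl.
by apply: J_continuous; exact: lbmM.
Qed.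

Lemma continuous_at_sum (T : topologicalType) (I : Type) (s : seq I) (F : I -> T -> R) (x : T) :
  (forall i, {for x, continuous (F i)}) -> {for x, continuous (fun y => \sum_(i <- s) F i y)}.
Proof.
move=> cF; elim: s => [|i s IH].
  have -> : (fun y => \sum_(i <- [::]) F i y) = fun=> 0 by apply/funext => y; rewrite big_nil.
  exact: cvg_cst.
have -> : (fun y => \sum_(j <- i :: s) F j y) = fun y => F i y + \sum_(j <- s) F j y.
  by apply/funext => y; rewrite big_cons.
by apply: cvgD => //; exact: cF.
Qed.

Lemma is_derive_bigsum (I : Type) (s : seq I) (F : I -> R -> R) (dF : I -> R) (x : R) :
  (forall i, is_derive x (1:R) (F i) (dF i)) ->
  is_derive x (1:R) (fun y => \sum_(i <- s) F i y) (\sum_(i <- s) dF i).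
Proof.
move=> dFP; elim: s => [|i s IH].
  have -> : (fun y => \sum_(i <- [::]) F i y) = fun=> 0 by apply/funext => y; rewrite big_nil.
  by rewrite big_nil; exact: is_derive_cst.
have -> : (fun y => \sum_(j <- i :: s) F j y) = fun y => F i y + \sum_(j <- s) F j y.
  by apply/funext => y; rewrite big_cons.
by rewrite big_cons; exact: is_deriveD.
Qed.

Lemma continuous_max_right (g dg : R -> R) (s : R) :
  (forall t, s < t -> is_derive t (1:R) g (dg t)) ->
  g t @[t --> s^'+] --> g s -> continuous (fun t => g (Num.max s t)).
Proof.
move=> dgP gs t.
have [ts|st|->] := ltgtP t s.
- apply: (@near_eq_continuous_at _ _ _ (fun=> g s)); last exact: cvg_cst.
  by near=> u; rewrite max_l// ltW//; near: u; exact: near_lt.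
- apply: (@near_eq_continuous_at _ _ _ g).
    by near=> u; rewrite max_r// ltW//; near: u; exact: near_gt.
  have [dd _] := dgP t st.
  by apply: differentiable_continuous; exact/derivable1_diffP.
- rewrite /continuous_at maxxx; apply/cvgrPdist_le => e e0.
  have /cvgrPdist_le/(_ _ e0)[d /= d0 Hd] := gs.
  exists d => // u /= ud; have [us|su] := leP u s.
    by rewrite subrr normr0 ltW.
  exact: Hd.
Unshelve. all: by end_near. Qed.

End PiecewiseContinuity.

(** * Strong solutions, regular from [s0] on and used from a later time [s] *)

Section StrongSolutions.
Variables (R : realType) (s0 s : R) (x : R -> R -> R).
Hypotheses (hx : strong_regularity s0 x) (s0s : s0 <= s).

Lemma strong_continuous : continuous (fun q : R * R => x (cl q.1) (Num.max s q.2)).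
Proof.
move=> q.
have c1 : continuous (fun q : R * R => cl q.1).
  exact: (continuous_comp1 (@continuous_fst R) (@continuous_cl R)).
have c2 : continuous (fun q : R * R => Num.max s q.2) by ctn.
have near_dom : \forall p \near q, [set zt : R * R | I01 zt.1 /\ s0 <= zt.2] (cl p.1, Num.max s p.2).
  near=> p; split; first by rewrite /I01 /= in_itv/=; exact: cl_itv.
  by rewrite /= le_max s0s.
exact: (within_continuous_retract (sr_cont hx) (pair_continuous_at (c1 q) (c2 q)) near_dom).
Unshelve. all: by end_near. Qed.

Lemma strong_is_derive_t (z t : R) : s < t -> is_derive t (1:R) (x (cl z)) (dt x (cl z) t).
Proof.
move=> st; rewrite /dt derive1E; apply: DeriveDef => //.
apply: (sr_derivable_t hx); last exact: le_lt_trans st.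
by rewrite /I01 /= in_itv/=; exact: cl_itv.
Qed.

Lemma strong_dt_continuous (z t : R) : s < t ->
  {for (z, t), continuous (fun q : R * R => dt x (cl q.1) q.2)}.
Proof.
move=> st.
have c1 : continuous (fun q : R * R => cl q.1).
  exact: (continuous_comp1 (@continuous_fst R) (@continuous_cl R)).
have c2 := @continuous_snd R.
have near_dom : \forall p \near (z, t), [set zt : R * R | I01 zt.1 /\ s0 < zt.2] (cl p.1, p.2).
  near=> p; split; first by rewrite /I01 /= in_itv/=; exact: cl_itv.
  rewrite /=; near: p; have := c2 (z, t).
  by move=> /(_ _ (near_gt (le_lt_trans s0s st))).
exact: (within_continuous_retract (sr_dt_cont hx) (pair_continuous_at (c1 (z, t)) (c2 (z, t))) near_dom).
Unshelve. all: by end_near. Qed.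

Lemma C1_in_continuous (f : R -> R) : C1_in (@I01 R) f ->
  [/\ continuous (fun z => f (cl z)), continuous (fun z => derive_in (@I01 R) f (cl z)) &
    forall z : R, 0 < z < 1 -> is_derive z (1:R) (fun z => f (cl z)) (derive_in (@I01 R) f (cl z))].
Proof.
move=> [df cdf].
have ncl (z : R) : \forall y \near z, (@I01 R) (cl y).
  by near=> y; rewrite /I01 /= in_itv/=; exact: cl_itv.
have cf : {within @I01 R, continuous f}.
  apply/subspace_continuousP => z Iz.
  have [l /cvgrPdist_le Hl] := df z Iz.
  apply/cvgrPdist_le => e e0.
  (* Difference quotients within 1 of [l] give |f y - f z| <= (|l| + 1) |y - z|, hence continuity at
     z, one-sided at the end points. *)
  have [d /= d0 Hd] := Hl 1 ltr01.
  have m0 : 0 < Num.min d (e / (`|l| + 1)) by rewrite lt_min d0 divr_gt0// ltr_wpDl.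
  exists (Num.min d (e / (`|l| + 1))) => // y /=; rewrite lt_min => /andP[yd ye] Iy.
  have [->|yz] := eqVneq y z; first by rewrite subrr normr0 ltW.
  have := Hd y yd yz Iy => H.
  have yz0 : y - z != 0 by rewrite subr_eq0.
  have -> : f z - f y = (l - (f y - f z) / (y - z) - l) * (y - z) by field.
  rewrite normrM [`|y - z|]distrC.
  have : `|l - (f y - f z) / (y - z) - l| <= `|l| + 1.
    by rewrite (le_trans (ler_normB _ _))// addrC lerD.
  move: ye; rewrite ltr_pdivlMr ?ltr_wpDl// => ye H2.
  apply: le_trans (ltW ye); rewrite mulrC ler_wpM2l//.
split.
- by move=> z; exact: (within_continuous_retract cf (@continuous_cl R z) (ncl z)).
- by move=> z; exact: (within_continuous_retract cdf (@continuous_cl R z) (ncl z)).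
- move=> z z01; have /andP[z0 z1] := z01.
  rewrite cl_id ?(ltW z0) ?(ltW z1)//.
  have D : is_derive z (1:R) f (derive_in (@I01 R) f z).
    apply: (derivable_in_interior z01).
      by move=> y /andP[y0 y1]; rewrite /I01 /= in_itv/= !ltW.
    by apply: df; rewrite /I01 /= in_itv/= !ltW.
  apply: near_eq_is_derive D; near=> y; rewrite cl_id//.
  by rewrite !ltW//; near: y; first [exact: near_lt|exact: near_gt].
Unshelve. all: by end_near. Qed.

(** The second derivative is read off the equation as (x_t - F) / lam, so its regularity comes from
    that of x_t and of the data. [Ft] is an extension of the right-hand side to the line. *)
Lemma strong_pwC2 (lam t : R) (F : R -> R -> R) (Ft : R -> R) : 0 < lam -> s < t ->
  parabolic_pde lam s0 F x -> pwc Ft -> (forall z, 0 < z < 1 -> Ft z = F z t) ->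
  pwC2 (fun z => x (cl z) t) (fun z => dz x (cl z) t) (fun z => (dt x (cl z) t - Ft z) / lam).
Proof.
move=> lam0 st pde pF EF.
have s0t : s0 < t by exact: le_lt_trans st.
have [cf cf1 df] := C1_in_continuous (sr_C1 hx s0t).
have cdt : continuous (fun z => dt x (cl z) t).
  move=> z; apply: (@continuous_comp _ _ _ (fun z : R => (z, t)) (fun q : R * R => dt x (cl q.1) q.2)).
    by apply: pair_continuous_at; [exact: cvg_id|exact: cvg_cst].
  exact: strong_dt_continuous.
have [l2 [D HD]] : pwc (fun z => (dt x (cl z) t - Ft z) / lam).
  by apply: pwcZr; apply: pwcB => //; exact: pwc_continuous.
split => //.
have [D' HD'] := pde t s0t.
exists (D ++ D') => z z01; rewrite mem_cat negb_or => /andP[zD zD'].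
split; last exact: HD.
have /andP[z0 z1] := z01.
have [dd E] := HD' z z01 zD'.
have dz2 : is_derive z (1:R) (dz x ^~ t) (dz (dz x) z t).
  apply: (derivable_in_interior z01) dd.
  by move=> y /andP[y0 y1]; rewrite /I01 /= in_itv/= !ltW.
rewrite cl_id ?(ltW z0) ?(ltW z1)// EF// E addrK mulrAC divff ?gt_eqF// mul1r.
apply: near_eq_is_derive dz2; near=> y; rewrite cl_id//.
by rewrite !ltW//; near: y; first [exact: near_lt|exact: near_gt].
Unshelve. all: by end_near. Qed.

End StrongSolutions.

Section Dot.
Variable R : realType.

Lemma dotE n (r : 'rV[R]_n) (c : 'cV[R]_n) : dot r c = \sum_j r 0 j * c j 0.
Proof. by rewrite /dot mxE. Qed.

Lemma dotD n (r r' : 'rV[R]_n) (c : 'cV[R]_n) : dot (r + r') c = dot r c + dot r' c.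
Proof. by rewrite /dot mulmxDl mxE. Qed.

Lemma dotN n (r : 'rV[R]_n) (c : 'cV[R]_n) : dot (- r) c = - dot r c.
Proof. by rewrite /dot mulNmx mxE. Qed.

Lemma dotZ n (l : R) (r : 'rV[R]_n) (c : 'cV[R]_n) : dot (l *: r) c = l * dot r c.
Proof. by rewrite /dot -scalemxAl mxE. Qed.

Lemma dot_mul n p (r : 'rV[R]_n) (M : 'M[R]_(n, p)) (c : 'cV[R]_p) :
  dot (r *m M) c = dot r (M *m c).
Proof. by rewrite /dot mulmxA. Qed.

End Dot.

(** * The closed loop *)

Section ClosedLoop.
Variables (R : realType) (nw : nat) (alpha t0 mu s : R).
Variables (S : 'M[R]_nw) (p : 'cV[R]_nw) (A : agent R) (k : R -> R -> R -> R).
Variables (ppi : R -> 'rV[R]_nw) (phi : R -> R -> 'rV[R]_(nv A)).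
Variables (w : R -> 'cV[R]_nw) (v : R -> 'cV[R]_(nv A)) (x : R -> R -> R).
Hypothesis hA : admissible alpha t0 A.
Hypothesis hk : kernel_solution alpha t0 A mu k.
Hypothesis hppi : reference_regulator S p A mu ppi.
Hypothesis hphi : disturbance_regulator t0 k mu phi.
Hypothesis t0s : t0 <= s.
Hypothesis hcl : closed_loop S k ppi phi s w v x.
Local Notation cont2 m := (continuous (fun q : R * R => m q.1 q.2)).
Local Notation kap := (kap k).
Local Notation kap_t := (kap_t k).

Let lam0 : 0 < lam A := lam_gt0 hA.
Let lamN0 : lam A != 0. Proof. by rewrite gt_eqF. Qed.

Definition transformed_state (z t : R) :=
  x (cl z) t - J 0 (cl z) (fun y => kap z y t * x (cl y) t).

Definition eps (z t : R) := transformed_state z t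
  - dot (ppi (cl z)) (w t) - dot (phi (cl z) t) (v t).

Definition dt_phi (z t : R) : 'rV[R]_(nv A) := \row_j dt (fun z t => phi z t 0 j) z t.

Definition eps_t (z t : R) :=
  dt x (cl z) t - J 0 (cl z) (fun y => kap_t z y t * x (cl y) t + kap z y t * dt x (cl y) t)
  - dot (ppi (cl z)) (S *m w t)
  - (dot (dt_phi (cl z) t) (v t) + dot (phi (cl z) t) (Sv A *m v t)).

Let hx : strong_regularity s x := as_reg (cl_x hcl).

Let w_derive j (t : R) : s < t -> is_derive t (1:R) (fun r => w r j 0) ((S *m w t) j 0).
Proof. by move=> st; have [H _] := cl_w hcl j; exact: H. Qed.

Let v_derive j (t : R) : s < t -> is_derive t (1:R) (fun r => v r j 0) ((Sv A *m v t) j 0).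
Proof. by move=> st; have [H _] := cl_v hcl j; exact: H. Qed.

Let w_cont j : continuous (fun t => w (Num.max s t) j 0).
Proof.
have [H H'] := cl_w hcl j.
exact: (@continuous_max_right R (fun r => w r j 0) (fun t => (S *m w t) j 0) s H H').
Qed.

Let v_cont j : continuous (fun t => v (Num.max s t) j 0).
Proof.
have [H H'] := cl_v hcl j.
exact: (@continuous_max_right R (fun r => v r j 0) (fun t => (Sv A *m v t) j 0) s H H').
Qed.

Let ppi_cont j : continuous (fun z => ppi (cl z) 0 j).
Proof. by have [H _ _] := C1_in_continuous (rr_reg hppi j). Qed.

Let c1 : continuous (fun q : R * R => cl q.1).
Proof. exact: (continuous_comp1 (@continuous_fst R) (@continuous_cl R)). Qed.

Let kap_cont : continuous (fun q : (R * R) * R => kap q.1.1 q.1.2 (Num.max q.2 t0)).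
Proof. by have [M [_ _ H _ _]] := kap_facts hk. Qed.

Lemma transformed_state_continuous :
  continuous (fun q : R * R => transformed_state q.1 (Num.max s q.2)).
Proof.
have cx := strong_continuous hx (lexx s).
apply: continuous_sub; first exact: cx.
apply: (continuous_J (m := fun q y => kap q.1 y (Num.max s q.2) * x (cl y) (Num.max s q.2))).
  exact: c1.
have cq11 : continuous (fun q : (R * R) * R => q.1.1).
  by move=> q; apply: (@continuous_comp _ _ _ (fun q : (R * R) * R => q.1) (fun q : R * R => q.1)); [exact: cvg_fst|exact: cvg_fst].
have cq12 : continuous (fun q : (R * R) * R => q.1.2).
  by move=> q; apply: (@continuous_comp _ _ _ (fun q : (R * R) * R => q.1) (fun q : R * R => q.2)); [exact: cvg_fst|exact: cvg_snd].
have cq2 : continuous (fun q : (R * R) * R => q.2) by move=> q; exact: cvg_snd.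
apply: continuous_mul; last first.
  exact: (continuous_comp2 (f := fun q : (R * R) * R => q.2) (g := fun q : (R * R) * R => q.1.2)
    (m := fun z t => x (cl z) (Num.max s t))).
move=> q.
have -> : (fun q : R * R * R => kap q.1.1 q.2 (Num.max s q.1.2)) =
   (fun q : (R * R) * R => kap q.1.1 q.1.2 (Num.max q.2 t0)) \o
   (fun q : (R * R) * R => ((q.1.1, q.2), Num.max s q.1.2)).
  by apply/funext => r /=; rewrite (max_l (_ : t0 <= _))// le_max t0s.
apply: continuous_comp; last exact: kap_cont.
apply: pair_continuous_at; first by apply: pair_continuous_at; [exact: cq11|exact: cq2].
by apply: continuous_max => //; exact: continuous_const.
Qed.

Lemma eps_continuous : continuous (fun q : R * R => eps q.1 (Num.max s q.2)).
Proof.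
apply: continuous_sub; first apply: continuous_sub; first exact: transformed_state_continuous.
- move=> q; under eq_fun do rewrite dotE.
  apply: continuous_at_sum => j; apply: cvgM.
    exact: (continuous_comp1 (@continuous_fst R) (@ppi_cont j)).
  exact: (continuous_comp1 (@continuous_snd R) (@w_cont j)).
- move=> q; under eq_fun do rewrite dotE.
  apply: continuous_at_sum => j; apply: cvgM.
    exact: (strong_continuous (dr_reg hphi j) t0s).
  exact: (continuous_comp1 (@continuous_snd R) (@v_cont j)).
Qed.

Lemma eps_is_derive (z t : R) : s < t -> is_derive t (1:R) (eps z) (eps_t z t).
Proof.
move=> st; have tt : t0 < t := le_lt_trans t0s st.
have [M [_ _ _ dkap ckt]] := kap_facts hk.
have /andP[z0 z1] := cl_itv z.
have dJ : is_derive t (1:R) (fun t => J 0 (cl z) (fun y => kap z y t * x (cl y) t))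
   (J 0 (cl z) (fun y => kap_t z y t * x (cl y) t + kap z y t * dt x (cl y) t)).
  have cxt r : s <= r -> continuous (fun y => x (cl y) r).
    move=> sr; have := continuous_section2 (m := fun z t => x (cl z) (Num.max s t)) (y := r) (strong_continuous hx (lexx s)).
    by rewrite (max_r sr).
  have cdxt r : s < r -> continuous (fun y => dt x (cl y) r).
    move=> sr y; apply: (@continuous_comp _ _ _ (fun z : R => (z, r)) (fun q : R * R => dt x (cl q.1) q.2)).
      by apply: pair_continuous_at; [exact: cvg_id|exact: cvg_cst].
    exact: (strong_dt_continuous hx (lexx s)).
  have ck r : s <= r -> continuous (fun y => kap z y r).
    move=> sr; apply: (continuous_section (m := fun z y => kap z y r)).
    exact: (kap_continuous2 hk (le_trans t0s sr)).
  have ckt2 : continuous (fun y => kap_t z y t).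
    apply: (continuous_section (m := fun z y => kap_t z y t)).
    exact: (kap_t_continuous2 hk tt).
  apply: (@is_derive_under_J R (fun t y => kap z y t * x (cl y) t)
     (fun t y => kap_t z y t * x (cl y) t + kap z y t * dt x (cl y) t)) => //.
  - near=> r; have sr : s < r by near: r; exact: near_gt.
    split.
      by apply: lbm_continuous; apply: continuous_mul; [apply: ck; exact: ltW|apply: cxt; exact: ltW].
    move=> y _; have D1 := dkap z y r (le_lt_trans t0s sr).
    have D2 := strong_is_derive_t hx (lexx s) y sr.
    apply: is_derive_eq (is_deriveM D1 D2) _.
    by rewrite addrC; congr (_ + _); exact: mulrC.
  - move=> y _.
    have k1 : {for (t, y), continuous (fun q : R * R => kap_t z q.2 q.1)}.
      apply: (@continuous_comp _ _ _ (fun q : R * R => ((z, q.2), q.1)) (fun q : (R * R) * R => kap_t q.1.1 q.1.2 q.2)).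
        apply: pair_continuous_at; last exact: continuous_fst.
        by apply: pair_continuous_at; [exact: cvg_cst|exact: continuous_snd].
      exact: ckt.
    have ntt : \forall q \near (t, y), s < q.1.
      by have := @continuous_fst R (t, y); move=> /(_ _ (near_gt st)).
    have k2 : {for (t, y), continuous (fun q : R * R => kap z q.2 q.1)}.
      apply: (@near_eq_continuous_at _ _ _ (fun q : R * R => kap z q.2 (Num.max q.1 t0))).
        near=> q; rewrite max_l// (le_trans t0s)// ltW//.
        by near: q.
      apply: (@continuous_comp _ _ _ (fun q : R * R => ((z, q.2), q.1)) (fun q : (R * R) * R => kap q.1.1 q.1.2 (Num.max q.2 t0))).
        apply: pair_continuous_at; last exact: continuous_fst.
        by apply: pair_continuous_at; [exact: cvg_cst|exact: continuous_snd].
      exact: kap_cont.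
    have k3 : {for (t, y), continuous (fun q : R * R => x (cl q.2) q.1)}.
      apply: (@near_eq_continuous_at _ _ _ (fun q : R * R => x (cl q.2) (Num.max s q.1))).
        by near=> q; rewrite max_r// ltW//; near: q.
      apply: (continuous_comp2 (f := fun q : R * R => q.2) (g := fun q : R * R => q.1)
        (m := fun z t => x (cl z) (Num.max s t))); [exact: continuous_snd|exact: continuous_fst|].
      exact: (strong_continuous hx (lexx s)).
    have k4 : {for (t, y), continuous (fun q : R * R => dt x (cl q.2) q.1)}.
      apply: (continuous_at_comp2 (f := fun q : R * R => q.2) (g := fun q : R * R => q.1)
        (m := fun z t => dt x (cl z) t)); [exact: continuous_snd|exact: continuous_fst|].
      exact: (strong_dt_continuous hx (lexx s)).
    by apply: cvgD; apply: cvgM.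
  - apply: lbm_continuous; apply: continuous_add; apply: continuous_mul => //.
    + by apply: cxt; exact: ltW.
    + by apply: ck; exact: ltW.
    + exact: cdxt.
have dX := strong_is_derive_t hx (lexx s) z st.
have dP : is_derive t (1:R) (fun t => dot (ppi (cl z)) (w t)) (dot (ppi (cl z)) (S *m w t)).
  under eq_fun do rewrite dotE; rewrite dotE.
  apply: is_derive_bigsum => j.
  have D1 : is_derive t (1:R) (fun=> ppi (cl z) 0 j) 0 by exact: is_derive_cst.
  by apply: is_derive_eq (is_deriveM D1 (w_derive j st)) _; rewrite /GRing.scale/= mulr0 addr0.
have dQ : is_derive t (1:R) (fun t => dot (phi (cl z) t) (v t))
   (dot (dt_phi (cl z) t) (v t) + dot (phi (cl z) t) (Sv A *m v t)).
  under eq_fun do rewrite dotE; rewrite !dotE -big_split /=.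
  apply: is_derive_bigsum => j.
  have D1 := strong_is_derive_t (dr_reg hphi j) t0s z st.
  apply: is_derive_eq (is_deriveM D1 (v_derive j st)) _.
  have -> : dt_phi (cl z) t 0 j = dt (fun z t => phi z t 0 j) (cl z) t by rewrite mxE.
  by rewrite addrC; congr (_ + _); exact: mulrC.
exact: is_deriveB (is_deriveB (is_deriveB dX dJ) dP) dQ.
Unshelve. all: by end_near. Qed.

Lemma eps_t_continuous (z t : R) : s < t ->
  {for (z, t), continuous (fun q : R * R => eps_t q.1 q.2)}.
Proof.
move=> st; have tt : t0 < t := le_lt_trans t0s st.
have [M [_ _ _ dkap ckt]] := kap_facts hk.
have cxt r : s <= r -> continuous (fun y => x (cl y) r).
  move=> sr; have := continuous_section2 (m := fun z t => x (cl z) (Num.max s t)) (y := r) (strong_continuous hx (lexx s)).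
  by rewrite (max_r sr).
have cdxt r : s < r -> continuous (fun y => dt x (cl y) r).
  move=> sr y; apply: (@continuous_comp _ _ _ (fun z : R => (z, r)) (fun q : R * R => dt x (cl q.1) q.2)).
    by apply: pair_continuous_at; [exact: cvg_id|exact: cvg_cst].
  exact: (strong_dt_continuous hx (lexx s)).
have nst : \forall q \near (z, t), s < q.2.
  by have := @continuous_snd R (z, t); move=> /(_ _ (near_gt st)).
have cwv n (S' : 'M[R]_n) (u : R -> 'cV[R]_n) :
    (forall j (r : R), s < r -> is_derive r (1:R) (fun r => u r j 0) ((S' *m u r) j 0)) ->
    forall j, {for (z, t), continuous (fun q : R * R => u q.2 j 0)}.
  move=> du j; apply: (@continuous_comp _ _ _ (fun q : R * R => q.2) (fun r => u r j 0)).
    exact: continuous_snd.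
  have [dd _] := du j t st.
  by apply: differentiable_continuous; exact/derivable1_diffP.
have cSwv n (S' : 'M[R]_n) (u : R -> 'cV[R]_n) :
    (forall j, {for (z, t), continuous (fun q : R * R => u q.2 j 0)}) ->
    forall j, {for (z, t), continuous (fun q : R * R => (S' *m u q.2) j 0)}.
  move=> cu j; have -> : (fun q : R * R => (S' *m u q.2) j 0) = fun q => \sum_l S' j l * u q.2 l 0.
    by apply/funext => q; rewrite mxE.
  by apply: continuous_at_sum => l; apply: cvgM; [exact: cvg_cst|exact: cu].
have cdot n (r : R * R -> 'rV[R]_n) (c : R * R -> 'cV[R]_n) :
    (forall j, {for (z, t), continuous (fun q => r q 0 j)}) ->
    (forall j, {for (z, t), continuous (fun q => c q j 0)}) ->
    {for (z, t), continuous (fun q => dot (r q) (c q))}.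
  move=> cr cc; have -> : (fun q => dot (r q) (c q)) = fun q => \sum_j r q 0 j * c q j 0.
    by apply/funext => q; rewrite dotE.
  by apply: continuous_at_sum => j; apply: cvgM; [exact: cr|exact: cc].
have cw := cwv _ _ _ w_derive; have cv := cwv _ _ _ v_derive.
have cphi j : {for (z, t), continuous (fun q : R * R => phi (cl q.1) q.2 0 j)}.
  apply: (@near_eq_continuous_at _ _ _ (fun q : R * R => phi (cl q.1) (Num.max s q.2) 0 j)).
    by near=> q; rewrite max_r// ltW//; near: q.
  exact: (strong_continuous (dr_reg hphi j) t0s).
apply: cvgB; [apply: cvgB; [apply: cvgB|]|apply: cvgD].
- exact: (strong_dt_continuous hx (lexx s)).
- apply: (J_continuous_param (m := fun q y => kap_t q.1 y q.2 * x (cl y) q.2 + kap q.1 y q.2 * dt x (cl y) q.2)).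
  + exact: c1.
  + move=> y.
    have cq1 : {for ((z, t), y), continuous (fun q : (R * R) * R => q.1)} by exact: cvg_fst.
    have cq11 : {for ((z, t), y), continuous (fun q : (R * R) * R => q.1.1)}.
      by apply: (@continuous_comp _ _ _ (fun q : (R * R) * R => q.1) (fun q : R * R => q.1)); [exact: cvg_fst|exact: cvg_fst].
    have cq12 : {for ((z, t), y), continuous (fun q : (R * R) * R => q.1.2)}.
      by apply: (@continuous_comp _ _ _ (fun q : (R * R) * R => q.1) (fun q : R * R => q.2)); [exact: cvg_fst|exact: cvg_snd].
    have cq2 : {for ((z, t), y), continuous (fun q : (R * R) * R => q.2)} by exact: cvg_snd.
    have ns : \forall q \near ((z, t), y), s < q.1.2 by have := cq1 _ nst.
    have k1 : {for ((z, t), y), continuous (fun q : (R * R) * R => kap_t q.1.1 q.2 q.1.2)}.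
      apply: (@continuous_comp _ _ _ (fun q : (R * R) * R => ((q.1.1, q.2), q.1.2)) (fun q : (R * R) * R => kap_t q.1.1 q.1.2 q.2)).
        by apply: pair_continuous_at; [exact: (pair_continuous_at cq11 cq2)|exact: cq12].
      exact: ckt.
    have k2 : {for ((z, t), y), continuous (fun q : (R * R) * R => kap q.1.1 q.2 q.1.2)}.
      apply: (@near_eq_continuous_at _ _ _ (fun q : (R * R) * R => kap q.1.1 q.2 (Num.max q.1.2 t0))).
        near=> q; rewrite max_l// (le_trans t0s)// ltW//.
        by near: q.
      apply: (@continuous_comp _ _ _ (fun q : (R * R) * R => ((q.1.1, q.2), q.1.2)) (fun q : (R * R) * R => kap q.1.1 q.1.2 (Num.max q.2 t0))).
        by apply: pair_continuous_at; [exact: (pair_continuous_at cq11 cq2)|exact: cq12].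
      exact: kap_cont.
    have k3 : {for ((z, t), y), continuous (fun q : (R * R) * R => x (cl q.2) q.1.2)}.
      apply: (@near_eq_continuous_at _ _ _ (fun q : (R * R) * R => x (cl q.2) (Num.max s q.1.2))).
        by near=> q; rewrite max_r// ltW//; near: q.
      apply: (continuous_at_comp2 (f := fun q : (R * R) * R => q.2) (g := fun q : (R * R) * R => q.1.2)
        (m := fun z t => x (cl z) (Num.max s t))) => //.
      exact: (strong_continuous hx (lexx s)).
    have k4 : {for ((z, t), y), continuous (fun q : (R * R) * R => dt x (cl q.2) q.1.2)}.
      apply: (continuous_at_comp2 (f := fun q : (R * R) * R => q.2) (g := fun q : (R * R) * R => q.1.2)
        (m := fun z t => dt x (cl z) t)) => //.
      exact: (strong_dt_continuous hx (lexx s)).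
    by apply: cvgD; apply: cvgM.
  + near=> q; have sq : s < q.2 by near: q.
    have tq : t0 < q.2 := le_lt_trans t0s sq.
    apply: lbm_continuous; apply: continuous_add; apply: continuous_mul.
    * apply: (continuous_section (m := fun z y => kap_t z y q.2)); exact: (kap_t_continuous2 hk tq).
    * by apply: cxt; exact: ltW.
    * apply: (continuous_section (m := fun z y => kap z y q.2)); exact: (kap_continuous2 hk (ltW tq)).
    * exact: cdxt.
- apply: (cdot _ (fun q => ppi (cl q.1)) (fun q => S *m w q.2)); last exact: cSwv.
  by move=> j; exact: (continuous_comp1 (@continuous_fst R) (@ppi_cont j)).
- apply: (cdot _ (fun q => dt_phi (cl q.1) q.2) (fun q => v q.2)) => // j.
  have -> : (fun q : R * R => dt_phi (cl q.1) q.2 0 j) = fun q => dt (fun z t => phi z t 0 j) (cl q.1) q.2.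
    by apply/funext => q; rewrite mxE.
  exact: (strong_dt_continuous (dr_reg hphi j) t0s).
- by apply: (cdot _ (fun q => phi (cl q.1) q.2) (fun q => Sv A *m v q.2)) => //; exact: cSwv.
Unshelve. all: by end_near. Qed.

(* The witness is eps_z. *)
Lemma eps_heat (t : R) : s < t -> exists e1 : R -> R,
  [/\ continuous e1, e1 1 = 0,
      forall z : R, 0 <= z <= 1 -> J 0 z e1 = eps z t - eps 0 t &
      forall z : R, 0 <= z <= 1 -> lam A * e1 z = J 0 z (fun y => eps_t y t + mu * eps y t)].
Proof.
move=> st; have tt : t0 < t := le_lt_trans t0s st.
have [kz [ky [[ckz cky] dkz dky dK [Ekz Eky]]]] := kap_partials hA hk tt.
have ck := kap_continuous2 hk (ltW tt).
have cB := kap_box_continuous2 hA hk tt.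
have ca := a_continuous hA tt.
have ckt := kap_t_continuous2 hk tt.
have inI (z : R) : 0 <= z <= 1 -> (@I01 R) z by move=> z01; rewrite /I01 /= in_itv.
have oc (z : R) : 0 < z < 1 -> 0 <= z <= 1 by move=> /andP[z0 z1]; rewrite !ltW.
pose f z := x (cl z) t; pose f1 z := dz x (cl z) t.
(* Extension by zero brings the piecewise continuous data under [pwc_restrict]. *)
pose gl l := (fun z => g1 A z t l 0) \_ (@I01 R).
have Egl l z : 0 <= z <= 1 -> gl l z = g1 A z t l 0.
  by move=> z01; rewrite /gl /patch mem_set//; exact: inI.
have pgl l : pwc (gl l).
  have [[M [rho [M0 rho0 Hb]]] Hpw] := g1_reg hA l.
  have [[D HD] _ _] := Hpw t tt.
  apply: (pwc_restrict M0 _ HD) => z Iz.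
  have [H _] := Hb z Iz; have [_] := H 0%N t tt.
  by rewrite /= fact0 powR1 mulr1 expr0 divr1.
pose d := P A *m v t.
pose G z := \sum_l gl l z * d l 0.
have pG : pwc G by apply: pwc_sum => l; exact: pwcZr.
pose Fx z := a A (cl z) t * f z + G z.
have cft : continuous f.
  have := continuous_section2 (m := fun z t => x (cl z) (Num.max s t)) (y := t) (strong_continuous hx (lexx s)).
  by rewrite (max_r (ltW st)).
have pFx : pwc Fx.
  by apply: pwcD => //; apply: pwcM; exact: pwc_continuous.
have EFx z : 0 < z < 1 -> Fx z = a A z t * x z t + dot (g1 A z t)^T d.
  move=> z01; rewrite /Fx /f cl_id ?oc//; congr (_ + _).
  by rewrite dotE; apply: eq_bigr => l _; rewrite Egl ?oc// [X in _ = X * _]mxE.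
have C2x := strong_pwC2 hx (lexx s) lam0 st (as_pde (cl_x hcl)) pFx EFx.
pose xi z := (dt x (cl z) t - Fx z) / lam A.
have [cf cf1 lxi df [D HD]] := C2x.
pose gg j z := \sum_l gl l z * P A l j.
have pgg j : pwc (gg j) by apply: pwc_sum => l; exact: pwcZr.
have Egg j z : 0 <= z <= 1 -> gg j z = gt1 A z t 0 j.
  move=> z01; rewrite /gt1 mxE; apply: eq_bigr => l _.
  by rewrite Egl// mxE.
pose hh j z := kap z 0 t * lam A * gt2 A t 0 j + (gg j z - J 0 (cl z) (fun y => kap z y t * gg j y)).
pose Fp j z := - (mu * phi (cl z) t 0 j) - (phi (cl z) t *m Sv A) 0 j + hh j z.
have cphi j : continuous (fun z => phi (cl z) t 0 j).
  by have [H _ _] := C1_in_continuous (sr_C1 (dr_reg hphi j) tt).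
have phh j : pwc (hh j).
  apply: pwcD.
    by apply: pwcZr; apply: pwcZr; apply: pwc_continuous; exact: (continuous_section2 (m := fun z y => kap z y t)).
  apply: pwcB => //; apply: pwc_continuous.
  by apply: (continuous_J_weight (m := fun z y => kap z y t)) => //; case: (pgg j).
have pFp j : pwc (Fp j).
  apply: pwcD => //; apply: pwcB.
    have -> : (fun z => - (mu * phi (cl z) t 0 j)) = fun z => (- mu) * phi (cl z) t 0 j.
      by apply/funext => z; rewrite mulNr.
    by apply: pwcZ; exact: pwc_continuous.
  have -> : (fun z => (phi (cl z) t *m Sv A) 0 j) = fun z => \sum_l phi (cl z) t 0 l * Sv A l j.
    by apply/funext => z; rewrite mxE.
  by apply: pwc_sum => l; apply: pwcZr; exact: pwc_continuous.
have EFp j z : 0 < z < 1 ->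
    Fp j z = (- (mu *: phi z t) - phi z t *m Sv A + h1 k A z t) 0 j.
  move=> z01; have /andP[z0 z1] := oc _ z01.
  rewrite /Fp /hh !(mxE, cl_id (oc _ z01)) kap_id ?lexx//.
  congr (_ + _); congr (_ + _); rewrite /Tc Egg ?oc//; congr (_ - _).
  apply: J_ext => y /andP[y0 yz]; rewrite kap_id ?y0// Egg// y0; exact: le_trans z1.
have C2p := pwC2_sum (index_enum 'I_(nv A)) (fun j => v t j 0)
  (fun j => strong_pwC2 (dr_reg hphi j) t0s lam0 st (dr_pde hphi j) (pFp j) (EFp j)).
have C2pi : pwC2 (fun z => \sum_j ppi (cl z) 0 j * w t j 0) (fun z => \sum_j dz_row ppi (cl z) 0 j * w t j 0)
    (fun z => \sum_j ((mu * ppi (cl z) 0 j + (ppi (cl z) *m S) 0 j) / lam A) * w t j 0).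
  apply: (pwC2_sum (index_enum 'I_nw) (fun j => w t j 0)) => j.
  have [a1 a2 a3] := C1_in_continuous (rr_reg hppi j).
  have dzE : (fun z => dz_row ppi (cl z) 0 j) = fun z => derive_in (@I01 R) (fun z => ppi z 0 j) (cl z).
    by apply/funext => z; rewrite mxE.
  have [l2 [D' HD']] : pwc (fun z => (mu * ppi (cl z) 0 j + (ppi (cl z) *m S) 0 j) / lam A).
    apply: pwcZr; apply: pwcD; first by apply: pwcZ; exact: pwc_continuous.
    have -> : (fun z => (ppi (cl z) *m S) 0 j) = fun z => \sum_l ppi (cl z) 0 l * S l j.
      by apply/funext => z; rewrite mxE.
    by apply: pwc_sum => l; apply: pwcZr; exact: pwc_continuous.
  split => //.
  - by rewrite dzE.
  - by move=> z z01; rewrite mxE; exact: a3.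
  - exists D' => z z01 zD; split; last exact: HD'.
    have dd := rr_reg2 hppi j z01.
    have D2 : is_derive z (1:R) (fun y => dz_row ppi y 0 j) (derive_in (@I01 R) (fun y => dz_row ppi y 0 j) z).
      apply: (derivable_in_interior z01) dd.
      by move=> y /oc; exact: inI.
    have E : (mu * ppi (cl z) 0 j + (ppi (cl z) *m S) 0 j) / lam A =
        derive_in (@I01 R) (fun y => dz_row ppi y 0 j) z.
      have rowE (l m0 : R) (r1 r2 r3 : 'rV[R]_nw) :
          (l *: r1 - m0 *: r2 - r3) 0 j = l * r1 0 j - m0 * r2 0 j - r3 0 j by rewrite !mxE.
      have ddE : dz_row (dz_row ppi) z 0 j = derive_in (@I01 R) (fun y => dz_row ppi y 0 j) z.
        by rewrite mxE.
      have := congr1 (fun M : 'rV[R]_nw => M 0 j) (rr_ode hppi z01).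
      rewrite rowE ddE [X in _ = X]mxE cl_id ?oc// => H0.
      by apply: (mulfI lamN0); rewrite mulrCA divff// mulr1; lra.
    rewrite E; apply: near_eq_is_derive D2; near=> y; rewrite cl_id// oc//.
    by apply/andP; split; near: y; [apply: near_gt|apply: near_lt]; case/andP: z01.
pose Pi0 z := \sum_j ppi (cl z) 0 j * w t j 0.
pose Pi1 z := \sum_j dz_row ppi (cl z) 0 j * w t j 0.
pose Pi2 z := \sum_j ((mu * ppi (cl z) 0 j + (ppi (cl z) *m S) 0 j) / lam A) * w t j 0.
pose Ph0 z := \sum_j phi (cl z) t 0 j * v t j 0.
pose Ph1 z := \sum_j dz (fun z t => phi z t 0 j) (cl z) t * v t j 0.
pose Ph2 z := \sum_j ((dt (fun z t => phi z t 0 j) (cl z) t - Fp j z) / lam A) * v t j 0.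
have epsE z : 0 <= z <= 1 -> eps z t = f z - J 0 z (fun y => kap z y t * f y) - Pi0 z - Ph0 z.
  by move=> z01; rewrite /eps /transformed_state !dotE [X in J 0 X]cl_id.
pose e1 z := transf_z (fun z y => kap z y t) kz f f1 z - Pi1 z - Ph1 z.
have ctr := @continuous_transf_z R (fun z y => kap z y t) kz ck ckz f f1 cf cf1.
have [cPi0 cPi1 lPi2 _ _] := C2pi; have [cPh0 cPh1 lPh2 _ _] := C2p.
(* k(0, 0) = q cancels the Robin term, phi_z(0) v cancels the disturbance g2 d, and pi_z(0)
   vanishes. *)
have e10 : e1 0 = 0.
  rewrite /e1 /transf_z J_gt// subr0 (kap00 hk tt) /f1 /f /Pi1 /Ph1 cl_id ?lexx ?ler01//.
  rewrite (as_bc0 (cl_x hcl) st) -!dotE (rr_bc0 hppi).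
  have -> : \sum_j dz (fun z t => phi z t 0 j) 0 t * v t j 0 = dot (dz_row (phi ^~ t) 0) (v t).
    by rewrite dotE; apply: eq_bigr => j _; rewrite mxE.
  rewrite (dr_bc0 hphi tt) /gt2 dot_mul {2}/dot mul0mx mxE; ring.
exists e1; split.
- by apply: continuous_sub => //; apply: continuous_sub.
(* At z = 1 every gain removes one term: [k_1] the values of x(1, t), [k_x] the integral against
   k_z(1, y), [k_w] the contribution of pi_z(1), and [k_v] both g3 d and phi_z(1) v. *)
- rewrite /e1 /transf_z /f1 /f /Pi1 /Ph1 !(cl_id (_ : 0 <= 1 <= 1)) ?ler01 ?lexx//.
  rewrite (as_bc1 (cl_x hcl) st) -dotE -!(dot_mul (g3 A t)^T) -/(gt3 A t).
  have -> : \sum_j dz (fun z t => phi z t 0 j) 1 t * v t j 0 = dot (dz_row (phi ^~ t) 1) (v t).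
    by rewrite dotE; apply: eq_bigr => j _; rewrite mxE.
  have -> : J 0 1 (fun y => kz 1 y * x (cl y) t) =
      - \int[@lebesgue_measure R]_(y in `[0, 1]) (k_x k y t * x y t).
    have ckx : continuous (fun y => kz 1 y * x (cl y) t).
      by apply: continuous_mul => //; exact: continuous_section.
    have EJ : J 0 1 (fun y => k_x k y t * x y t) = J 0 1 (fun y => - (kz 1 y * x (cl y) t)).
      apply: J_ext_co; first by apply: lbmN; exact: lbm_continuous.
      move=> y /andP[y0 y1]; rewrite /k_x Ekz ?y0// cl_id ?y0 ?(ltW y1)// mulNr//.
    by rewrite -/(J 0 1 (fun y => k_x k y t * x y t)) EJ JN ?opprK//; exact: lbm_continuous.
  rewrite /regulator mulrA divff ?b_neq0// ?mul1r; last exact: (b_neq0 hA).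
  rewrite /k_w /k_v /k_1 !dotD !dotN -(kap_id k (z := 1) (y := 1)) ?ler01 ?lexx//.
  ring.
- move=> z z01; have [E1 _] := J_pwC2 C2pi z01; have [E2 _] := J_pwC2 C2p z01.
  rewrite JB; [|apply: lbm_continuous; exact: continuous_sub|exact: lbm_continuous].
  rewrite JB; [|exact: lbm_continuous..].
  rewrite E1 E2 (J_transf_z ck ckz dkz cf cf1 df z01).
  rewrite (epsE z z01) (epsE 0) ?lexx ?ler01// [J 0 0 _]J_gt// /Pi0 /Ph0 /f; ring.
have [X [lX EX JX]] := J_transf_zz ck ckz cky cB dkz dky dK cf cf1 lxi df HD.
move=> z z01; have [_ E1] := J_pwC2 C2pi z01; have [_ E2] := J_pwC2 C2p z01.
have -> : lam A * e1 z = J 0 z (fun y => lam A * (X y - Pi2 y - Ph2 y)).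
  rewrite JZ; last by apply: lbmB => //; exact: lbmB.
  rewrite JB //; last exact: lbmB.
  rewrite JB // JX// E1 E2; congr (_ * _).
  transitivity (e1 z - e1 0); first by rewrite e10 subr0.
  by rewrite /e1 /Pi1 /Ph1 /f /f1; ring.
have ceps : continuous (fun y => eps y t).
  have := continuous_section2 (m := fun z t => eps z (Num.max s t)) (y := t) eps_continuous.
  by rewrite (max_r (ltW st)).
have cepst : continuous (fun y => eps_t y t).
  move=> y; apply: (@continuous_comp _ _ _ (fun z : R => (z, t)) (fun q : R * R => eps_t q.1 q.2)).
    by apply: pair_continuous_at; [exact: cvg_id|exact: cvg_cst].
  exact: eps_t_continuous.
(* The comparison is made on the open interval, since the diagonal derivative and the trace of [ky]
   at y = 0 are known for 0 < y < 1 only. *)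
apply: (@J_ext_fin R 0 z [::]).
- by apply: lbmZ; apply: lbmB => //; exact: lbmB.
- by apply: lbmD; [exact: lbm_continuous|apply: lbmZ; exact: lbm_continuous].
move=> y /andP[y0 yz] _.
have y1 : y < 1 by case/andP: z01 => _; exact: lt_le_trans.
have y01' : 0 < y < 1 by rewrite y0.
have y01 := oc _ y01'.
have cdt : continuous (fun z => dt x (cl z) t).
  move=> u; apply: (@continuous_comp _ _ _ (fun z : R => (z, t)) (fun q : R * R => dt x (cl q.1) q.2)).
    by apply: pair_continuous_at; [exact: cvg_id|exact: cvg_cst].
  exact: (strong_dt_continuous hx (lexx s)).
have cky0 := @continuous_section R (fun z y => kap z y t) y ck.
have ckty := @continuous_section R (fun z y => kap_t z y t) y ckt.
have cBy := continuous_section (s := y) cB.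
have lG : lbm G by case: pG.
have lkf : lbm (fun u => kap y u t * f u) by apply: lbm_continuous; exact: continuous_mul.
have lkG : lbm (fun u => kap y u t * G u) by apply: lbmM => //; exact: lbm_continuous.
have lkt : lbm (fun u => kap_t y u t * f u + kap y u t * dt x (cl u) t).
  by apply: lbm_continuous; apply: continuous_add; exact: continuous_mul.
(* The kernel equation contributes (a + mu) k f and lam xi contributes - a k f; the coefficient [a]
   cancels under the integral and [mu] remains. *)
have HJ : lam A * (J 0 y (fun u => kap_box mu A k t y u * f u) + J 0 y (fun u => kap y u t * xi u)) =
   J 0 y (fun u => kap_t y u t * f u + kap y u t * dt x (cl u) t)
   + mu * J 0 y (fun u => kap y u t * f u) - J 0 y (fun u => kap y u t * G u).
  have l1 : lbm (fun u => kap_box mu A k t y u * f u) by apply: lbm_continuous; exact: continuous_mul.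
  have l2 : lbm (fun u => kap y u t * xi u) by apply: lbmM => //; exact: lbm_continuous.
  rewrite -JD// -JZ; last exact: lbmD.
  rewrite -JZ// -JD//; last exact: lbmZ.
  rewrite -JB//; last by apply: lbmD => //; exact: lbmZ.
  by apply: J_ext => u _; rewrite /kap_box /xi /Fx; field.
have HPi : lam A * Pi2 y = mu * Pi0 y + dot (ppi (cl y)) (S *m w t).
  rewrite -dot_mul dotE /Pi2 /Pi0 !mulr_sumr -big_split /=; apply: eq_bigr => j _.
  by field.
(* The last bracket is [h1] applied to v. It reproduces exactly the terms in g1 and g2 that the
   transformation leaves in [lamX]. *)
have HPh : lam A * Ph2 y = dot (dt_phi (cl y) t) (v t) + mu * Ph0 y + dot (phi (cl y) t) (Sv A *m v t)
    - (kap y 0 t * lam A * dot (g2 A t)^T d + (G y - J 0 y (fun u => kap y u t * G u))).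
  have E3 : dot (g2 A t)^T d = \sum_j gt2 A t 0 j * v t j 0 by rewrite -dot_mul dotE.
  have E4 u : G u = \sum_j gg j u * v t j 0.
    rewrite /G /gg; under [RHS]eq_bigr do rewrite mulr_suml.
    rewrite exchange_big /=; apply: eq_bigr => l _.
    rewrite /d mxE mulr_sumr; apply: eq_bigr => j _; ring.
  have E5 : J 0 y (fun u => kap y u t * G u) = \sum_j J 0 y (fun u => kap y u t * gg j u) * v t j 0.
    transitivity (J 0 y (fun u => \sum_j (v t j 0 * (kap y u t * gg j u)))).
      by apply: J_ext => u _; rewrite E4 mulr_sumr; apply: eq_bigr => j _; ring.
    have lj j : lbm (fun u => kap y u t * gg j u).
      by apply: lbmM; [exact: lbm_continuous|case: (pgg j)].
    rewrite J_sum; last by move=> j; exact: lbmZ.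
    by apply: eq_bigr => j _; rewrite (JZ 0 y (v t j 0) (lj j)); exact: mulrC.
  rewrite E3 E4 E5 -[dot (phi _ _) _]dot_mul !dotE /Ph2 /Ph0 !mulr_sumr.
  rewrite -!big_split/= -!sumrB -!big_split/= -!sumrB; apply: eq_bigr => j _.
  have -> : dt_phi (cl y) t 0 j = dt (fun z t => phi z t 0 j) (cl y) t by rewrite mxE.
  by rewrite /Fp /hh [X in J 0 X]cl_id//; field.
(* Twice this diagonal value times lam is - (a + mu), which exchanges the local term - a f for mu
   f. *)
have HK := kap_diag_derive hA hk tt ckz cky dkz dky y01'.
have f10 : f1 0 = q A t * f 0 + dot (g2 A t)^T d.
  by rewrite /f1 /f cl_id ?lexx ?ler01// (as_bc0 (cl_x hcl) st).
have lamX : lam A * X y = dt x (cl y) t + mu * f y - G y - lam A * kap y 0 t * dot (g2 A t)^T d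
    - (J 0 y (fun u => kap_t y u t * f u + kap y u t * dt x (cl u) t)
   + mu * J 0 y (fun u => kap y u t * f u) - J 0 y (fun u => kap y u t * G u)).
  (* The boundary terms combine: ky(y, 0) = q k(y, 0) and f'(0) = q f(0) + g2 d leave only - k(y, 0)
     g2 d. *)
  have EXy : X y = xi y - 2 * ((kz y y + ky y y) * f y) + ky y 0 * f 0 - kap y 0 t * f1 0
      - (J 0 y (fun u => kap_box mu A k t y u * f u) + J 0 y (fun u => kap y u t * xi u)) := EX y y01.
  rewrite -HJ EXy HK Eky// f10 /xi /Fx; field.
  exact: lamN0.
have -> : lam A * (X y - Pi2 y - Ph2 y) = lam A * X y - lam A * Pi2 y - lam A * Ph2 y by ring.
rewrite lamX HPi HPh (epsE y y01) /eps_t /f !(cl_id y01).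
ring.
Unshelve. all: by end_near. Qed.

End ClosedLoop.

(** * Decay of the transformed error, the output error and the tracking error *)

Section Decay.
Variables (R : realType) (nw : nat) (alpha t0 mu s : R).
Variables (S : 'M[R]_nw) (p : 'cV[R]_nw) (A : agent R) (k : R -> R -> R -> R).
Variables (ppi : R -> 'rV[R]_nw) (phi : R -> R -> 'rV[R]_(nv A)).
Variables (w : R -> 'cV[R]_nw) (v : R -> 'cV[R]_(nv A)) (x : R -> R -> R).
Hypothesis hA : admissible alpha t0 A.
Hypothesis hk : kernel_solution alpha t0 A mu k.
Hypothesis hppi : reference_regulator S p A mu ppi.
Hypothesis hphi : disturbance_regulator t0 k mu phi.
Hypothesis t0s : t0 <= s.
Hypothesis hcl : closed_loop S k ppi phi s w v x.
Local Notation eps := (eps k ppi phi w v x).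
Local Notation eps_t := (eps_t S k ppi phi w v x).
Local Notation kap := (kap k).

Let ceps : continuous (fun q : R * R => eps q.1 (Num.max s q.2)) :=
  eps_continuous hk hppi hphi t0s hcl.

Lemma eps_continuous_z (t : R) : s <= t -> continuous (eps^~ t).
Proof.
move=> st; have := continuous_section2 (m := fun z t => eps z (Num.max s t)) (y := t) ceps.
by rewrite (max_r st).
Qed.

Lemma eps_energy n (t : R) : s <= t ->
  J 0 1 (fun z => (expR (mu * (t - s)) * eps z t) ^+ n.*2.+2) <=
  J 0 1 (fun z => eps z s ^+ n.*2.+2).
Proof.
move=> st.
pose u z t := expR (mu * (t - s)) * eps z t.
pose ut z t := expR (mu * (t - s)) * (eps_t z t + mu * eps z t).
have cE : continuous (fun r : R => expR (mu * (r - s))).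
  apply: (continuous_comp1 (f := fun r : R => mu * (r - s))); first by ctn.
  exact: continuous_expR.
have := @heat_energy_nonincreasing R (lam A) s u ut (lam_gt0 hA) _ _ _ _ n t st.
have -> : (fun z => u z s ^+ n.*2.+2) = (fun z => eps z s ^+ n.*2.+2).
  by apply/funext => z; rewrite /u subrr mulr0 expR0 mul1r.
apply.
- apply: continuous_mul; last exact: ceps.
  apply: (continuous_comp1 (f := fun q : R * R => Num.max s q.2) (g := fun r => expR (mu * (r - s)))) => //.
  by ctn.
- move=> z r sr.
  have D1 : is_derive r (1:R) (fun r : R => mu * (r - s)) mu.
    have D0 : is_derive r (1:R) (fun r : R => r - s) 1.
      by apply: is_derive_eq (is_deriveB (is_derive_id r (1:R)) (is_derive_cst s r (1:R))) _; rewrite subr0.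
    by apply: is_derive_eq (is_deriveM (is_derive_cst mu r (1:R)) D0) _; rewrite /GRing.scale/= mulr1 mulr0 addr0.
  have D2 := @is_derive1_comp R expR (fun r => mu * (r - s)) r _ _ (is_derive_expR _) D1.
  have D3 := eps_is_derive hk hphi t0s hcl z sr.
  apply: is_derive_eq (is_deriveM D2 D3) _.
  by rewrite /GRing.scale/= /ut; ring.
- move=> z r sr; apply: cvgM.
    exact: (continuous_comp1 (@continuous_snd R) cE).
  apply: cvgD; first exact: (eps_t_continuous hk hppi hphi t0s hcl sr).
  apply: cvgM; first exact: cvg_cst.
  have H : {for (z, r), continuous (fun q : R * R => eps q.1 q.2)}.
    apply: (@near_eq_continuous_at _ _ _ (fun q : R * R => eps q.1 (Num.max s q.2))); last exact: ceps.
    near=> q; rewrite max_r// ltW//; near: q.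
    by have := @continuous_snd R (z, r); move=> /(_ _ (near_gt sr)).
  exact: H.
- move=> r sr; have [e1 [ce1 e11 H1 H2]] := eps_heat hA hk hppi hphi t0s hcl sr.
  have lE : lbm (fun y => eps_t y r + mu * eps y r).
    apply: lbm_continuous; apply: continuous_add.
      move=> y; apply: (@continuous_comp _ _ _ (fun z : R => (z, r)) (fun q : R * R => eps_t q.1 q.2)).
        by apply: pair_continuous_at; [exact: cvg_id|exact: cvg_cst].
      exact: (eps_t_continuous hk hppi hphi t0s hcl sr).
    by apply: continuous_mul; [exact: continuous_const|exact: (eps_continuous_z (ltW sr))].
  exists (fun z => expR (mu * (r - s)) * e1 z); split.
  + by apply: continuous_mul => //; exact: continuous_const.
  + by rewrite e11 mulr0.
  + by move=> z z01; rewrite (JZ 0 z _ (lbm_continuous ce1)) H1// /u mulrBr.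
  + by move=> z z01; rewrite mulrCA H2// -(JZ 0 z _ lE).
Unshelve. all: by end_near. Qed.

Lemma eps_L2_decay (t : R) : s <= t ->
  J 0 1 (fun z => eps z t ^+ 2) <= expR (- mu * (t - s)) ^+ 2 * J 0 1 (fun z => eps z s ^+ 2).
Proof.
move=> st; have := eps_energy 0 st; rewrite /=.
have le : lbm (fun z => eps z t ^+ 2).
  by apply: lbm_continuous => z; apply: (@continuous_exp _ _ (eps^~ t)); exact: eps_continuous_z.
have -> : J 0 1 (fun z => (expR (mu * (t - s)) * eps z t) ^+ 2) =
    expR (mu * (t - s)) ^+ 2 * J 0 1 (fun z => eps z t ^+ 2).
  by rewrite -(JZ 0 1 _ le); apply: J_ext => z _; rewrite exprMn.
move=> H; rewrite mulNr expRN exprVn mulrC ler_pdivlMr ?exprn_gt0 ?expR_gt0//.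
by rewrite mulrC.
Qed.

(** The constant depends on the solution through its values at time [s]; this is enough for a limit
    statement about the output. *)
Lemma eps_sup_decay : exists M : R, forall t, s <= t ->
  `|eps 0 t| <= M * expR (- mu * (t - s)).
Proof.
have [C hC] := (lbm_continuous (eps_continuous_z (lexx s))).2 1.
(* [sup_of_moments] asks for a strictly positive bound, hence the summand 1. *)
pose M := `|C| + 1; have M0 : 0 < M by rewrite ltr_wpDl.
exists M => t st.
have cu : continuous (fun z => expR (mu * (t - s)) * eps z t).
  by apply: continuous_mul; [exact: continuous_const|exact: eps_continuous_z].
have H : `|expR (mu * (t - s)) * eps 0 t| <= M.
  apply: (sup_of_moments M0 cu) => n; apply: le_trans (eps_energy n st) _.
  have -> : M ^+ n.*2.+2 = J 0 1 (fun=> M ^+ n.*2.+2) by rewrite J_cst// subr0 mulr1.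
  apply: le_J; [|exact: lbm_cst|].
    by apply: lbm_continuous => z; apply: (@continuous_exp _ _ (eps^~ s)); exact: (eps_continuous_z (lexx s)).
  move=> z /andP[z0 z1].
  have zM : `|eps z s| <= M.
    by rewrite (le_trans (hC z _)) ?ger0_norm// /M (le_trans (ler_norm C))// lerDl.
  rewrite (le_trans (ler_norm _))// normrX.
  by apply: lerXn2r; rewrite ?nnegrE// ltW.
rewrite mulNr expRN ler_pdivlMr ?expR_gt0// mulrC.
by move: H; rewrite normrM (gtr0_norm (expR_gt0 _)).
Qed.

(** The Volterra integral is empty at z = 0, and the output conditions of the regulator equations, c
    pi(0) = p^T and c phi(0) = - gt4, turn c eps(0, t) into the output minus the reference. *)
Lemma output_error (t : R) : s < t ->
  output (fun t => P A *m v t) x t - dot p^T (w t) = c A * eps 0 t.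
Proof.
move=> st; have tt := le_lt_trans t0s st.
have cl0 : cl 0 = 0 :> R by rewrite cl_id// lexx ler01.
rewrite /output /eps /transformed_state cl0 J_gt// subr0.
rewrite -(rr_out hppi) -[dot (g4 A t)^T _]dot_mul -/(gt4 A t).
have -> : gt4 A t = - (c A *: phi 0 t) by rewrite (dr_out hphi tt) opprK.
by rewrite dotN !dotZ; ring.
Qed.

Lemma output_regulation : 0 < mu ->
  (output (fun t => P A *m v t) x t - dot p^T (w t)) @[t --> +oo] --> (0 : R).
Proof.
move=> mu0; have [M HM] := eps_sup_decay.
apply/cvgrPdist_le => e e0.
(* Once t > s + B the product |c| M is at most e mu (t - s), and exp(y) >= 1 + y absorbs it. *)
pose B := `|c A| * M / e / mu.
near=> t.
have st : s < t by near: t; apply: nbhs_pinfty_gt; exact: num_real.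
have Bt : s + B < t by near: t; apply: nbhs_pinfty_gt; exact: num_real.
rewrite (output_error st) sub0r normrN normrM.
have := HM t (ltW st); rewrite mulNr expRN => H.
rewrite (le_trans (ler_wpM2l (normr_ge0 _) H))// mulrA ler_pdivrMr ?expR_gt0//.
have E := expR_ge1Dx (mu * (t - s)).
have : `|c A| * M <= e * (mu * (t - s)).
  rewrite -ler_pdivrMl// [X in X <= _]mulrC -ler_pdivrMl// [X in X <= _]mulrC -/B.
  by rewrite lerBrDl ltW.
by move=> H2; rewrite (le_trans H2)// ler_wpM2l ?(ltW e0)// (le_trans _ E)// lerDr.
Unshelve. all: by end_near. Qed.

(** [xget] returns a member of its set once the set is inhabited, here by the Volterra solution for
    the extended kernel, which agrees with [k] on the triangle. *)
Let Tc_invP (f : R -> R) (t : R) : t0 <= t -> continuous (fun z => f (cl z)) ->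
  {within @I01 R, continuous (Tc_inv k f t)} /\
  forall z, I01 z -> Tc k (Tc_inv k f t) t z = f z.
Proof.
move=> tt cf; have [M [M0 kM _ _ _]] := kap_facts hk.
have [g [cg Hg]] := volterra_solution (kap_continuous2 hk tt) cf M0 (fun z y => kM z y t tt).
rewrite /Tc_inv; apply: (@xgetPex _ (fun=> 0)
  [set g : R -> R | {within @I01 R, continuous g} /\ forall z, I01 z -> Tc k g t z = f z]).
exists g; split; first exact: continuous_subspaceT.
move=> z; rewrite /I01 /= in_itv/= => z01; have /andP[z0 z1] := z01.
have := Hg z z01; rewrite (cl_id z01) => <-; congr (_ - _).
by apply: J_ext => y /andP[y0 yz]; rewrite kap_id// y0.
Qed.

Let Tc_inv_cl (f : R -> R) (t : R) : t0 <= t -> continuous (fun z => f (cl z)) ->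
  continuous (fun z => Tc_inv k f t (cl z)) /\
  forall z : R, 0 <= z <= 1 ->
    f z = Tc_inv k f t (cl z) - J 0 z (fun y => kap z y t * Tc_inv k f t (cl y)).
Proof.
move=> tt cf; have [cT HT] := Tc_invP tt cf; split.
  move=> z.
  have ncl : \forall y \near z, (@I01 R) (cl y).
    by near=> y; rewrite /I01 /= in_itv/=; exact: cl_itv.
  exact: (within_continuous_retract cT (@continuous_cl R z) ncl).
move=> z z01; have /andP[z0 z1] := z01.
rewrite -HT; last by rewrite /I01 /= in_itv.
rewrite /Tc (cl_id z01); congr (_ - _).
apply: J_ext => y /andP[y0 yz]; rewrite kap_id ?y0//.
by rewrite cl_id// y0 (le_trans yz).
Unshelve. all: by end_near. Qed.

(** By linearity, T_c maps the tracking error to T_c x - pi w - phi v, which is [eps]. The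
    continuous [g] replaces the tracking error outside [0, 1], as the L2 estimates work on the
    line. *)
Lemma tracking_error_transform (t : R) : s <= t -> exists g : R -> R,
  [/\ continuous g,
      forall z : R, 0 <= z <= 1 -> tracking_error k ppi phi w v x t z = g z &
      forall z : R, 0 <= z <= 1 -> eps z t = g z - J 0 z (fun y => kap z y t * g y)].
Proof.
move=> st; have tt : t0 <= t := le_trans t0s st.
have hx : strong_regularity s x := as_reg (cl_x hcl).
have cx : continuous (fun z => x (cl z) t).
  have := continuous_section2 (m := fun z t => x (cl z) (Num.max s t)) (y := t) (strong_continuous hx (lexx s)).
  by rewrite (max_r st).
have cpi j : continuous (fun z => ppi (cl z) 0 j).
  by have [H _ _] := C1_in_continuous (rr_reg hppi j).
have cph j : continuous (fun z => phi (cl z) t 0 j).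
  have := continuous_section2 (m := fun z t => phi (cl z) (Num.max s t) 0 j) (y := t) (strong_continuous (dr_reg hphi j) t0s).
  by rewrite (max_r st).
pose Pj j := Tc_inv k (fun y => ppi y 0 j) t.
pose Qj j := Tc_inv k (fun y => phi y t 0 j) t.
have HP j := Tc_inv_cl (f := fun y => ppi y 0 j) tt (cpi j).
have HQ j := Tc_inv_cl (f := fun y => phi y t 0 j) tt (cph j).
have cP j : continuous (fun z => Pj j (cl z)) by case: (HP j).
have cQ j : continuous (fun z => Qj j (cl z)) by case: (HQ j).
have csumP : continuous (fun z => \sum_j Pj j (cl z) * w t j 0).
  by move=> z; apply: continuous_at_sum => j; apply: cvgM; [exact: cP|exact: cvg_cst].
have csumQ : continuous (fun z => \sum_j Qj j (cl z) * v t j 0).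
  by move=> z; apply: continuous_at_sum => j; apply: cvgM; [exact: cQ|exact: cvg_cst].
exists (fun z => x (cl z) t - \sum_j Pj j (cl z) * w t j 0 - \sum_j Qj j (cl z) * v t j 0); split.
- by apply: continuous_sub => //; exact: continuous_sub.
- move=> z z01; rewrite /tracking_error !dotE (cl_id z01); congr (_ - _ - _).
    by apply: eq_bigr => j _; rewrite mxE.
  by apply: eq_bigr => j _; rewrite mxE.
- move=> z z01.
  have ckz := @continuous_section R (fun z y => kap z y t) z (kap_continuous2 hk tt).
  have lk (g : R -> R) : continuous g -> lbm (fun y => kap z y t * g y).
    by move=> cg; apply: lbm_continuous; exact: continuous_mul.
  have Jsum n (Fj : 'I_n -> R -> R) (cj : 'I_n -> R) : (forall j, continuous (Fj j)) ->
      J 0 z (fun y => kap z y t * \sum_j Fj j y * cj j) =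
      \sum_j J 0 z (fun y => kap z y t * Fj j y) * cj j.
    move=> cF; transitivity (J 0 z (fun y => \sum_j cj j * (kap z y t * Fj j y))).
      by apply: J_ext => y _; rewrite mulr_sumr; apply: eq_bigr => j _; ring.
    rewrite J_sum; last by move=> j; apply: lbmZ; exact: lk.
    by apply: eq_bigr => j _; rewrite (JZ 0 z (cj j) (lk _ (cF j))); exact: mulrC.
  have -> : J 0 z (fun y => kap z y t *
      (x (cl y) t - \sum_j Pj j (cl y) * w t j 0 - \sum_j Qj j (cl y) * v t j 0)) =
    J 0 z (fun y => kap z y t * x (cl y) t)
    - \sum_j J 0 z (fun y => kap z y t * Pj j (cl y)) * w t j 0
    - \sum_j J 0 z (fun y => kap z y t * Qj j (cl y)) * v t j 0.
    rewrite -(Jsum _ (fun j y => Pj j (cl y)) _ cP) -(Jsum _ (fun j y => Qj j (cl y)) _ cQ).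
    rewrite -JB; [|exact: lk|exact: lk].
    rewrite -JB; [|by apply: lbmB; exact: lk|exact: lk].
    by apply: J_ext => y _; ring.
  rewrite /eps /transformed_state !dotE (cl_id z01).
  have -> : \sum_j ppi z 0 j * w t j 0 = \sum_j Pj j z * w t j 0
      - \sum_j J 0 z (fun y => kap z y t * Pj j (cl y)) * w t j 0.
    rewrite -sumrB; apply: eq_bigr => j _; have [_ H] := HP j.
    by rewrite (H z z01) (cl_id z01) mulrBl.
  have -> : \sum_j phi z t 0 j * v t j 0 = \sum_j Qj j z * v t j 0
      - \sum_j J 0 z (fun y => kap z y t * Qj j (cl y)) * v t j 0.
    rewrite -sumrB; apply: eq_bigr => j _; have [_ H] := HQ j.
    by rewrite (H z z01) (cl_id z01) mulrBl.
  ring.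
Qed.

(** Inverse transform at time t, decay of [eps], transform at time s: the square root collects the
    two constants for squared norms. *)
Lemma tracking_error_decay (M t : R) : 0 < M ->
  (forall z y t, t0 <= t -> `|kap z y t| <= M) -> s <= t ->
  let e := tracking_error k ppi phi w v x in
  (L2norm (e t) <= (Num.sqrt (2 * expR (2 * M ^+ 2) * (2 + 2 * M ^+ 2)) *
     expR (- mu * (t - s)))%:E * L2norm (e s))%E.
Proof.
move=> M0 kM st /=.
have [g [cg Eg Tg]] := tracking_error_transform st.
have [g0 [cg0 Eg0 Tg0]] := tracking_error_transform (lexx s).
rewrite (L2normE cg Eg) (L2normE cg0 Eg0) -EFinM lee_fin.
have B1 := L2_inverse_transform_le (kap_continuous2 hk (le_trans t0s st)) M0
  (fun z y => kM z y t (le_trans t0s st)) cg (eps_continuous_z st) Tg.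
have B2 := L2_transform_le (kap_continuous2 hk t0s) M0
  (fun z y => kM z y s t0s) cg0 (eps_continuous_z (lexx s)) Tg0.
have B3 := eps_L2_decay st.
set C1 := 2 * expR (2 * M ^+ 2) in B1 *; set C2 := 2 + 2 * M ^+ 2 in B2 *.
have C10 : 0 <= C1 by rewrite mulr_ge0// expR_ge0.
have C20 : 0 <= C2 by rewrite addr_ge0// mulr_ge0// sqr_ge0.
set E := expR (- mu * (t - s)) in B3 *.
have E0 : 0 <= E by exact: expR_ge0.
have E20 : 0 <= E ^+ 2 by exact: sqr_ge0.
have -> : Num.sqrt (C1 * C2) * E = Num.sqrt (C1 * C2 * E ^+ 2).
  by rewrite [in RHS]sqrtrM ?mulr_ge0// sqrtr_sqr ger0_norm.
rewrite -sqrtrM ?mulr_ge0//; apply: ler_wsqrtr.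
apply: le_trans B1 _; rewrite -[C1 * C2 * _]mulrA -[X in _ <= X]mulrA ler_wpM2l//.
by apply: le_trans B3 _; rewrite (mulrC C2 (_ ^+ 2)) -[X in _ <= X]mulrA ler_wpM2l.
Qed.

End Decay.

Theorem theorem4 (R : realType) (N nw : nat) (alpha t0 : R)
    (S : 'M[R]_nw) (p : 'cV[R]_nw)
    (A : 'I_N -> agent R) (mu : 'I_N -> R)
    (k : 'I_N -> R -> R -> R -> R)
    (ppi : 'I_N -> R -> 'rV[R]_nw)
    (phi : forall i : 'I_N, R -> R -> 'rV[R]_(nv (A i)))
    (halpha : 1 <= alpha < 2)
    (ht0 : 0 <= t0)
    (hp : observable p^T S)
    (hS : imaginary_spectrum S)
    (hA : forall i, admissible alpha t0 (A i))
    (hmu : forall i, 0 < mu i)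
    (hk : forall i, kernel_solution alpha t0 (A i) (mu i) (k i))
    (hppi : forall i, reference_regulator S p (A i) (mu i) (ppi i))
    (hphi : forall i, disturbance_regulator t0 (k i) (mu i) (phi i)) :
  forall i : 'I_N,
    (forall (s : R) (w : R -> 'cV[R]_nw) (v : R -> 'cV[R]_(nv (A i)))
            (x : R -> R -> R),
       t0 <= s ->
       closed_loop S (k i) (ppi i) (phi i) s w v x ->
       (output (fun t => P (A i) *m v t) x t - dot p^T (w t))
         @[t --> +oo] --> (0 : R))
    /\
    (exists M : R, 1 <= M /\
       forall (s : R) (w : R -> 'cV[R]_nw) (v : R -> 'cV[R]_(nv (A i)))
              (x : R -> R -> R),
         t0 <= s ->
         closed_loop S (k i) (ppi i) (phi i) s w v x ->
         let e := tracking_error (k i) (ppi i) (phi i) w v x in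
         H2 (e s) ->
         error_bc (k i) s (e s) ->
         forall t : R, s <= t ->
           (L2norm (e t) <= (M * expR (- mu i * (t - s)))%:E * L2norm (e s))%E).
Proof.
move=> i; split.
  move=> s w v x t0s hcl.
  exact: (output_regulation (hA i) (hk i) (hppi i) (hphi i) t0s hcl (hmu i)).
(* The kernel bound is fixed before the initial time and the solution are introduced, so one
   constant serves them all. *)
have [M [M0 kM _ _ _]] := kap_facts (hk i).
exists (Num.sqrt (2 * expR (2 * M ^+ 2) * (2 + 2 * M ^+ 2))); split.
  rewrite -[X in X <= _]sqrtr1; apply: ler_wsqrtr.
  have M2 : 0 <= M ^+ 2 by exact: sqr_ge0.
  have E1 : 1 <= expR (2 * M ^+ 2).
    by apply: le_trans (expR_ge1Dx _); rewrite lerDl mulr_ge0.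
  nra.
move=> s w v x t0s hcl e _ _ t st.
exact: (tracking_error_decay (hA i) (hk i) (hppi i) (hphi i) t0s hcl M0 kM st).
Qed.
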